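(* Let $A=\mathbb{F}_q[t]$, $F=\mathbb{F}_q(t)$, $n\ge1$ and $r\ge1$. The ring $R_n$ is Cohen-Macaulay.
   Context: $\mathbb{F}_q$ is a finite field with $q$ elements, $A=\mathbb{F}_q[t]$, $F=\mathbb{F}_q(t)$. For $0\le\nu\le n$ put $V_\nu=(t^{-\nu}A/A)^{\oplus r}$, so $V_0=0$ and $V_\nu\subset V_n$ is the $t^\nu$-torsion submodule. For a finite dimensional $\mathbb{F}_q$-vector space $V$ let $K_V$ be the field of quotients of the symmetric algebra of $V$ over $\mathbb{F}_q$, and $R_V\subset K_V$ the $\mathbb{F}_q$-subalgebra generated by the elements $\frac1v$ for all $v\in V\setminus\{0\}$. $R_n$ is the factor ring of $R_{V_n}\otimes_{\mathbb{F}_q}F$ by the ideal generated by the elements $\frac{1}{av}\otimes a-\sum_{v'\in V_\nu}\frac{1}{v-v'}\otimes1$ for all $a=\alpha t^\nu$ with $\alpha\in\mathbb{F}_q^\times$, $0\le\nu\le n$, and all $v\in V_n\setminus V_\nu$. *)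

(* Defs.v *)
From HB Require Import structures.
From mathcomp Require Import all_boot all_order all_algebra.
From mathcomp Require Import boolp classical_sets.
From mathcomp Require Import freeg mpoly ring.

Set Implicit Arguments.
Unset Strict Implicit.
Unset Printing Implicit Defensive.

Import Order.TTheory GRing.Theory.
Local Open Scope classical_set_scope.
Local Open Scope quotient_scope.
Local Open Scope ring_scope.

Section GeneratedSubgroup.
Variables (V : zmodType) (S : set V).

Definition zmod_gen : {pred V} :=
  [pred x | `[< smallest (fun M => zmod_closed (mem M)) S x >]].

Lemma zmod_gen_closed : zmod_closed zmod_gen.
Proof.
split=> [|x y /asboolP Sx /asboolP Sy]; apply/asboolP => M [cM SM].
  by have /set_mem := cM.1.
by apply: set_mem; apply: cM.2; apply: mem_set; [apply: Sx|apply: Sy].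
Qed.

HB.instance Definition _ := GRing.isZmodClosed.Build V zmod_gen zmod_gen_closed.

Lemma mem_zmod_gen x : S x -> x \in zmod_gen.
Proof. by move=> Sx; apply/asboolP => M [_]; apply. Qed.

Lemma zmod_gen_sub (P : zmodClosed V) :
  (forall x, S x -> x \in P) -> {subset zmod_gen <= P}.
Proof.
move=> SP x /asboolP /(_ (fun y => y \in P)); apply; split; last exact: SP.
split=> [|u v /set_mem /= uP /set_mem /= vP]; apply: mem_set.
  exact: rpred0.
exact: rpredB.
Qed.

End GeneratedSubgroup.

Section TensorProduct.
Variables (k B C : comPzRingType) (f : {rmorphism k -> B}) (g : {rmorphism k -> C}).

(* B and C are k-algebras through f and g; the additive group of B ⊗_k C is
   the free abelian group on B × C modulo the k-balanced bilinear relations. *)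
Definition tensor_rel : set {freeg (B * C)} :=
  [set x | exists b b' c, x = << (b + b', c) >> - << (b, c) >> - << (b', c) >>]
  `|` [set x | exists b c c', x = << (b, c + c') >> - << (b, c) >> - << (b, c') >>]
  `|` [set x | exists a b c, x = << (f a * b, c) >> - << (b, g a * c) >>].

Definition tensor := Quotient.quot (zmod_gen tensor_rel).
HB.instance Definition _ := GRing.Zmodule.on tensor.

Definition tens (b : B) (c : C) : tensor := \pi << (b, c) >>.

Lemma tens_pi (u v : {freeg (B * C)}) :
  u - v \in zmod_gen tensor_rel -> \pi_tensor u = \pi_tensor v.
Proof. by move=> uv; apply/eqP; rewrite -Quotient.idealrBE. Qed.

Lemma tensor_piD (u v : {freeg (B * C)}) :
  \pi_tensor u + \pi_tensor v = \pi_tensor (u + v).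
Proof. by rewrite piE. Qed.

Lemma tensDl b b' c : tens (b + b') c = tens b c + tens b' c.
Proof.
rewrite tensor_piD; apply: tens_pi; rewrite opprD addrA; apply: mem_zmod_gen.
by left; left; exists b, b', c.
Qed.

Lemma tensDr b c c' : tens b (c + c') = tens b c + tens b c'.
Proof.
rewrite tensor_piD; apply: tens_pi; rewrite opprD addrA; apply: mem_zmod_gen.
by left; right; exists b, c, c'.
Qed.

Lemma tensM a b c : tens (f a * b) c = tens b (g a * c).
Proof. by apply: tens_pi; apply: mem_zmod_gen; right; exists a, b, c. Qed.

Lemma tensor_ind (P : tensor -> Prop) :
  (forall b c, P (tens b c)) -> (forall x y, P x -> P y -> P (x - y)) ->
  forall x, P x.
Proof.
move=> Pt PB.
have P0 : P 0 by rewrite -(subrr (tens 0 0)); apply: PB.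
have PN x : P x -> P (- x) by move=> Px; rewrite -sub0r; apply: PB.
have PD x y : P x -> P y -> P (x + y).
  by move=> Px Py; rewrite -[y]opprK; apply: PB => //; apply: PN.
have PZ (m : int) x : P x -> P (x *~ m).
  move=> Px; have Pn n : P (x *+ n).
    by elim: n => [|n IH]; rewrite ?mulr0n // mulrS; apply: PD.
  by case: m => n; [exact: Pn | apply: PN; exact: Pn].
elim/quotW => u; rewrite -[u]Freeg_dom.
have -> : [freeg [seq (coeff x u, x) | x <- dom u]] =
    \sum_(x <- dom u) << x >> *~ coeff x u.
  elim: (dom u) => [|x s IH]; first by rewrite big_nil.
  rewrite big_cons -IH freegU_mulz.
  apply/eqP/freeg_eqP => y; rewrite coeffD !coeff_Freeg !precoeff_cons.
  by rewrite precoeff_nil addr0 intz.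
elim: (dom u) => [|x s IH]; first by rewrite big_nil raddf0.
rewrite big_cons -tensor_piD; apply: PD => //.
rewrite raddfMz; apply: PZ; case: x => b c; exact: Pt.
Qed.

Section Lift.
Variables (M : zmodType) (h : B -> C -> M).

Definition balanced :=
  [/\ forall b b' c, h (b + b') c = h b c + h b' c,
      forall b c c', h b (c + c') = h b c + h b c'
    & forall a b c, h (f a * b) c = h b (g a * c)].

Definition tlift (x : tensor) : M :=
  fglift (fun p => h p.1 p.2 : zmodule M) (repr x).

Hypothesis hP : balanced.

Let pre : {freeg (B * C)} -> M := fglift (fun p => h p.1 p.2 : zmodule M).

Let preB : zmod_morphism pre.
Proof.
exact: (lift_is_additive (M := zmodule M) (fun p => h p.1 p.2 : zmodule M)).
Qed.

Let preU p : pre << p >> = h p.1 p.2.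
Proof. by rewrite /pre liftU scale1r. Qed.

Lemma tlift_pi u : tlift (\pi u) = pre u.
Proof.
pose K : {pred {freeg (B * C)}} := [pred u | pre u == 0].
have Kc : zmod_closed K.
  split=> [|v w]; rewrite !inE.
    by have := preB 0 0; rewrite !subrr => ->.
  by move=> /eqP hv /eqP hw; rewrite preB hv hw subrr.
pose Ki := GRing.isZmodClosed.Build _ K Kc.
pose Ks : zmodClosed _ := HB.pack K Ki.
suff sub : {subset zmod_gen tensor_rel <= Ks}.
  apply/eqP; rewrite -subr_eq0 -preB; apply: (sub (repr (\pi_tensor u) - u)).
  by rewrite Quotient.idealrBE reprK.
have [hDl hDr hM] := hP.
apply: zmod_gen_sub => v [[]|] [b [b' [c ->]]]; apply/eqP; rewrite !preB !preU.
- by rewrite [h _ _]hDl addrAC addrK subrr.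
- by rewrite [h _ _]hDr addrAC addrK subrr.
- by rewrite [h _ _]hM subrr.
Qed.

Lemma tlift_tens b c : tlift (tens b c) = h b c.
Proof. by rewrite tlift_pi preU. Qed.

Lemma tlift_is_zmod_morphism : zmod_morphism tlift.
Proof.
move=> x y; rewrite -[x]reprK -[y]reprK.
have -> : \pi_tensor (repr x) - \pi_tensor (repr y) = \pi_tensor (repr x - repr y).
  by rewrite [RHS]raddfB.
by rewrite !tlift_pi preB.
Qed.

End Lift.

Definition tensor_mul (x y : tensor) : tensor :=
  tlift (fun b c => tlift (fun b' c' => tens (b * b') (c * c')) y) x.

Let inner_balanced b c : balanced (fun b' c' => tens (b * b') (c * c')).
Proof.
split=> [b1 b2 c1|b1 c1 c2|a b1 c1]; rewrite ?mulrDr ?tensDl ?tensDr //.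
by rewrite mulrCA tensM mulrCA.
Qed.

Let outer_balanced y :
  balanced (fun b c => tlift (fun b' c' => tens (b * b') (c * c')) y).
Proof.
split=> [b1 b2 c1|b1 c1 c2|a b1 c1]; move: y; apply: tensor_ind => [b c|x y hx hy].
- by rewrite !tlift_tens ?mulrDl ?tensDl.
- by rewrite !tlift_is_zmod_morphism // hx hy opprD addrACA.
- by rewrite !tlift_tens ?mulrDl ?tensDr.
- by rewrite !tlift_is_zmod_morphism // hx hy opprD addrACA.
- by rewrite !tlift_tens // -!mulrA tensM.
- by rewrite !tlift_is_zmod_morphism // hx hy.
Qed.

Lemma tensor_mul_tens b c b' c' :
  tensor_mul (tens b c) (tens b' c') = tens (b * b') (c * c').
Proof. by rewrite /tensor_mul !tlift_tens. Qed.

Let tensor_mulBl x y z : tensor_mul (x - y) z = tensor_mul x z - tensor_mul y z.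
Proof. by rewrite /tensor_mul tlift_is_zmod_morphism. Qed.

Let tensor_mulC : commutative tensor_mul.
Proof.
have mulBr b c x y :
    tensor_mul (tens b c) (x - y) = tensor_mul (tens b c) x - tensor_mul (tens b c) y.
  by rewrite /tensor_mul !tlift_tens // tlift_is_zmod_morphism.
move=> x y; elim/tensor_ind: x => [b c|x1 x2 h1 h2].
  elim/tensor_ind: y => [b' c'|y1 y2 h1 h2].
    by rewrite !tensor_mul_tens mulrC [c * _]mulrC.
  by rewrite mulBr h1 h2 tensor_mulBl.
have mulBr' z : tensor_mul z (x1 - x2) = tensor_mul z x1 - tensor_mul z x2.
  elim/tensor_ind: z => [b c|z1 z2 e1 e2]; first exact: mulBr.
  rewrite !tensor_mulBl e1 e2 !opprB [LHS]addrACA [RHS]addrACA.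
  by congr (_ + _); rewrite addrC.
by rewrite tensor_mulBl h1 h2 mulBr'.
Qed.

Let tensor_mulBr x y z : tensor_mul x (y - z) = tensor_mul x y - tensor_mul x z.
Proof. by rewrite tensor_mulC tensor_mulBl ![tensor_mul _ x]tensor_mulC. Qed.

Let tensor_mulA : associative tensor_mul.
Proof.
move=> x y z; elim/tensor_ind: x => [b c|x1 x2 h1 h2]; last first.
  by rewrite !tensor_mulBl h1 h2.
elim/tensor_ind: y => [b' c'|y1 y2 h1 h2]; last first.
  by rewrite tensor_mulBl !tensor_mulBr tensor_mulBl h1 h2.
elim/tensor_ind: z => [b'' c''|z1 z2 h1 h2]; last first.
  by rewrite !tensor_mulBr h1 h2.
by rewrite !tensor_mul_tens !mulrA.
Qed.

Let tensor_mul1 : left_id (tens 1 1) tensor_mul.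
Proof.
move=> x; elim/tensor_ind: x => [b c|x1 x2 h1 h2].
  by rewrite tensor_mul_tens !mul1r.
by rewrite tensor_mulBr h1 h2.
Qed.

Let tensor_mulDl : left_distributive tensor_mul +%R.
Proof.
move=> x y z; rewrite -[y in LHS]opprK tensor_mulBl; congr (_ + _).
by rewrite -[- y]sub0r tensor_mulBl -[in X in X - _](subrr y) tensor_mulBl
           subrr sub0r opprK.
Qed.

HB.instance Definition _ := GRing.Zmodule_isComPzRing.Build tensor
  tensor_mulA tensor_mulC tensor_mul1 tensor_mulDl.

Lemma tens_mul b c b' c' : tens b c * tens b' c' = tens (b * b') (c * c').
Proof. exact: tensor_mul_tens. Qed.

Lemma tens1 : tens 1 1 = 1. Proof. by []. Qed.

End TensorProduct.

Arguments tens {k B C f g} b c.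

Section Ideals.
Variable R : comPzRingType.
Implicit Types (I J P M S : set R) (s : seq R).

Definition ideal I :=
  [/\ I 0, forall x y, I x -> I y -> I (x + y) & forall a x, I x -> I (a * x)].

Definition ideal_gen S : set R := smallest ideal S.

Definition prime_ideal P :=
  [/\ ideal P, ~ P 1 & forall x y, P (x * y) -> P x \/ P y].

Definition maximal_ideal M :=
  [/\ ideal M, ~ M 1 & forall J, ideal J -> ~ J 1 -> M `<=` J -> J = M].

Definition noetherian :=
  forall I, ideal I -> exists s, I = ideal_gen [set` s].

Lemma ideal_gen_ideal S : ideal (ideal_gen S).
Proof.
split=> [|x y Sx Sy|a x Sx] J [cJ SJ]; have [J0 JD JM] := cJ => //.
  by apply: JD; [apply: Sx | apply: Sy].
by apply: JM; apply: Sx.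
Qed.

End Ideals.

Section QuotientRing.
Variables (R : comPzRingType) (S : set R).

Definition ideal_pred : {pred R} := [pred x | `[< ideal_gen S x >]].

Lemma ideal_pred_zmod_closed : zmod_closed ideal_pred.
Proof.
have [S0 SD SM] := ideal_gen_ideal S.
split=> [|x y /asboolP Sx /asboolP Sy]; apply/asboolP => //.
by apply: SD => //; rewrite -mulN1r; apply: SM.
Qed.

HB.instance Definition _ :=
  GRing.isZmodClosed.Build R ideal_pred ideal_pred_zmod_closed.

(* R / (S); the library's {ideal_quot _} only covers proper ideals. *)
Definition quot_ring := Quotient.quot ideal_pred.
HB.instance Definition _ := GRing.Zmodule.on quot_ring.
HB.instance Definition _ := EqQuotient.on quot_ring.

Let quot_mul : quot_ring -> quot_ring -> quot_ring :=
  fun x y => \pi_quot_ring (repr x * repr y).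

Let idealMl (a : R) x : x \in ideal_pred -> a * x \in ideal_pred.
Proof.
have [_ _ SM] := ideal_gen_ideal S.
by move=> /asboolP Sx; apply/asboolP; apply: SM.
Qed.

Let quot_mul_pi x y : quot_mul (\pi_quot_ring x) (\pi_quot_ring y) = \pi_quot_ring (x * y).
Proof.
apply/eqP; rewrite -Quotient.idealrBE.
set x' := repr _; set y' := repr _.
have -> : x' * y' - x * y = y' * (x' - x) + x * (y' - y).
  by rewrite !mulrBr addrA mulrC [y' * x]mulrC subrK.
by apply: rpredD; apply: idealMl; rewrite Quotient.idealrBE reprK.
Qed.

Let quotP (x : quot_ring) : exists r, x = \pi_quot_ring r.
Proof. by exists (repr x); rewrite reprK. Qed.

Let quot_mulA : associative quot_mul.
Proof.
move=> x y z; have [a ->] := quotP x; have [b ->] := quotP y.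
by have [c ->] := quotP z; rewrite !quot_mul_pi mulrA.
Qed.

Let quot_mulC : commutative quot_mul.
Proof. by move=> x y; rewrite /quot_mul mulrC. Qed.

Let quot_mul1 : left_id (\pi_quot_ring 1) quot_mul.
Proof. by move=> x; have [a ->] := quotP x; rewrite quot_mul_pi mul1r. Qed.

Let quot_mulDl : left_distributive quot_mul +%R.
Proof.
move=> x y z; have [a ->] := quotP x; have [b ->] := quotP y.
have [c ->] := quotP z; rewrite !quot_mul_pi.
have piD u v : \pi_quot_ring u + \pi_quot_ring v = \pi_quot_ring (u + v).
  by rewrite [RHS]raddfD.
by rewrite !piD quot_mul_pi mulrDl.
Qed.

HB.instance Definition _ := GRing.Zmodule_isComPzRing.Build quot_ring
  quot_mulA quot_mulC quot_mul1 quot_mulDl.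

Lemma quot_ring_pi_is_monoid_morphism : monoid_morphism \pi_quot_ring.
Proof. by split=> // x y; rewrite /= -quot_mul_pi. Qed.

HB.instance Definition _ := GRing.isMonoidMorphism.Build R quot_ring
  \pi_quot_ring quot_ring_pi_is_monoid_morphism.

Lemma quot_ring_pi_eq0 x : \pi_quot_ring x = 0 <-> ideal_gen S x.
Proof.
rewrite -(raddf0 \pi_quot_ring); split=> [/eqP|Sx].
  by rewrite -Quotient.idealrBE subr0 => /asboolP.
by apply/eqP; rewrite -Quotient.idealrBE subr0; apply/asboolP.
Qed.

End QuotientRing.

Section Localization.
Variables (R : comPzRingType) (D : {pred R}) (mulD : mulr_closed D).

Definition lfrac : Type := {x : R * R | x.2 \in D}.
HB.instance Definition _ := Choice.on lfrac.

Definition mklfrac (a s : R) (sD : s \in D) : lfrac := exist _ (a, s) sD.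
Definition lnum (x : lfrac) := (val x).1.
Definition lden (x : lfrac) := (val x).2.

Lemma den_in x : lden x \in D. Proof. exact: (valP x). Qed.
Lemma denM x y : lden x * lden y \in D.
Proof. by apply: mulD.2; apply: den_in. Qed.

(* a/s = b/t iff u (a t) = u (b s) for some u in D *)
Definition frac_rel : rel lfrac := fun x y =>
  `[< exists2 u, u \in D & u * (lnum x * lden y) = u * (lnum y * lden x) >].

Lemma frac_rel_equiv : equiv_class_of frac_rel.
Proof.
split=> [x|x y|y x z].
- by apply/asboolP; exists 1; first exact: mulD.1.
- by apply/asboolP/asboolP => -[u uD e]; exists u.
move=> /asboolP[u uD e] /asboolP[w wD e']; apply/asboolP.
exists (u * w * lden y).
  by apply: mulD.2; [apply: mulD.2 | apply: den_in].
have -> : u * w * lden y * (lnum x * lden z) = w * lden z * (u * (lnum x * lden y)).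
  by ring.
rewrite e.
have -> : w * lden z * (u * (lnum y * lden x)) = u * lden x * (w * (lnum y * lden z)).
  by ring.
rewrite e'.
by ring.
Qed.

Let frac_equiv := EquivRelPack frac_rel_equiv.
Canonical frac_rel_equivrel := frac_equiv.
Canonical frac_rel_enc := defaultEncModRel frac_rel.

Definition localization := {eq_quot frac_rel}.
HB.instance Definition _ := EqQuotient.on localization.
HB.instance Definition _ := Choice.on localization.

Definition lfrac_class (x : lfrac) : localization := \pi_localization x.

Lemma lfrac_classP x y :
  reflect (exists2 u, u \in D & u * (lnum x * lden y) = u * (lnum y * lden x))
          (lfrac_class x == lfrac_class y).
Proof. by rewrite /lfrac_class eqmodE; apply: asboolP. Qed.

Let classW (x : localization) : exists p, x = lfrac_class p.
Proof. by exists (repr x); rewrite /lfrac_class reprK. Qed.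

Let class_eq x y u : u \in D ->
  u * (lnum x * lden y) = u * (lnum y * lden x) -> lfrac_class x = lfrac_class y.
Proof. by move=> uD e; apply/eqP/lfrac_classP; exists u. Qed.

Let reprP (x : lfrac) : exists2 u, u \in D &
  u * (lnum (repr (lfrac_class x)) * lden x)
    = u * (lnum x * lden (repr (lfrac_class x))).
Proof. by apply/lfrac_classP; rewrite /lfrac_class reprK. Qed.

Definition lfrac_add (x y : lfrac) :=
  mklfrac (lnum x * lden y + lnum y * lden x) (denM x y).
Definition lfrac_mul (x y : lfrac) := mklfrac (lnum x * lnum y) (denM x y).
Definition lfrac_opp (x : lfrac) := mklfrac (- lnum x) (den_in x).

Let num_mk a s (sD : s \in D) : lnum (mklfrac a sD) = a. Proof. by []. Qed.
Let den_mk a s (sD : s \in D) : lden (mklfrac a sD) = s. Proof. by []. Qed.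
Let num_add x y : lnum (lfrac_add x y) = lnum x * lden y + lnum y * lden x. Proof. by []. Qed.
Let den_add x y : lden (lfrac_add x y) = lden x * lden y. Proof. by []. Qed.
Let num_mul x y : lnum (lfrac_mul x y) = lnum x * lnum y. Proof. by []. Qed.
Let den_mul x y : lden (lfrac_mul x y) = lden x * lden y. Proof. by []. Qed.
Let num_opp x : lnum (lfrac_opp x) = - lnum x. Proof. by []. Qed.
Let den_opp x : lden (lfrac_opp x) = lden x. Proof. by []. Qed.
Let fracE := (num_add, den_add, num_mul, den_mul, num_opp, den_opp, num_mk, den_mk).

Let add (x y : localization) := lfrac_class (lfrac_add (repr x) (repr y)).
Let mul (x y : localization) := lfrac_class (lfrac_mul (repr x) (repr y)).
Let opp (x : localization) := lfrac_class (lfrac_opp (repr x)).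

Let add_class x y : add (lfrac_class x) (lfrac_class y) = lfrac_class (lfrac_add x y).
Proof.
have [u uD ex] := reprP x; have [w wD ey] := reprP y.
apply: (@class_eq _ _ (u * w)); first exact: mulD.2.
rewrite /add !fracE.
move: (repr (lfrac_class x)) (repr (lfrac_class y)) ex ey => x' y' ex ey.
transitivity (u * (lnum x' * lden x) * (w * lden y' * lden y) +
              w * (lnum y' * lden y) * (u * lden x' * lden x)); first by ring.
by rewrite ex ey; ring.
Qed.

Let mul_class x y : mul (lfrac_class x) (lfrac_class y) = lfrac_class (lfrac_mul x y).
Proof.
have [u uD ex] := reprP x; have [w wD ey] := reprP y.
apply: (@class_eq _ _ (u * w)); first exact: mulD.2.
rewrite /mul !fracE.
move: (repr (lfrac_class x)) (repr (lfrac_class y)) ex ey => x' y' ex ey.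
transitivity ((u * (lnum x' * lden x)) * (w * (lnum y' * lden y))); first by ring.
by rewrite ex ey; ring.
Qed.

Let opp_class x : opp (lfrac_class x) = lfrac_class (lfrac_opp x).
Proof.
have [u uD ex] := reprP x; apply: (@class_eq _ _ u) => //.
rewrite /opp !fracE.
by move: ex; rewrite !mulNr !mulrN => ->.
Qed.

Let of_base (a : R) := lfrac_class (mklfrac a mulD.1).

Let addA : associative add.
Proof.
move=> x y z; have [a ->] := classW x; have [b ->] := classW y.
have [c ->] := classW z; rewrite !add_class; apply: (class_eq mulD.1).
by rewrite !fracE; ring.
Qed.

Let addC : commutative add.
Proof.
move=> x y; have [a ->] := classW x; have [b ->] := classW y.
rewrite !add_class; apply: (class_eq mulD.1).
by rewrite !fracE; ring.
Qed.

Let add0 : left_id (of_base 0) add.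
Proof.
move=> x; have [a ->] := classW x; rewrite add_class; apply: (class_eq mulD.1).
by rewrite !fracE; ring.
Qed.

Let addN : left_inverse (of_base 0) opp add.
Proof.
move=> x; have [a ->] := classW x; rewrite opp_class add_class.
apply: (class_eq mulD.1).
by rewrite !fracE; ring.
Qed.

Let mulA : associative mul.
Proof.
move=> x y z; have [a ->] := classW x; have [b ->] := classW y.
have [c ->] := classW z; rewrite !mul_class; apply: (class_eq mulD.1).
by rewrite !fracE; ring.
Qed.

Let mulC : commutative mul.
Proof.
move=> x y; have [a ->] := classW x; have [b ->] := classW y.
rewrite !mul_class; apply: (class_eq mulD.1).
by rewrite !fracE; ring.
Qed.

Let mul1 : left_id (of_base 1) mul.
Proof.
move=> x; have [a ->] := classW x; rewrite mul_class; apply: (class_eq mulD.1).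
by rewrite !fracE; ring.
Qed.

Let mulDl : left_distributive mul add.
Proof.
move=> x y z; have [a ->] := classW x; have [b ->] := classW y.
have [c ->] := classW z; rewrite !(add_class, mul_class).
apply: (class_eq mulD.1).
by rewrite !fracE; ring.
Qed.

HB.instance Definition _ := GRing.isZmodule.Build localization addA addC add0 addN.
HB.instance Definition _ :=
  GRing.Zmodule_isComPzRing.Build localization mulA mulC mul1 mulDl.

Lemma lfrac_class_add x y :
  lfrac_class x + lfrac_class y = lfrac_class (lfrac_add x y).
Proof. exact: add_class. Qed.

Lemma lfrac_class_mul x y :
  lfrac_class x * lfrac_class y = lfrac_class (lfrac_mul x y).
Proof. exact: mul_class. Qed.

End Localization.

Section CohenMacaulay.

Definition is_local (R : comPzRingType) (M : set R) :=
  maximal_ideal M /\ forall M', maximal_ideal M' -> M' = M.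

Definition prime_chain (R : comPzRingType) (P : nat -> set R) (d : nat) :=
  (forall i, (i <= d)%N -> prime_ideal (P i)) /\
  (forall i, (i < d)%N -> P i `<` P i.+1).

(* R has finite Krull dimension d. *)
Definition krull_dim (R : comPzRingType) (d : nat) :=
  (exists P : nat -> set R, prime_chain P d) /\
  (forall (P : nat -> set R) e, prime_chain P e -> (e <= d)%N).

Definition regular_seq (R : comPzRingType) (s : seq R) :=
  (forall i x, (i < size s)%N ->
     ideal_gen [set` take i s] (s`_i * x) -> ideal_gen [set` take i s] x) /\
  ~ ideal_gen [set` s] 1.

(* M is meant to be the maximal ideal of a local ring, and depth its maximal
   length of a regular sequence in M. *)
Definition depth_in (R : comPzRingType) (M : set R) (d : nat) :=
  (exists s, [/\ regular_seq s, [set` s] `<=` M & size s = d]) /\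
  (forall s, regular_seq s -> [set` s] `<=` M -> (size s <= d)%N).

Definition cohen_macaulay_local (R : comPzRingType) :=
  noetherian R /\
  exists (M : set R) (d : nat), [/\ is_local M, krull_dim R d & depth_in M d].

Definition complement (R : comPzRingType) (P : set R) : {pred R} :=
  [pred x | `[< ~ P x >]].

Lemma complement_mulr_closed (R : comPzRingType) (P : set R) :
  prime_ideal P -> mulr_closed (complement P).
Proof.
move=> [_ P1 PM]; split=> [|x y /asboolP Px /asboolP Py]; apply/asboolP => //.
by case/PM.
Qed.

Definition localization_at (R : comPzRingType) (P : set R) (hP : prime_ideal P) :=
  localization (complement_mulr_closed hP).
HB.instance Definition _ R P hP := GRing.ComPzRing.on (@localization_at R P hP).

Lemma maximal_prime (R : comPzRingType) (M : set R) :
  maximal_ideal M -> prime_ideal M.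
Proof.
move=> [[M0 MD MM] M1 Mmax]; split=> // x y Mxy.
have [Mx|nMx] := pselect (M x); [by left | right].
pose J : set R := [set z | exists m a, M m /\ z = m + a * x].
have cJ : ideal J.
  split=> [|_ _ [m [a [Mm ->]]] [m' [a' [Mm' ->]]]|b _ [m [a [Mm ->]]]].
  - by exists 0, 0; rewrite mul0r addr0.
  - by exists (m + m'), (a + a'); split; [exact: MD | ring].
  - by exists (b * m), (b * a); split; [exact: MM | ring].
have [[m [a [Mm e]]]|J1] := pselect (J 1).
  have -> : y = y * m + a * (x * y) by rewrite -[LHS]mulr1 e; ring.
  by apply: MD; exact: MM.
case: nMx; rewrite -(Mmax J) //; first by exists 0, 1; split; [|ring].
by move=> z Mz; exists z, 0; rewrite mul0r addr0.
Qed.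

(* Bruns-Herzog, Definition 2.1.1; the zero ring satisfies it vacuously. *)
Definition cohen_macaulay (R : comPzRingType) :=
  noetherian R /\
  forall (M : set R) (hM : maximal_ideal M),
    cohen_macaulay_local (localization_at (maximal_prime hM)).

End CohenMacaulay.

Local Notation "x %:F" := (@tofrac _ x).

Section SymmetricAlgebra.
Variables (k : fieldType) (V : vectType k).

(* Sym V is realised as the polynomial ring on a basis of V; sym_inj is the
   canonical embedding, and sym_universal is the universal property. *)
Definition Sym := {mpoly k[\dim {:V}]}.

Definition sym_inj (v : V) : Sym :=
  \sum_(i < \dim {:V}) coord (vbasis {:V}) i v *: 'X_i.

Lemma sym_inj_linear : linear sym_inj.
Proof.
move=> a u v; rewrite /sym_inj scaler_sumr -big_split /=.
by apply: eq_bigr => i _; rewrite linearP scalerDl scalerA.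
Qed.

Lemma sym_universal (B : comAlgType k) (h : {linear V -> B}) :
  exists phi : {lrmorphism Sym -> B},
    (forall v, phi (sym_inj v) = h v) /\
    (forall psi : {lrmorphism Sym -> B},
       (forall v, psi (sym_inj v) = h v) -> psi =1 phi).
Proof.
pose g (i : 'I_(\dim {:V})) := h (vbasis {:V})`_i.
pose phi0 : {rmorphism Sym -> B} := mmap (in_alg B) g.
have phi0Z : scalable phi0.
  by move=> c p; rewrite /phi0 /= mmapZ /= mulr_algl.
pose phi : {lrmorphism Sym -> B} :=
  HB.pack (phi0 : Sym -> B) (GRing.RMorphism.on phi0)
    (GRing.isScalable.Build k Sym B _ phi0 phi0Z).
have phiX i : phi 'X_i = g i by rewrite /= mmapX mmap1U.
have phi_inj v : phi (sym_inj v) = h v.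
  rewrite [in RHS](coord_vbasis (memvf v)) !linear_sum.
  apply: eq_bigr => i _; rewrite !linearZ; congr (_ *: _); exact: phiX.
exists phi; split=> // psi psi_inj p.
have symX (i : 'I_(\dim {:V})) : sym_inj (vbasis {:V})`_i = 'X_i.
  rewrite /sym_inj (bigD1 i) //= coord_free ?(basis_free (vbasisP _)) // eqxx scale1r.
  rewrite big1 ?addr0 // => j ji; rewrite coord_free ?(basis_free (vbasisP _)) //.
  by rewrite eq_sym (negPf ji) scale0r.
have psiX i : psi 'X_i = phi 'X_i by rewrite -symX psi_inj phi_inj.
rewrite (mpolyE p) !linear_sum; apply: eq_bigr => m _; rewrite !linearZ.
congr (_ *: _); rewrite mpolyXE_id !rmorph_prod.
apply: eq_bigr => i _; rewrite !rmorphXn; congr (_ ^+ _); exact: psiX.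
Qed.

Definition SymFrac := {fraction Sym}.

Definition sym_frac (v : V) : SymFrac := (sym_inj v)%:F.
Definition const_frac (c : k) : SymFrac := (c%:MP)%:F.

Definition recip_pred : {pred SymFrac} :=
  [pred x | `[< smallest (fun M => subring_closed (mem M))
     (range const_frac `|` [set (sym_frac v)^-1 | v in [set v | v != 0]]) x >]].

Lemma recip_pred_subring_closed : subring_closed recip_pred.
Proof.
split=> [|x y /asboolP Sx /asboolP Sy|x y /asboolP Sx /asboolP Sy];
  apply/asboolP => M [[M1 MB MM] SM].
- exact/set_mem.
- by apply/set_mem/MB; apply/mem_set; [apply: Sx|apply: Sy].
- by apply/set_mem/MM; apply/mem_set; [apply: Sx|apply: Sy].
Qed.

HB.instance Definition _ :=
  GRing.isSubringClosed.Build SymFrac recip_pred recip_pred_subring_closed.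

Record recip_ring := RecipRing {recip_val : SymFrac; _ : recip_val \in recip_pred}.
HB.instance Definition _ := [isSub for recip_val].
HB.instance Definition _ := [Choice of recip_ring by <:].
HB.instance Definition _ := [SubChoice_isSubComNzRing of recip_ring by <:].

Lemma recip_subproof v : (sym_frac v)^-1 \in recip_pred.
Proof.
have [->|v0] := eqVneq v 0.
  suff -> : sym_frac 0 = 0 by rewrite invr0; apply: rpred0.
  rewrite /sym_frac; suff -> : sym_inj 0 = 0 by rewrite tofrac0.
  by rewrite /sym_inj big1 // => i _; rewrite linear0 scale0r.
by apply/asboolP => M [_]; apply; right; exists v.
Qed.

(* 1/v; the junk value at v = 0 is 0. *)
Definition recip (v : V) : recip_ring := RecipRing (recip_subproof v).

Lemma const_subproof c : const_frac c \in recip_pred.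
Proof. by apply/asboolP => M [_]; apply; left; exists c. Qed.

Definition recip_const (c : k) : recip_ring := RecipRing (const_subproof c).

Lemma recip_const_is_zmod_morphism : zmod_morphism recip_const.
Proof.
by move=> a b; apply: val_inj; rewrite /= /const_frac mpolyCB rmorphB.
Qed.

Lemma recip_const_is_monoid_morphism : monoid_morphism recip_const.
Proof.
split=> [|a b]; apply: val_inj; first by rewrite /= /const_frac mpolyC1 rmorph1.
by rewrite /= /const_frac mpolyCM rmorphM.
Qed.

HB.instance Definition _ := GRing.isZmodMorphism.Build k recip_ring recip_const
  recip_const_is_zmod_morphism.
HB.instance Definition _ := GRing.isMonoidMorphism.Build k recip_ring recip_const
  recip_const_is_monoid_morphism.

End SymmetricAlgebra.

Section TorsionModule.
Variable k : finFieldType.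
Local Notation A := {poly k}.
Local Notation F := {fraction {poly k}}.

Definition poly_in_frac : {pred F} := [pred x | `[< exists a : A, x = a%:F >]].

Lemma poly_in_frac_closed : zmod_closed poly_in_frac.
Proof.
split=> [|_ _ /asboolP[a ->] /asboolP[b ->]]; apply/asboolP.
  by exists 0; rewrite tofrac0.
by exists (a - b); rewrite tofracB.
Qed.

HB.instance Definition _ := GRing.isZmodClosed.Build F poly_in_frac poly_in_frac_closed.

Definition FmodA := Quotient.quot poly_in_frac.
HB.instance Definition _ := GRing.Zmodule.on FmodA.
HB.instance Definition _ := EqQuotient.on FmodA.

Definition FmodA_pi (x : F) : FmodA := \pi_FmodA x.

Lemma FmodA_pi_eq x y : FmodA_pi x = FmodA_pi y <-> exists a : A, x - y = a%:F.
Proof.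
split=> [/eqP|[a e]]; first by rewrite -Quotient.idealrBE => /asboolP.
by apply/eqP; rewrite -Quotient.idealrBE; apply/asboolP; exists a.
Qed.

Lemma FmodA_piD x y : FmodA_pi (x + y) = FmodA_pi x + FmodA_pi y.
Proof. exact: raddfD. Qed.

Lemma FmodA_pi0 : FmodA_pi 0 = 0.
Proof. exact: raddf0. Qed.

Lemma FmodA_piB x y : FmodA_pi (x - y) = FmodA_pi x - FmodA_pi y.
Proof. exact: raddfB. Qed.

Lemma FmodA_surj (w : FmodA) : exists x, w = FmodA_pi x.
Proof. by exists (repr w); rewrite /FmodA_pi reprK. Qed.

Definition FmodA_act (a : A) (w : FmodA) : FmodA := FmodA_pi (a%:F * repr w).

Lemma FmodA_act_pi a x : FmodA_act a (FmodA_pi x) = FmodA_pi (a%:F * x).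
Proof.
have /FmodA_pi_eq[b e] : FmodA_pi (repr (FmodA_pi x)) = FmodA_pi x.
  by rewrite /FmodA_pi reprK.
by apply/FmodA_pi_eq; exists (a * b); rewrite -mulrBr e tofracM.
Qed.

Let actA a b w : FmodA_act a (FmodA_act b w) = FmodA_act (a * b) w.
Proof.
by have [x ->] := FmodA_surj w; rewrite !FmodA_act_pi tofracM mulrA.
Qed.

Let act1 : left_id 1 FmodA_act.
Proof. by move=> w; have [x ->] := FmodA_surj w; rewrite FmodA_act_pi tofrac1 mul1r. Qed.

Let actDr : right_distributive FmodA_act +%R.
Proof.
move=> a w w'; have [x ->] := FmodA_surj w; have [y ->] := FmodA_surj w'.
by rewrite -FmodA_piD !FmodA_act_pi mulrDr FmodA_piD.
Qed.

Let actDl w : {morph FmodA_act^~ w : a b / a + b}.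
Proof.
move=> a b; have [x ->] := FmodA_surj w.
by rewrite !FmodA_act_pi tofracD mulrDl FmodA_piD.
Qed.

HB.instance Definition _ :=
  GRing.Zmodule_isLmodule.Build A FmodA actA act1 actDr actDl.

Lemma FmodA_scale_pi (a : A) x : a *: FmodA_pi x = FmodA_pi (a%:F * x).
Proof. exact: FmodA_act_pi. Qed.

(* t^{-n}A/A, as the image of t^{-n}A in F/A *)
Definition tnA (n : nat) : {pred FmodA} :=
  [pred w | `[< exists a : A, w = FmodA_pi (a%:F / ('X^n)%:F) >]].

Lemma mem_tnA n w : (w \in tnA n) = ('X^n *: w == 0).
Proof.
have Xn0 : ('X^n : A)%:F != 0 by rewrite tofrac_eq0 expf_neq0 ?polyX_eq0.
apply/asboolP/eqP => [[a ->]|].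
  rewrite FmodA_scale_pi mulrCA mulfV // mulr1 -FmodA_pi0.
  by apply/FmodA_pi_eq; exists a; rewrite subr0.
have [x ->] := FmodA_surj w.
rewrite FmodA_scale_pi -FmodA_pi0 => /FmodA_pi_eq[a]; rewrite subr0 => e.
by exists a; rewrite -e mulrC mulKf.
Qed.

Lemma tnA_submod_closed n : submod_closed (tnA n).
Proof.
split=> [|c _ _ /asboolP[a ->] /asboolP[b ->]]; apply/asboolP.
  by exists 0; rewrite tofrac0 mul0r FmodA_pi0.
exists (c * a + b).
by rewrite FmodA_scale_pi -FmodA_piD tofracD tofracM mulrDl mulrA.
Qed.

HB.instance Definition _ n :=
  GRing.isSubmodClosed.Build A FmodA (tnA n) (tnA_submod_closed n).

Record torsion (n : nat) := Torsion {torsion_val : FmodA; _ : torsion_val \in tnA n}.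
HB.instance Definition _ n := [isSub for @torsion_val n].
HB.instance Definition _ n := [Choice of torsion n by <:].
HB.instance Definition _ n := [SubChoice_isSubZmodule of torsion n by <:].

Section Torsion.
Variable n : nat.
Local Notation Q := (torsion n).

Lemma torsion_act_subproof (a : A) (q : Q) : a *: val q \in tnA n.
Proof. by apply: rpredZ; apply: valP. Qed.

(* The A-action is a plain function: the Lmodule structure of Q is the one over
   the field k of constants. *)
Definition torsion_act (a : A) (q : Q) : Q := Torsion (torsion_act_subproof a q).

Let scale (c : k) (q : Q) : Q := torsion_act c%:P q.

Let scaleA a b q : scale a (scale b q) = scale (a * b) q.
Proof. by apply: val_inj; rewrite /= scalerA polyCM. Qed.
Let scale1 : left_id 1 scale.
Proof. by move=> q; apply: val_inj; rewrite /= scale1r. Qed.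
Let scaleDr : right_distributive scale +%R.
Proof. by move=> a q q'; apply: val_inj; rewrite /= scalerDr. Qed.
Let scaleDl q : {morph scale^~ q : a b / a + b}.
Proof. by move=> a b; apply: val_inj; rewrite /= polyCD scalerDl. Qed.

HB.instance Definition _ :=
  GRing.Zmodule_isLmodule.Build k Q scaleA scale1 scaleDr scaleDl.

Lemma torsion_scaleE (c : k) (q : Q) : c *: q = torsion_act c%:P q.
Proof. by []. Qed.

Let Xn0 : ('X^n : A)%:F != 0.
Proof. by rewrite tofrac_eq0 expf_neq0 ?polyX_eq0. Qed.

Lemma torsion_of_row_subproof (u : 'rV[k]_n) :
  FmodA_pi ((rVpoly u)%:F / ('X^n)%:F) \in tnA n.
Proof. by apply/asboolP; exists (rVpoly u). Qed.

Definition torsion_of_row (u : 'rV[k]_n) : Q := Torsion (torsion_of_row_subproof u).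

Lemma torsion_of_row_linear : linear torsion_of_row.
Proof.
move=> c u v; apply: val_inj => /=.
rewrite linearP /= FmodA_scale_pi -FmodA_piD tofracD mulrDl mulrA -tofracM.
by rewrite mul_polyC.
Qed.

Lemma torsion_of_row_inj : injective torsion_of_row.
Proof.
move=> u v /(congr1 val) /= /FmodA_pi_eq[a e].
have {}e : rVpoly (u - v) = a * 'X^n.
  apply/eqP; rewrite -tofrac_eq tofracM -e mulrBl.
  by rewrite -!mulrA mulVf // !mulr1 linearB tofracB.
have a0 : a = 0.
  apply/eqP; apply: contraTT isT => a0.
  have := size_poly n (fun i => (if insub i is Some i then (u - v) ord0 i else 0)).
  by rewrite -/(rVpoly _) e size_Mmonic ?monicXn // size_polyXn addnS /= leqNgt
             -[X in (X < _)%N]add0n ltn_add2r size_poly_gt0 a0.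
apply/eqP; rewrite -subr_eq0; apply/eqP.
by rewrite -[u - v]rVpolyK e a0 mul0r linear0.
Qed.

Lemma torsion_of_row_surj (q : Q) : exists u, q = torsion_of_row u.
Proof.
have /asboolP[a e] := valP q.
exists (poly_rV (a %% 'X^n)); apply: val_inj; rewrite /= e.
rewrite poly_rV_K; last first.
  by rewrite -ltnS -(size_polyXn k n) ltn_modp -size_poly_eq0 size_polyXn.
apply/FmodA_pi_eq; exists (a %/ 'X^n).
rewrite -mulrBl -tofracB {1}(divp_eq a 'X^n) addrK tofracM mulfK //.
Qed.

Definition row_of_torsion (q : Q) : 'rV[k]_n := projT1 (cid (torsion_of_row_surj q)).

Lemma row_of_torsionK : cancel row_of_torsion torsion_of_row.
Proof. by move=> q; rewrite /row_of_torsion; case: cid => u /= ->. Qed.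

Lemma torsion_of_rowK : cancel torsion_of_row row_of_torsion.
Proof. by move=> u; apply: torsion_of_row_inj; rewrite row_of_torsionK. Qed.

Lemma torsion_vect : Vector.axiom n Q.
Proof.
exists row_of_torsion; last first.
  by exists torsion_of_row; [exact: row_of_torsionK | exact: torsion_of_rowK].
move=> c u v; apply: torsion_of_row_inj.
by rewrite torsion_of_row_linear !row_of_torsionK.
Qed.

HB.instance Definition _ := Lmodule_hasFinDim.Build k Q torsion_vect.
HB.instance Definition _ := Choice_isCountable.Build Q (pcan_pickleK (can_pcan row_of_torsionK)).
HB.instance Definition _ := isFinite.Build Q (pcan_enumP (can_pcan row_of_torsionK)).

End Torsion.
End TorsionModule.

Section Rn.
Variables (k : finFieldType) (r n : nat).
Local Notation A := {poly k}.
Local Notation F := {fraction {poly k}}.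

(* V_n = (t^{-n}A/A)^r; for nu <= n, Vsub nu is V_nu inside V_n. *)
Definition Vn := {ffun 'I_r -> torsion k n}.
HB.instance Definition _ := Finite.on Vn.
HB.instance Definition _ := Vector.on Vn.

Definition Vsub (nu : nat) : {pred Vn} :=
  [pred v : Vn | [forall i, val (v i) \in tnA nu]].

Definition Vn_act (a : A) (v : Vn) : Vn := [ffun i => torsion_act a (v i)].

Lemma Vsub_torsion nu v : (v \in Vsub nu) = (Vn_act 'X^nu v == 0).
Proof.
apply/forallP/eqP => [h|h i].
  by apply/ffunP => i; apply: val_inj; move: (h i); rewrite mem_tnA !ffunE => /eqP.
have : (Vn_act 'X^nu v) i = 0 by rewrite h ffunE.
by rewrite ffunE mem_tnA => /(congr1 val) /= /eqP.
Qed.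

Definition const_ratfun (c : k) : F := (c%:P)%:F.

Lemma const_ratfun_is_zmod_morphism : zmod_morphism const_ratfun.
Proof. by move=> a b; rewrite /const_ratfun polyCB tofracB. Qed.

Lemma const_ratfun_is_monoid_morphism : monoid_morphism const_ratfun.
Proof. by split=> // a b; rewrite /const_ratfun polyCM tofracM. Qed.

HB.instance Definition _ := GRing.isZmodMorphism.Build k F const_ratfun
  const_ratfun_is_zmod_morphism.
HB.instance Definition _ := GRing.isMonoidMorphism.Build k F const_ratfun
  const_ratfun_is_monoid_morphism.

Definition RVn_F := tensor (@recip_const k Vn) const_ratfun.
HB.instance Definition _ := GRing.ComPzRing.on RVn_F.

Definition Rn_rel : set RVn_F :=
  [set x | exists (alpha : k) (nu : nat) (v : Vn),
    [/\ alpha != 0, (nu <= n)%N, v \notin Vsub nu &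
      let a : A := alpha *: 'X^nu in
      x = tens (recip (Vn_act a v)) (a%:F)
          - \sum_(v' : Vn | v' \in Vsub nu) tens (recip (v - v')) 1]].

Definition Rn := quot_ring Rn_rel.
HB.instance Definition _ := GRing.ComPzRing.on Rn.

End Rn.

(* Main.v *)
Require Import Defs.
From HB Require Import structures.
From mathcomp Require Import all_boot all_order all_algebra all_field.
From mathcomp Require Import boolp classical_sets.
From mathcomp Require Import freeg mpoly ring zify.

(* Encode V_n by the polynomials p over k of degree < n r, t acting by
   p |-> p div X^r, and let X_p be the class of 1/p. Put Y_j, for j < r, to be
   the sum of X_p over the monic p of degree (n-1) r + j.

   Modulo 1/t the X_p with p in V_(n-1) vanish, and the remaining ones satisfy
   X_p X_q = X_(q-p) (X_p - X_q); straightening and Nakayama over k[1/t] show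
   that R_n is spanned over F[Y] by products of X_p with p monic outside V_(n-1),
   at most one p per degree, and not the first one of that degree.
   For nonconstant monic f_j, adjoining successively to F(Z) the roots Y_j of f_j = Z_j and
   the torsion points of a generic Drinfeld module of rank r gives a free
   F(Z)-algebra of exactly the rank predicted by this spanning family, and a
   homomorphism from R_n to it. So R_n is free of finite rank over
   F[f_1(Y_1), .., f_r(Y_r)].

   Given a maximal ideal M, Zariski's lemma yields monic f_j with f_j(Y_j) in M.
   By freeness these r elements form a regular sequence in the localization at
   M, whose dimension is at most r: a longer chain of primes would give r + 1
   algebraically independent elements, too many by a count of monomials in a
   finite F[Z_1, .., Z_r]-module. *)

Set Implicit Arguments.
Unset Strict Implicit.
Unset Printing Implicit Defensive.

Import Order.TTheory GRing.Theory.
Local Open Scope classical_set_scope.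
Local Open Scope quotient_scope.
Local Open Scope ring_scope.
Local Notation "x %:F" := (@tofrac _ x).

(** * Prime ideals and regular sequences *)

(** No structure of R_n is known beforehand, so freeness comes from comparing two counts. Let D be
    the product of the deg f_j and of the q^i for (n-1) r <= i < n r. Straightening yields D
    generators over F[f_1(Y_1), .., f_r(Y_r)]. The equations of the tower have degrees deg f_j, then
    q^i for i < r, then q^r for the (n-1) r remaining points, and the product is again D.

    The stages of the tower are quotients by monic polynomials. Their ranks thus require no
    irreducibility, but they may fail to be domains, and every division in them needs an exhibited
    inverse. In particular Y_j must be a unit; it is one because it divides Z_j - f_j(0), a nonzero
    element of F(Z).

    A torsion point y_i is a root of e_i = c or e_r = c, where e_i is the additive polynomial
    vanishing on the k-span of y_0, .., y_(i-1). The derivative of e_i is constant, so its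
    logarithmic derivative gives the sums of reciprocals in the relations of R_n.

    General f_j are needed because a maximal ideal need not contain the Y_j: their residues are only
    algebraic over F. *)

Section IdealTheory.
Variable R : comPzRingType.
Implicit Types (I J P S : set R) (s : seq R).

Lemma ideal_sum I (J : finType) (F : J -> R) :
  ideal I -> (forall j, I (F j)) -> I (\sum_j F j).
Proof. by case=> I0 ID _ IF; apply: big_ind => // j _; apply: IF. Qed.

Lemma idealN I x : ideal I -> I x -> I (- x).
Proof. by case=> _ _ IM Ix; rewrite -mulN1r; apply: IM. Qed.

Lemma mem_ideal_gen S x : S x -> ideal_gen S x.
Proof. by move=> Sx J [_]; apply. Qed.

Lemma ideal_gen_sub S I : ideal I -> S `<=` I -> ideal_gen S `<=` I.
Proof. by move=> cI SI x; apply. Qed.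

Lemma ideal_gen_seqP s x :
  ideal_gen [set` s] x <-> exists c : nat -> R, x = \sum_(i < size s) c i * s`_i.
Proof.
split=> [|[c ->]]; last first.
  apply: ideal_sum; first exact: ideal_gen_ideal.
  move=> i; have [_ _ H] := ideal_gen_ideal [set` s]; apply: H.
  by apply: mem_ideal_gen => /=; apply: mem_nth.
pose I : set R := [set x | exists c : nat -> R, x = \sum_(i < size s) c i * s`_i].
suff: ideal_gen [set` s] `<=` I by apply.
apply: ideal_gen_sub => [|y /= ys]; first split.
- by exists (fun=> 0); rewrite big1 // => i _; rewrite mul0r.
- move=> _ _ [c ->] [d ->]; exists (fun i => c i + d i); rewrite -big_split.
  by apply: eq_bigr => i _; rewrite mulrDl.
- move=> a _ [c ->]; exists (fun i => a * c i); rewrite mulr_sumr.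
  by apply: eq_bigr => i _; rewrite mulrA.
- have ylt : (index y s < size s)%N by rewrite index_mem.
  exists (fun i => (i == index y s)%:R); rewrite (bigD1 (Ordinal ylt)) //= eqxx.
  rewrite mul1r nth_index // big1 ?addr0 // => i; rewrite -val_eqE /= => /negPf ->.
  by rewrite mul0r.
Qed.

(** Zorn's lemma gives an ideal [A] over [I], maximal among those disjoint from [S]. For [x] and [y]
    outside [A], both A + (x) and A + (y) meet [S]; the product of two such elements would lie in
    [A] as soon as x y does. *)
Lemma prime_disjoint I S :
    ideal I -> S 1 -> (forall x y, S x -> S y -> S (x * y)) ->
    (forall x, I x -> ~ S x) ->
  exists P, [/\ prime_ideal P, I `<=` P & forall x, P x -> ~ S x].
Proof.
move=> cI S1 SM IS.
pose good (A : set R) := [/\ ideal A, I `<=` A & forall x, A x -> ~ S x].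
pose Q (A : set R) := A = set0 \/ good A.
have [F FT FQ|A [QA Amax]] := @Zorn_bigcup R Q.
  have [[A [FA gA]]|nF] := pselect (exists A, F A /\ good A); last first.
    left; apply/seteqP; split=> // x [A FA Ax]; have [A0|gA] := FT A FA.
      by rewrite A0 in Ax.
    by case: nF; exists A.
  right; have [[A0 AD AM] IA AS] := gA; split; first split.
  - by exists A.
  - move=> x y [B FB Bx] [C FC Cy].
    have [BC|CB] := FQ _ _ FB FC.
      exists C => //; have [C0|[[_ CD _] _ _]] := FT _ FC; first by rewrite C0 in Cy.
      by apply: CD => //; apply: BC.
    exists B => //; have [B0|[[_ BD _] _ _]] := FT _ FB; first by rewrite B0 in Bx.
    by apply: BD => //; apply: CB.
  - move=> a x [B FB Bx]; exists B => //.
    have [B0|[[_ _ BM] _ _]] := FT _ FB; first by rewrite B0 in Bx.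
    exact: BM.
  - by move=> x Ix; exists A => //; apply: IA.
  - move=> x [B FB Bx]; have [B0|[_ _ BS]] := FT _ FB; first by rewrite B0 in Bx.
    exact: BS.
have gI : good I by split.
have gA : good A.
  have [A0|//] := QA; exfalso; apply: (Amax I); last by right.
  rewrite A0; split; first by move=> ?.
  by have [I0 _ _] := cI; move=> /(_ 0 I0).
have [[A0 AD AM] IA AS] := gA; exists A; split=> //; split=> //.
  by move/AS.
move=> x y Axy; have [Ax|nAx] := pselect (A x); first by left.
have [Ay|nAy] := pselect (A y); first by right.
have key z : ~ A z -> exists a b, S (a + b * z) /\ A a.
  move=> nAz; pose B : set R := [set w | exists a b, w = a + b * z /\ A a].
  have AB : A `<=` B by move=> a Aa; exists a, 0; rewrite mul0r addr0.
  apply: contrapT => nS; apply: (Amax B); last first.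
    right; split; first split.
    - exact: AB.
    - move=> _ _ [a [b [-> Aa]]] [c [d [-> Ac]]]; exists (a + c), (b + d).
      by split; [ring | apply: AD].
    - move=> e _ [a [b [-> Aa]]]; exists (e * a), (e * b).
      by split; [ring | apply: AM].
    - by move=> w Iw; apply/AB/IA.
    - by move=> _ [a [b [-> Aa]]] Sw; apply: nS; exists a, b.
  split=> // BA; apply: nAz; apply: BA; exists 0, 1.
  by rewrite mul1r add0r.
have [a [b [Sx Aa]]] := key _ nAx; have [c [d [Sy Ac]]] := key _ nAy.
exfalso; apply: (AS _ _ (SM _ _ Sx Sy)).
have -> : (a + b * x) * (c + d * y) = (c + d * y) * a + (b * x * c + b * d * (x * y)).
  by ring.
by apply: (AD); [apply: AM | apply: AD; apply: AM].
Qed.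

(* Primes of R disjoint from { a^k u : u notin Q } lie below Q and avoid a. *)
Lemma regular_prime_below I Q a :
    ideal I -> prime_ideal Q -> I `<=` Q -> (forall x, I (a * x) -> I x) ->
  exists P, [/\ prime_ideal P, I `<=` P, P `<=` Q & ~ P a].
Proof.
move=> cI [cQ Q1 QM] IQ Ia.
pose S : set R := [set x | exists k u, x = a ^+ k * u /\ ~ Q u].
have [| |x Ix [k [u [xe nQu]]]|P [pP IP PS]] := @prime_disjoint I S cI.
- by exists 0%N, 1; rewrite expr0 mulr1.
- move=> _ _ [k [u [-> Qu]]] [l [w [-> Qw]]]; exists (k + l)%N, (u * w).
  by split; [rewrite exprD; ring | case/QM].
- apply: nQu; apply: IQ; move: Ix; rewrite {}xe.
  by elim: k => [|k IH]; [rewrite expr0 mul1r | rewrite exprS -mulrA => /Ia].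
exists P; split=> // [x Px|Pa].
  by apply: contrapT => nQx; apply: (PS _ Px); exists 0%N, x; rewrite expr0 mul1r.
by apply: (PS _ Pa); exists 1%N, 1; rewrite expr1 mulr1.
Qed.

(** The chain is built downwards from a prime over the whole sequence: [regular_prime_below] inserts
    under [P 0] a prime that contains the first i elements but not the next one. This bounds the
    dimension from below and the length of every regular sequence from above. *)
Lemma regular_seq_chain s :
  regular_seq s -> exists P : nat -> set R, @prime_chain R P (size s).
Proof.
move=> [sreg s1].
have {}sreg i x : (i < size s)%N -> ideal_gen [set` take i s] (s`_i * x) ->
    ideal_gen [set` take i s] x by apply: sreg.
suff H d : (d <= size s)%N -> exists P : nat -> set R, @prime_chain R P d /\
    ideal_gen [set` take (size s - d) s] `<=` P 0%N.
  by have [P [cP _]] := H _ (leqnn _); exists P.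
elim: d => [_|d IH ds].
  have [||||P [pP IP _]] := @prime_disjoint (ideal_gen [set` s]) [set 1].
  - exact: ideal_gen_ideal.
  - by [].
  - by move=> x y /= -> ->; rewrite mulr1.
  - by move=> x gx x1; apply: s1; rewrite -x1.
  exists (fun=> P); rewrite subn0 take_size; split=> //; split=> // i.
have [P [[Pp Plt] P0]] := IH (ltnW ds).
set i := (size s - d.+1)%N.
have si : (size s - d)%N = i.+1 by rewrite /i subnSK.
have ilt : (i < size s)%N by rewrite /i ltn_subrL /=; apply: leq_trans ds.
have [||||Q [pQ IQ QP Qa]] := @regular_prime_below (ideal_gen [set` take i s]) (P 0%N) s`_i.
- exact: ideal_gen_ideal.
- exact: Pp.
- apply: subset_trans P0; apply: ideal_gen_sub; first exact: ideal_gen_ideal.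
  move=> x /= xs; apply: mem_ideal_gen => /=; rewrite si (take_nth 0) //.
  by rewrite mem_rcons inE xs orbT.
- by move=> x; apply: sreg.
exists (fun j => if j is j'.+1 then P j' else Q); split=> //; split.
  by case=> [|j] // jd; apply: Pp.
case=> [|j] jd; last exact: Plt.
split=> // PQ; apply/Qa/PQ/P0.
apply: (@mem_ideal_gen [set` take (size s - d) s]) => /=.
by rewrite si (take_nth 0) // mem_rcons mem_head.
Qed.

End IdealTheory.

(** * Localization *)

Section LocalizationTheory.
Variables (R B : comPzRingType) (M : set R) (phi : {rmorphism R -> B}).
Hypothesis hM : maximal_ideal M.
Hypothesis phi_frac : forall z, exists a s, ~ M s /\ z * phi s = phi a.
Hypothesis phi_unit : forall s, ~ M s -> exists w, w * phi s = 1.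
Hypothesis phi_eq : forall a b, phi a = phi b -> exists u, ~ M u /\ u * a = u * b.

Let pM : prime_ideal M := maximal_prime hM.

Lemma ideal_loc (J : set B) : ideal J -> ideal [set a | J (phi a)].
Proof.
move=> [J0 JD JM]; split=> [|x y|a x]; rewrite /mkset.
- by rewrite rmorph0.
- by rewrite rmorphD; apply: JD.
- by rewrite rmorphM; apply: JM.
Qed.

Lemma ideal_gen_loc s x :
  ideal_gen [set` s] x -> ideal_gen [set` map phi s] (phi x).
Proof.
move=> sx; have cJ := ideal_loc (ideal_gen_ideal [set` map phi s]).
apply: (ideal_gen_sub cJ _ sx) => y /= ys; apply: mem_ideal_gen => /=.
exact: map_f.
Qed.

Lemma ideal_gen_loc_inv s x :
  ideal_gen [set` map phi s] (phi x) -> exists u, ~ M u /\ ideal_gen [set` s] (u * x).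
Proof.
have [cM M1 MM] := pM; have [g0 gD gM] := ideal_gen_ideal [set` s].
pose J : set B := [set z | exists u, ~ M u /\
  exists2 a, ideal_gen [set` s] a & z * phi u = phi a].
have nM u v : ~ M u -> ~ M v -> ~ M (u * v) by move=> nu nv /MM[].
have cJ : ideal J.
  split=> [|z w [u [nu [a sa za]]] [v [nv [b sb wb]]]|c z [u [nu [a sa za]]]].
  - by exists 1; split=> //; exists 0; rewrite ?mul0r ?rmorph0.
  - exists (u * v); split; first exact: nM.
    exists (v * a + u * b); first by apply: gD; apply: gM.
    rewrite !(rmorphD, rmorphM) -za -wb /=; ring.
  - have [d [t [nt ct]]] := phi_frac c.
    exists (t * u); split; first exact: nM.
    exists (d * a); first exact: gM.
    rewrite !rmorphM /= -za -ct; ring.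
move/(ideal_gen_sub cJ); case=> [_ /= /mapP[y ys ->]|u [nu [a sa]]].
  by exists 1; split=> //; exists y; [exact: mem_ideal_gen | rewrite rmorph1 mulr1].
rewrite -rmorphM => /phi_eq[v [nv e]]; exists (v * u); split; first exact: nM.
by rewrite -mulrA [u * x]mulrC e; apply: gM.
Qed.

Lemma noetherian_loc : noetherian R -> noetherian B.
Proof.
move=> nR J cJ; have [s Js] := nR _ (ideal_loc cJ); exists (map phi s).
have [_ _ gM] := ideal_gen_ideal [set` map phi s].
have [_ _ JM] := cJ.
apply/seteqP; split=> [z Jz|]; last first.
  apply: ideal_gen_sub => // _ /= /mapP[y ys ->].
  suff : [set a | J (phi a)] y by [].
  by rewrite Js; apply: mem_ideal_gen.
have [a [t [nt zt]]] := phi_frac z; have [w wt] := phi_unit nt.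
have -> : z = w * phi a by rewrite -zt mulrCA wt mulr1.
apply: (gM); apply: ideal_gen_loc; rewrite -Js /mkset -zt mulrC; exact: JM.
Qed.

Definition loc_max : set B := [set z | exists a s, [/\ M a, ~ M s & z * phi s = phi a]].

(** Locality follows at once from this description, since a proper ideal contains no unit. *)
Lemma loc_max_nonunit z : loc_max z <-> ~ exists w, w * z = 1.
Proof.
have [[M0 MD MM] M1 Mp] := pM.
split=> [[a [s [Ma ns zs]]] [w wz]|nz].
  have [b [t [nt wt]]] := phi_frac w.
  have : phi (s * t) = phi (b * a).
    by rewrite !rmorphM /= -zs -wt; transitivity (w * z * (phi s * phi t)); [rewrite wz; ring | ring].
  move=> /phi_eq[u [nu e]].
  have : M (u * (s * t)) by rewrite e; apply: (MM); apply: MM.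
  by case/Mp=> // /Mp[].
have [a [s [ns zs]]] := phi_frac z; exists a, s; split=> //.
apply: contrapT => /phi_unit[w wa]; apply: nz; exists (w * phi s).
by rewrite -wa -zs; ring.
Qed.

Lemma loc_max_ideal : ideal loc_max.
Proof.
have [[M0 MD MM] M1 Mp] := pM.
split=> [|z w [a [s [Ma ns zs]]] [b [t [Mb nt wt]]]|c z [a [s [Ma ns zs]]]].
- by exists 0, 1; rewrite mul0r rmorph0.
- exists (a * t + b * s), (s * t); split; last 1 first.
  + rewrite !(rmorphD, rmorphM) /= -zs -wt; ring.
  + by apply: MD; rewrite mulrC; apply: MM.
  + by case/Mp.
- have [d [t [nt ct]]] := phi_frac c; exists (d * a), (s * t); split.
  + exact: MM.
  + by case/Mp.
  + rewrite !rmorphM /= -zs -ct; ring.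
Qed.

Lemma loc_is_local : is_local loc_max.
Proof.
have sub J : ideal J -> ~ J 1 -> J `<=` loc_max.
  move=> [J0 JD JM] J1 z Jz; apply/loc_max_nonunit => -[w wz]; apply: J1.
  by rewrite -wz; apply: JM.
have m1 : ~ loc_max 1 by move/loc_max_nonunit; apply; exists 1; rewrite mulr1.
have mm : maximal_ideal loc_max.
  split=> // [|J cJ J1 mJ]; first exact: loc_max_ideal.
  by apply/seteqP; split=> //; apply: sub.
split=> // M' [cM' M'1 M'max]; apply/esym/M'max => //; first exact: loc_max_ideal.
exact: sub.
Qed.

(** Every fraction is a unit times a numerator, so an ideal of [B] is determined by its contraction
    to [R] and strict inclusions survive. *)
Lemma prime_chain_loc (P : nat -> set B) d :
  prime_chain P d -> prime_chain (fun i => [set a | P i (phi a)]) d.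
Proof.
move=> [Pp Plt]; split=> [i /Pp [cP P1 PM]|i id].
  split; [exact: ideal_loc | by rewrite /mkset rmorph1 |].
  by move=> x y; rewrite /mkset rmorphM => /PM.
have [le nle] := Plt _ id; split=> [a|]; first exact: le.
move=> H; apply: nle => z Pz.
have [a [s [ns zs]]] := phi_frac z; have [w ws] := phi_unit ns.
have [[_ _ PM'] _ _] := Pp _ id.
have [[_ _ QM] Q1 QM'] := Pp _ (ltnW id).
have : P i (z * phi s) by rewrite zs; apply: H; rewrite /mkset -zs mulrC; apply: PM'.
by case/QM'=> // Ps; case: Q1; rewrite -ws; apply: QM.
Qed.

(** Clearing denominators turns a relation over [B] into one over [R], up to a factor outside [M],
    which is a unit again in [B]. Properness holds because the sequence lies in the maximal
    ideal. *)
Lemma regular_seq_loc (s : seq R) : [set` s] `<=` M ->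
    (forall i x, (i < size s)%N ->
      ideal_gen [set` take i s] (s`_i * x) -> ideal_gen [set` take i s] x) ->
  regular_seq (map phi s) /\ [set` map phi s] `<=` loc_max.
Proof.
have [_ M1 Mp] := pM.
move=> sM sreg; have sm : [set` map phi s] `<=` loc_max.
  move=> _ /= /mapP[x xs ->]; exists x, 1; split=> //; first exact: sM.
  by rewrite rmorph1 mulr1.
split=> //; split=> [i z|]; last first.
  move/(ideal_gen_sub loc_max_ideal sm)/loc_max_nonunit; apply.
  by exists 1; rewrite mulr1.
rewrite size_map => lti; rewrite -map_take (nth_map 0) //.
have [a [t [nt zt]]] := phi_frac z; have [w wt] := phi_unit nt.
have [_ _ gM] := ideal_gen_ideal [set` map phi (take i s)].
move=> /(gM (phi t)).
have -> : phi t * (phi s`_i * z) = phi (s`_i * a) by rewrite rmorphM /= -zt; ring.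
move=> /ideal_gen_loc_inv[u [nu]]; rewrite mulrCA => /(sreg _ _ lti)/ideal_gen_loc.
have [v vu] := phi_unit nu.
move=> /(gM (v * w)); rewrite rmorphM /= -zt.
have -> : v * w * (phi u * (z * phi t)) = (v * phi u) * (w * phi t) * z by ring.
by rewrite vu wt !mul1r.
Qed.

(** Dimension and depth both equal [size s]: the regular sequence yields a chain of that length, the
    hypothesis on chains bounds the dimension, and any other regular sequence also yields a chain
    subject to that bound. *)
Lemma cohen_macaulay_local_criterion (s : seq R) :
    noetherian R -> [set` s] `<=` M ->
    (forall i x, (i < size s)%N ->
      ideal_gen [set` take i s] (s`_i * x) -> ideal_gen [set` take i s] x) ->
    (forall (P : nat -> set R) e, prime_chain P e -> (e <= size s)%N) ->
  cohen_macaulay_local B.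
Proof.
move=> nR sM sreg dimR; split; first exact: noetherian_loc.
have [rs rsM] := regular_seq_loc sM sreg.
have dimB (P : nat -> set B) e : prime_chain P e -> (e <= size s)%N.
  by move/prime_chain_loc/dimR.
exists loc_max, (size s); split; first exact: loc_is_local.
  split=> //; have [P cP] := regular_seq_chain rs; exists P.
  by rewrite size_map in cP.
split; first by exists (map phi s); rewrite size_map.
by move=> s' /regular_seq_chain[P cP] _; apply: dimB cP.
Qed.

End LocalizationTheory.

Section LocalizationMap.
Variables (R : comPzRingType) (P : set R) (hP : prime_ideal P).
Let D := complement_mulr_closed hP.

Definition loc (a : R) : localization_at hP := lfrac_class D (mklfrac a D.1).

Lemma loc_class_eq x y :
  lnum x * lden y = lnum y * lden x ->
  lfrac_class D x = lfrac_class D y :> localization_at hP.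
Proof. by move=> e; apply/eqP/lfrac_classP; exists 1; rewrite ?D.1 ?e. Qed.

Lemma loc_is_monoid_morphism : monoid_morphism loc.
Proof.
split=> // a b; rewrite /loc lfrac_class_mul.
by apply: loc_class_eq; rewrite /lnum /lden /= !mulr1.
Qed.

Lemma loc_is_zmod_morphism : zmod_morphism loc.
Proof.
have locD a b : loc (a + b) = loc a + loc b.
  rewrite /loc lfrac_class_add.
by apply: loc_class_eq; rewrite /lnum /lden /= !mulr1.
by move=> a b; apply/eqP; rewrite eq_sym subr_eq -locD subrK.
Qed.

HB.instance Definition _ := GRing.isZmodMorphism.Build R (localization_at hP) loc
  loc_is_zmod_morphism.
HB.instance Definition _ := GRing.isMonoidMorphism.Build R (localization_at hP) loc
  loc_is_monoid_morphism.

Lemma loc_den_num x : lfrac_class D x * loc (lden x) = loc (lnum x).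
Proof.
rewrite /loc lfrac_class_mul.
by apply: loc_class_eq; rewrite /lnum /lden /= !mulr1.
Qed.

Lemma loc_frac z : exists a s, ~ P s /\ z * loc s = loc a.
Proof.
exists (lnum (repr z)), (lden (repr z)); split; first by have /asboolP := den_in (repr z).
by rewrite -loc_den_num; congr (_ * _); rewrite /lfrac_class reprK.
Qed.

Lemma loc_unit s : ~ P s -> exists w, w * loc s = 1.
Proof.
move=> ns; have sD : s \in complement P by apply/asboolP.
exists (lfrac_class D (mklfrac 1 sD)); rewrite /loc lfrac_class_mul.
by apply: loc_class_eq; rewrite /lnum /lden /= !mulr1.
Qed.

Lemma loc_eq a b : loc a = loc b -> exists u, ~ P u /\ u * a = u * b.
Proof.
move=> /eqP/lfrac_classP[u /asboolP uD]; rewrite /lnum /lden /= !mulr1 => e.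
by exists u.
Qed.

End LocalizationMap.

Lemma noetherian_surj (A B : comPzRingType) (phi : {rmorphism A -> B}) :
  (forall b, exists a, b = phi a) -> noetherian A -> noetherian B.
Proof.
move=> surj nA J cJ; have [s Js] := nA _ (ideal_loc phi cJ); exists (map phi s).
apply/seteqP; split=> [z Jz|]; last first.
  apply: ideal_gen_sub => // _ /= /mapP[y ys ->].
  suff : [set a | J (phi a)] y by [].
  by rewrite Js; apply: mem_ideal_gen.
have [a za] := surj z; rewrite za; apply: ideal_gen_loc; rewrite -Js.
by rewrite /mkset -za.
Qed.

Lemma noetherian_field (F : fieldType) : noetherian F.
Proof.
move=> I [I0 ID IM]; have [[x [Ix x0]]|nx] := pselect (exists x, I x /\ x != 0).
  exists [:: 1]; apply/seteqP; split=> [y _|].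
    have [_ _ gM] := ideal_gen_ideal [set` [:: 1 : F]].
    by rewrite -[y]mulr1; apply: gM; apply: mem_ideal_gen; rewrite /= mem_head.
  apply: ideal_gen_sub => // y /=; rewrite inE => /eqP ->.
  by rewrite -(mulVf x0); apply: IM.
exists [::]; apply/seteqP; split=> [y Iy|]; last exact: ideal_gen_sub.
have -> : y = 0 by apply: contrapT => /eqP y0; apply: nx; exists y.
by have [] := ideal_gen_ideal [set` [::] : seq F].
Qed.

(** * Noetherian rings *)

Section HilbertBasis.
Variable R : comNzRingType.
Hypothesis nR : noetherian R.

Lemma ideal_eq_by_leading (I J : set {poly R}) : ideal I -> ideal J -> J `<=` I ->
    (forall f e, I f -> size f = e.+1 ->
       exists g, [/\ J g, (size g <= e.+1)%N & g`_e = f`_e]) ->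
  I `<=` J.
Proof.
move=> cI cJ JI H f If; have [n] := ubnP (size f).
elim: n f If => // n IH f If; rewrite ltnS => sf.
have [f0|f0] := posnP (size f).
  by move/eqP: f0; rewrite size_poly_eq0 => /eqP ->; have [] := cJ.
have [g [Jg sg ge]] := H f (size f).-1 If (esym (prednK f0)).
have [_ ID _] := cI; have [_ JD _] := cJ.
rewrite -(subrK g f); apply: JD => //; apply: IH.
  by apply: ID => //; apply: idealN => //; apply: JI.
rewrite -[X in (X < _)%N]/(size (f - g)) (leq_trans _ sf) //.
rewrite -(prednK f0) ltnS; apply/leq_sizeP => j; rewrite leq_eqVlt coefB.
case/orP=> [/eqP <-|ltj]; first by rewrite ge subrr.
by rewrite !nth_default ?subrr // ?(leq_trans sg) // -(prednK f0).
Qed.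

(** Hilbert's argument with the ideals [L d] of leading coefficients in degree d. Since [noetherian]
    means finite generation, the index [D] where they become stationary is read off from generators
    of their union. *)
Lemma hilbert_basis : noetherian {poly R}.
Proof.
move=> I cI; have [I0 ID IM] := cI.
pose L d : set R := [set c | exists f, [/\ I f, (size f <= d.+1)%N & f`_d = c]].
have cL d : ideal (L d).
  split=> [|_ _ [f [If sf <-]] [g [Ig sg <-]]|a _ [f [If sf <-]]].
  - by exists 0; rewrite size_poly0 coef0.
  - exists (f + g); rewrite coefD; split=> //; first exact: ID.
    by apply: leq_trans (size_polyD _ _) _; rewrite geq_max sf.
  - exists (a%:P * f); rewrite coefCM; split=> //; first exact: IM.
    by rewrite mul_polyC (leq_trans (size_scale_leq _ _)).
have L_incr d : L d `<=` L d.+1.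
  move=> _ [f [If sf <-]]; exists ('X * f); rewrite coefXM /=; split=> //.
    exact: IM.
  by have [->|f0] := eqVneq f 0; rewrite ?mulr0 ?size_poly0 // mulrC size_mulX.
have L_mono d e : (d <= e)%N -> L d `<=` L e.
  elim: e => [|e IH]; first by rewrite leqn0 => /eqP -> c.
  rewrite leq_eqVlt => /orP[/eqP -> //|/IH de]; move=> c /de; exact: L_incr.
have [s Ls] : exists s : seq R, [set c | exists d, L d c] = ideal_gen [set` s].
  apply: nR; split=> [|x y|a x].
  - by exists 0%N; have [] := cL 0%N.
  - move=> [i ix] [j jy]; exists (maxn i j); have [_ LD _] := cL (maxn i j).
    by apply: LD; [apply: L_mono ix; apply: leq_maxl | apply: L_mono jy; apply: leq_maxr].
  - by case=> d dx; exists d; have [_ _ LM] := cL d; apply: LM.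
have [D LD] : exists D, forall c, c \in s -> L D c.
  have : forall c, c \in s -> exists d, L d c.
    move=> c cs; suff : [set c | exists d, L d c] c by [].
    by rewrite Ls; apply: mem_ideal_gen.
  elim: s {Ls} => [|c s IH] H; first by exists 0%N.
  have [|D HD] := IH; first by move=> x xs; apply: H; rewrite inE xs orbT.
  have [d hd] := H c (mem_head _ _); exists (maxn d D) => x; rewrite inE.
  case/orP=> [/eqP ->|/HD]; last by apply: L_mono; apply: leq_maxr.
  by apply: L_mono hd; apply: leq_maxl.
have LeD e : L e `<=` L D.
  move=> c Lc; apply: (@ideal_gen_sub _ [set` s] _ (cL D)) => //.
  by rewrite -Ls; exists e.
have [S HS] := choice (fun d => nR (cL d)).
have Lwit (p : nat * R) : exists f : {poly R}, L p.1 p.2 ->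
    [/\ I f, (size f <= p.1.+1)%N & f`_(p.1) = p.2].
  have [[f Hf]|nL] := pselect (L p.1 p.2); first by exists f.
  by exists 0 => /nL.
have [g Hg] := choice Lwit.
pose G := flatten [seq [seq g (d, c) | c <- S d] | d <- iota 0 D.+1].
have LS d c : c \in S d -> L d c by move=> cS; rewrite HS; apply: mem_ideal_gen.
exists G; apply/seteqP; split; last first.
  apply: ideal_gen_sub => // f /= /flatten_mapP[d _] /mapP[c cS ->].
  by have [] := Hg (d, c) (LS _ _ cS).
apply: ideal_eq_by_leading; [exact: cI | exact: ideal_gen_ideal | |].
  apply: ideal_gen_sub => // f /= /flatten_mapP[d _] /mapP[c cS ->].
  by have [] := Hg (d, c) (LS _ _ cS).
(* For e > D the coefficient already lies in [L D], and the factor ['X^(e - d)] brings the witnesses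
   of degree [D] up to degree e. *)
move=> f e If sf; pose d := minn e D.
have Lf : L d f`_e.
  rewrite /d; have [eD|De] := leqP e D; first by exists f; rewrite sf.
  by apply: (LeD e); exists f; rewrite sf.
rewrite HS in Lf; have /ideal_gen_seqP[c ce] := Lf.
exists (\sum_(i < size (S d)) (c i)%:P * 'X^(e - d) * g (d, (S d)`_i)).
have Hi (i : 'I_(size (S d))) := Hg (d, (S d)`_i) (LS d _ (mem_nth 0 (ltn_ord i))).
have de : (d <= e)%N by rewrite geq_minl.
split.
- apply: ideal_sum; first exact: ideal_gen_ideal.
  move=> i; have [_ _ gM] := ideal_gen_ideal [set` G]; apply: gM; apply: mem_ideal_gen => /=.
  apply/flatten_mapP; exists d; first by rewrite mem_iota ltnS geq_minr.
  by apply/mapP; exists (S d)`_i => //; apply: mem_nth.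
- apply: leq_trans (size_sum _ _ _) _; apply/bigmax_leqP => i _.
  have [_ si _] := Hi i; rewrite -mulrA mul_polyC (leq_trans (size_scale_leq _ _)) //.
  rewrite mulrC; have [->|g0] := eqVneq (g (d, (S d)`_i)) 0; first by rewrite mul0r size_poly0.
  by rewrite size_mulXn // -(subnK de) addnK -addnS leq_add2l.
- rewrite coef_sum [RHS]ce; apply: eq_bigr => i _; have [_ _ gi] := Hi i.
  by rewrite -mulrA coefCM coefXnM ltnNge leq_subr /= subKn // gi.
Qed.

End HilbertBasis.

(** Generation stated as an induction principle: a subring containing the image of [phi] and [xs] is
    everything. In this form a generator can be moved into the base ring, as in
    [ring_generated_cons]. *)
Definition ring_generated (A B : comPzRingType) (phi : A -> B) (xs : seq B) :=
  forall P : set B, P 1 -> (forall x y, P x -> P y -> P (x - y)) ->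
    (forall x y, P x -> P y -> P (x * y)) -> (forall a, P (phi a)) ->
    (forall x, x \in xs -> P x) -> forall b, P b.

Section Evaluation.
Variables (A B : comNzRingType) (phi : {rmorphism A -> B}) (x : B).

Definition poly_eval (p : {poly A}) : B := (map_poly phi p).[x].

Lemma poly_eval_is_zmod_morphism : zmod_morphism poly_eval.
Proof. by move=> p q; rewrite /poly_eval rmorphB hornerD hornerN. Qed.

Lemma poly_eval_is_monoid_morphism : monoid_morphism poly_eval.
Proof.
by split=> [|p q]; rewrite /poly_eval ?rmorph1 ?hornerC // rmorphM hornerM.
Qed.

HB.instance Definition _ := GRing.isZmodMorphism.Build {poly A} B poly_eval
  poly_eval_is_zmod_morphism.
HB.instance Definition _ := GRing.isMonoidMorphism.Build {poly A} B poly_eval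
  poly_eval_is_monoid_morphism.

Lemma poly_evalC a : poly_eval a%:P = phi a.
Proof. by rewrite /poly_eval map_polyC hornerC. Qed.

Lemma poly_evalX : poly_eval 'X = x.
Proof. by rewrite /poly_eval map_polyX hornerX. Qed.

Lemma ring_generated_cons xs :
  ring_generated phi (x :: xs) -> ring_generated poly_eval xs.
Proof.
move=> gen P P1 PB PM Pe Px; apply: gen => // [a|y]; first by rewrite -poly_evalC.
by rewrite inE => /orP[/eqP ->|/Px //]; rewrite -poly_evalX.
Qed.

End Evaluation.

Lemma ring_generated_nil (A B : comPzRingType) (phi : {rmorphism A -> B}) :
  ring_generated phi [::] -> forall b, exists a, b = phi a.
Proof.
apply=> //.
- by exists 1; rewrite rmorph1.
- by move=> _ _ [a ->] [b ->]; exists (a - b); rewrite rmorphB.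
- by move=> _ _ [a ->] [b ->]; exists (a * b); rewrite rmorphM.
- by move=> a; exists a.
Qed.

Lemma noetherian_generated (A B : comNzRingType) (phi : {rmorphism A -> B}) xs :
  noetherian A -> ring_generated phi xs -> noetherian B.
Proof.
elim: xs A phi => [|x xs IH] A phi nA gen.
  by apply: noetherian_surj nA; apply: ring_generated_nil gen.
by apply: IH (hilbert_basis nA) (ring_generated_cons gen).
Qed.

(** * Dimension of finite modules over polynomial rings *)

(** Exponent vectors are lists so that inductions can split off the first variable. *)
Fixpoint exponents (m N : nat) : seq (seq nat) :=
  if m is m'.+1 then [seq k :: a | k <- iota 0 N.+1, a <- exponents m' N]
  else [:: [::]].

Lemma exponentsS m N :
  exponents m.+1 N = [seq k :: a | k <- iota 0 N.+1, a <- exponents m N].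
Proof. by []. Qed.

Lemma size_exponents m N : size (exponents m N) = (N.+1 ^ m)%N.
Proof. by elim: m => // m IH; rewrite exponentsS size_allpairs size_iota IH expnS. Qed.

Lemma exponents_uniq m N : uniq (exponents m N).
Proof.
elim: m => // m IH; rewrite exponentsS; apply: allpairs_uniq => //; first exact: iota_uniq.
by move=> [k a] [l b] _ _ [-> ->].
Qed.

Lemma exponentsP m N a :
  a \in exponents m N = (size a == m) && all (fun k => k <= N)%N a.
Proof.
elim: m a => [|m IH] [|k a] //.
  by apply/allpairsP => -[[l b] [_ _]].
rewrite exponentsS [size _]/= eqSS [all _ _]/=; apply/allpairsP/idP => [[p [lN bm [-> ->]]]|].
  by move: bm; rewrite IH => /andP[-> ->]; move: lN; rewrite mem_iota add0n ltnS /= => ->.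
case/and3P=> sa kN aN; exists (k, a); rewrite [_.1]/= [_.2]/= mem_iota add0n ltnS kN IH sa aN.
by split.
Qed.

Section Dimension.
Variables (F : fieldType) (R : comNzRingType) (cst : {rmorphism F -> R}).

Fixpoint monomial (xs : seq R) (a : seq nat) : R :=
  match xs, a with
  | x :: xs', k :: a' => x ^+ k * monomial xs' a'
  | _, _ => 1
  end.

Lemma cst_notin_prime (P : set R) c : prime_ideal P -> P (cst c) -> c = 0.
Proof.
case=> [[_ _ PM] P1 _] Pc; apply: contrapT => /eqP c0; apply: P1.
by rewrite -(rmorph1 cst) -(mulVf c0) rmorphM; apply: PM.
Qed.

(* A chain of r + 1 primes yields algebraically independent elements: take xs`_i
   in P i.+1 but not in P i, and read off the coefficients by increasing powers
   of xs`_0. *)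
Lemma chain_independent (N : nat) (xs : seq R) (P : nat -> set R) (c : seq nat -> F) :
    (forall i, (i <= size xs)%N -> prime_ideal (P i)) ->
    (forall i, (i < size xs)%N -> [/\ P i `<=` P i.+1, P i.+1 xs`_i & ~ P i xs`_i]) ->
    P 0%N (\sum_(a <- exponents (size xs) N) cst (c a) * monomial xs a) ->
  forall a, a \in exponents (size xs) N -> c a = 0.
Proof.
elim: xs P c => [|x xs IH] P c Pp Px.
  rewrite /= big_seq1 mulr1 => /(cst_notin_prime (Pp 0%N isT)) c0 a.
  by rewrite inE => /eqP ->.
have [cP0 P01 PM] := Pp 0%N isT; have [P0 PD PMl] := cP0.
have [cP1 _ _] := Pp 1%N isT; have [_ QD QM] := cP1.
have [sub01 P1x P0x] := Px 0%N isT.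
rewrite [size _]/= exponentsS big_allpairs_dep /=.
pose S k := \sum_(a <- exponents (size xs) N) cst (c (k :: a)) * monomial xs a.
have -> : \sum_(i1 <- iota 0 N.+1) \sum_(i2 <- exponents (size xs) N)
    cst (c (i1 :: i2)) * (x ^+ i1 * monomial xs i2) = \sum_(i <- iota 0 N.+1) x ^+ i * S i.
  by apply: eq_bigr => k _; rewrite mulr_sumr; apply: eq_bigr => a _; rewrite mulrCA.
have Sk0 k : P 1%N (S k) -> forall a, a \in exponents (size xs) N -> c (k :: a) = 0.
  apply: (IH (fun i => P i.+1) (fun a => c (k :: a))) => i; first exact: (Pp i.+1).
  exact: (Px i.+1).
have main l m : P 0%N (\sum_(i <- iota m l) x ^+ i * S i) ->
    forall k a, k \in iota m l -> a \in exponents (size xs) N -> c (k :: a) = 0.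
  elim: l m => [//|l IHl] m /=; rewrite big_cons => PS.
  have c0 a : a \in exponents (size xs) N -> c (m :: a) = 0.
    (* The factor x^m can be cancelled because [x] is outside the prime [P 0]. Modulo [x], which
       lies in [P 1], only [S m] remains, and the induction hypothesis applies to the chain starting
       at [P 1]. *)
    apply: Sk0; have /PM[] : P 0%N (x ^+ m * (S m + \sum_(i <- iota m.+1 l) x ^+ (i - m) * S i)).
    - rewrite mulrDr mulr_sumr.
      rewrite (eq_big_seq (fun i => x ^+ i * S i)) // => i; rewrite mem_iota => /andP[mi _].
      by rewrite mulrA -exprD subnKC // ltnW.
    - by move=> Pxm; exfalso; elim: m Pxm {PS IHl} => [|m IHm]; rewrite ?expr0 // exprS => /PM[].
    - move=> /sub01 H; have -> : S m = (S m + \sum_(i <- iota m.+1 l) x ^+ (i - m) * S i) -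
        (\sum_(i <- iota m.+1 l) x ^+ (i - m.+1) * S i) * x.
        rewrite mulr_suml -[LHS](addrK (\sum_(i <- iota m.+1 l) x ^+ (i - m) * S i)).
        congr (_ - _); apply: eq_big_seq => i; rewrite mem_iota => /andP[mi _].
        by rewrite -(subnSK mi) exprS; ring.
      by apply: QD => //; apply: idealN => //; apply: QM.
  move=> k a; rewrite inE => /orP[/eqP -> //|kl aE]; first exact: c0.
  apply: (IHl m.+1) => //; move: PS; suff -> : S m = 0 by rewrite mulr0 add0r.
  by rewrite /S big1_seq // => b /andP[_ bE]; rewrite c0 // rmorph0 mul0r.
move=> /main H a aE; have /allpairsP[[k b] [kN bE ->]] : a \in exponents (size xs).+1 N by [].
exact: H kN bE.
Qed.

Lemma linear_dependence (I : finType) (s : seq (seq nat)) (f : seq nat -> R) (g : I -> R) :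
    uniq s -> (#|I| < size s)%N ->
    (forall a, a \in s -> exists c : I -> F, f a = \sum_i cst (c i) * g i) ->
  exists c : seq nat -> F, (exists2 a, a \in s & c a != 0) /\
    \sum_(a <- s) cst (c a) * f a = 0.
Proof.
move=> us lts fs.
have {}fs a : exists c : I -> F, a \in s -> f a = \sum_i cst (c i) * g i.
  have [aS|naS] := boolP (a \in s); last by exists (fun=> 0).
  by have [c] := fs a aS; exists c.
have [C HC] := choice fs.
have {}HC a (aS : a \in s) := HC a aS.
pose A : 'M[F]_(size s, #|I|) := \matrix_(i, j) C (nth [::] s i) (enum_val j).
have kA : kermx A != 0.
  rewrite -mxrank_eq0 mxrank_ker subn_eq0 -ltnNge.
  by apply: leq_ltn_trans lts; apply: rank_leq_col.
have /rowV0Pn[v vA v0] := kA; have {}vA : v *m A = 0 by apply/sub_kermxP.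
have /rV0Pn[j vj] := v0.
pose c a := if insub (index a s) is Some i then v 0 i else 0.
have cE (i : 'I_(size s)) : c (nth [::] s i) = v 0 i.
  rewrite /c index_uniq // insubT //= => lti; congr (v 0 _); exact: val_inj.
exists c; split.
  by exists (nth [::] s j); [apply: mem_nth | rewrite cE].
rewrite (big_nth [::]) big_mkord.
under eq_bigr => i _ do rewrite cE HC ?mem_nth // mulr_sumr.
rewrite exchange_big big1 //= => i _.
have /(congr1 (fun m : 'rV_#|I| => cst (m 0 (enum_rank i)))) := vA.
rewrite !mxE rmorph0 rmorph_sum => e; rewrite -[RHS](mul0r (g i)) -[in RHS]e mulr_suml.
by apply: eq_bigr => l _; rewrite rmorphM mxE enum_rankK mulrA.
Qed.

Lemma dimension_bound (r : nat) :
    (forall xs : seq R, size xs = r.+1 -> exists N (I : finType) (g : I -> R),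
       (#|I| < N.+1 ^ r.+1)%N /\
       forall a, a \in exponents r.+1 N ->
         exists c : I -> F, monomial xs a = \sum_i cst (c i) * g i) ->
  forall (P : nat -> set R) e, prime_chain P e -> (e <= r)%N.
Proof.
move=> growth P e [Pp Plt]; rewrite leqNgt; apply/negP => re.
have xP i : exists x, (i < e)%N -> P i.+1 x /\ ~ P i x.
  have [ie|] := boolP (i < e)%N; last by exists 0.
  have [_ nsub] := Plt i ie.
  apply: contrapT => nx; apply: nsub => x Px; apply: contrapT => nPx.
  by apply: nx; exists x.
have [x Hx] := choice xP; pose xs := mkseq x r.+1.
have sxs : size xs = r.+1 by rewrite size_mkseq.
have [N [I [g [cI span]]]] := growth xs sxs.
have [|c [[a aE ca] c0]] := linear_dependence (exponents_uniq r.+1 N) _ span.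
  by rewrite size_exponents.
suff : c a = 0 by apply/eqP.
apply: (@chain_independent N xs P c); rewrite ?sxs //.
- by move=> i ir; apply: Pp; apply: leq_trans re.
- move=> i ir; have ie : (i < e)%N := leq_trans ir re.
  have [sub _] := Plt i ie; have [? ?] := Hx i ie.
  by rewrite nth_mkseq.
- by rewrite c0; have [[]] := Pp 0%N isT.
Qed.

End Dimension.

Lemma card_bmultinom r b : (#|{: 'X_{1..r < b}}| <= b ^ r)%N.
Proof.
case: b => [|b].
  rewrite (eq_card0 (A := {: 'X_{1..r < 0}})) // => m.
  by have := bmdeg m; rewrite ltn0.
have -> : (b.+1 ^ r = #|{ffun 'I_r -> 'I_b.+1}|)%N by rewrite card_ffun !card_ord.
pose f (m : 'X_{1..r < b.+1}) : {ffun 'I_r -> 'I_b.+1} := [ffun i => inord (m i)].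
apply: (@leq_card _ _ f) => m1 m2 e.
have lem (m : 'X_{1..r < b.+1}) i : (m i <= b)%N.
  rewrite -ltnS; apply: leq_ltn_trans (bmdeg m).
  by rewrite mdegE (bigD1 i) //= leq_addr.
apply/val_inj/mnmP => i; have := congr1 (fun g : {ffun 'I_r -> 'I_b.+1} => val (g i)) e.
by rewrite /f !ffunE /= !inordK ?ltnS.
Qed.

Section FiniteModule.
Variables (F : fieldType) (R : comNzRingType) (cst : {rmorphism F -> R}).
Variables (r D : nat) (Z : 'I_r -> R) (G : 'I_D -> R).

Definition mspan (x : R) :=
  exists p : 'I_D -> {mpoly F[r]}, x = \sum_b mmap cst Z (p b) * G b.

(** Filtration by the degree of the coefficients ([msize] is the degree plus one). An element may
    have several representations; only subadditivity up to a constant is required of the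
    filtration. *)
Definition mspan_le (d : nat) (x : R) :=
  exists2 p : 'I_D -> {mpoly F[r]}, forall b, (msize (p b) <= d)%N &
    x = \sum_b mmap cst Z (p b) * G b.

Lemma mspan_le_mono d e x : (d <= e)%N -> mspan_le d x -> mspan_le e x.
Proof. by move=> de [p pd ->]; exists p => // b; apply: leq_trans de. Qed.

Lemma mspan_leP x : mspan x -> exists d, mspan_le d x.
Proof.
move=> [p ->]; exists (\max_b msize (p b)); exists p => // b.
exact: (leq_bigmax b).
Qed.

Hypothesis gen : forall x, mspan x.

Lemma mspan_leM : exists c, forall d e x y,
  mspan_le d x -> mspan_le e y -> mspan_le (d + e + c) (x * y).
Proof.
have [s Hs] := choice (fun ab : 'I_D * 'I_D => gen (G ab.1 * G ab.2)).
(* [c0] bounds the structure constants of the multiplication of generators; the 2 added to it leaves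
   room for two uses of the size bound for products. *)
pose c0 := \max_ab \max_c msize (s ab c).
exists (c0 + 2)%N => d e _ _ [p pd ->] [q qe ->].
exists (fun c => \sum_a \sum_b p a * q b * s (a, b) c) => [c|].
  apply: leq_trans (msize_sum _ _ _) _; apply/bigmax_leqP => a _.
  apply: leq_trans (msize_sum _ _ _) _; apply/bigmax_leqP => b _.
  have sc : (msize (s (a, b) c) <= c0)%N.
    apply: leq_trans (leq_bigmax (a, b)); exact: (leq_bigmax c).
  have := msizeM_le (p a * q b) (s (a, b) c); have := msizeM_le (p a) (q b).
  have := pd a; have := qe b; lia.
rewrite mulr_suml.
under eq_bigr => a _ do (rewrite mulr_sumr; under eq_bigr => b _ do
  rewrite mulrACA (Hs (a, b)) mulr_sumr).
under [RHS]eq_bigr => c _ do (rewrite rmorph_sum mulr_suml;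
  under eq_bigr => a _ do rewrite rmorph_sum mulr_suml).
rewrite [RHS]exchange_big; apply: eq_bigr => a _.
rewrite [RHS]exchange_big; apply: eq_bigr => b _.
by apply: eq_bigr => c _; rewrite !rmorphM mulrA.
Qed.

Lemma mspan_le_mono_bound (xs : seq R) : exists C, forall N a,
  a \in exponents (size xs) N -> mspan_le (C * N.+1) (monomial xs a).
Proof.
have [c cM] := mspan_leM.
have [d1 H1] := mspan_leP (gen 1).
elim: xs => [|x xs [C HC]].
  by exists d1 => N a; rewrite inE => /eqP ->; apply: mspan_le_mono H1; rewrite leq_pmulr.
have [d Hd] := mspan_leP (gen x).
have Hx k : mspan_le (d1 + k * (d + c)) (x ^+ k).
  elim: k => [|k IH]; first by rewrite expr0 mul0n addn0.
  by rewrite exprS; apply: mspan_le_mono (cM _ _ _ _ Hd IH); lia.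
exists (d1 + d + c + C + c)%N => N a; rewrite exponentsP.
case: a => // k a /= /and3P[sa kN aN].
have /HC Ha : a \in exponents (size xs) N by rewrite exponentsP -eqSS sa aN.
by apply: mspan_le_mono (cM _ _ _ _ (Hx k) Ha); nia.
Qed.

Lemma growth_bound (xs : seq R) : size xs = r.+1 ->
  exists N (I : finType) (g : I -> R),
    (#|I| < N.+1 ^ r.+1)%N /\
    forall a, a \in exponents r.+1 N ->
      exists c : I -> F, monomial xs a = \sum_i cst (c i) * g i.
Proof.
move=> sxs; have [C HC] := mspan_le_mono_bound xs.
(* The monomials lie in a space spanned by at most C^r (N+1)^r D elements. For N = C^r D this is N
   (N+1)^r, less than the number (N+1)^(r+1) of monomials. *)
pose N := (C ^ r * D)%N; pose d := (C * N.+1)%N.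
exists N, ('X_{1..r < d} * 'I_D)%type, (fun i : 'X_{1..r < d} * 'I_D => mmap1 Z i.1 * G i.2); split.
  rewrite card_prod card_ord.
  apply: leq_ltn_trans (_ : ((C * N.+1) ^ r * D < _)%N).
    by rewrite leq_mul2r card_bmultinom orbT.
  by rewrite expnMn expnS mulnAC ltn_mul2r expn_gt0 /= /N.
move=> a; rewrite -sxs => /HC[p pd ->].
exists (fun i : 'X_{1..r < d} * 'I_D => (p i.2)@_(i.1)).
rewrite -(pair_bigA _ (fun (m : 'X_{1..r < d}) b => cst (p b)@_m * (mmap1 Z m * G b))) /= exchange_big /=.
apply: eq_bigr => b _; rewrite (mmapE d) //= mulr_suml.
by apply: eq_bigr => m _; rewrite mulrA.
Qed.

Lemma finite_module_dimension (P : nat -> set R) e : prime_chain P e -> (e <= r)%N.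
Proof. by apply: (dimension_bound (cst := cst)); apply: growth_bound. Qed.

End FiniteModule.

(** * Zariski's lemma *)

Section Integral.
Variables (B : comNzRingType) (K : fieldType) (iota : {rmorphism B -> K}).
Local Notation int := (integralOver iota).

Lemma integral_exp x m : int x -> int (x ^+ m).
Proof.
move=> ix; elim: m => [|m IH]; first by rewrite expr0; apply: integral1.
by rewrite exprS; apply: integral_mul.
Qed.

Lemma integral_sum I (s : seq I) (P : pred I) (F : I -> K) :
  (forall i, P i -> int (F i)) -> int (\sum_(i <- s | P i) F i).
Proof.
by move=> iF; apply: big_ind => //; [exact: integral0 | exact: integral_add].
Qed.

(** With e the degree of [P], the element l y is a root of the monic polynomial with coefficients
    l^(e-i) P_i. For i < e one factor l makes P_i integral and the other factors are integral
    themselves. *)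
Lemma integral_scale (P : {poly K}) y l :
    P \is monic -> root P y -> int l -> (forall i, int (l * P`_i)) -> int (l * y).
Proof.
move=> mP rP il iP; set e := (size P).-1.
have sP : size P = e.+1 by rewrite -polySpred ?monic_neq0.
pose Q := \poly_(i < e.+1) (l ^+ (e - i) * P`_i).
have Pe : P`_e = 1 by have /monicP := mP; rewrite lead_coefE -/e.
have Qe : Q`_e = 1 by rewrite coef_poly ltnSn subnn expr0 mul1r.
have sQ : size Q = e.+1.
  by apply: size_poly_eq; rewrite subnn expr0 mul1r Pe oner_eq0.
apply: (@integral_root_monic _ _ _ _ Q).
- by apply/monicP; rewrite lead_coefE sQ.
- rewrite /root horner_poly; have /rootP := rP; rewrite horner_coef sP => P0.
  apply/eqP; transitivity (l ^+ e * \sum_(i < e.+1) P`_i * y ^+ i); last first.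
    by rewrite P0 mulr0.
  rewrite mulr_sumr; apply: eq_bigr => i _; rewrite exprMn.
  have -> : l ^+ e = l ^+ (e - i) * l ^+ i by rewrite -exprD subnK // -ltnS.
  by ring.
- apply/integral_poly => i; rewrite coef_poly; case: ltnP => [|_]; last exact: integral0.
  rewrite ltnS leq_eqVlt => /orP[/eqP ->|ie]; first by rewrite subnn mul1r Pe; apply: integral1.
  by rewrite -(subnSK ie) exprSr -mulrA; apply: integral_mul => //; apply: integral_exp.
Qed.

(** Dividing an integral equation of [y] by y^(j+1), where j is the least index with a nonzero
    coefficient q_j, writes q_j / y as a polynomial in [y]. *)
Lemma integral_inverse_multiple y : y != 0 -> int y ->
  exists c, iota c != 0 /\ int (iota c / y).
Proof.
move=> y0 [q mq /rootP qy].
have ex : exists i, iota q`_i != 0.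
  by exists (size q).-1; have /monicP := mq; rewrite lead_coefE => ->; rewrite rmorph1 oner_eq0.
case: (ex_minnP ex) => j qj jmin; exists q`_j; split=> //.
have jlt : (j < size q)%N.
  by rewrite ltnNge; apply: contra qj => /(nth_default 0) ->; rewrite rmorph0.
pose S := \sum_(j.+1 <= i < size q) iota q`_i * y ^+ (i - j.+1).
suff -> : iota q`_j / y = - S.
  apply: integral_opp; apply: integral_sum => i _; apply: integral_mul.
    exact: integral_id.
  by apply: integral_exp; exists q => //; apply/rootP.
apply: (mulIf y0); rewrite mulfVK //.
have yj : y ^+ j != 0 by rewrite expf_neq0.
apply: (mulfI yj); apply/eqP; rewrite -subr_eq0; apply/eqP.
rewrite -[RHS]qy (@horner_coef_wide _ (size q)) ?size_poly //.
rewrite -(big_mkord xpredT (fun i => (map_poly iota q)`_i * y ^+ i)).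
rewrite (big_cat_nat _ (n := j)) //=; last exact: ltnW.
rewrite big_nat big1 ?add0r => [|i /andP[_ ij]]; last first.
  rewrite coef_map /=; have [->|/jmin] := eqVneq (iota q`_i) 0; first by rewrite mul0r.
  by rewrite leqNgt ij.
rewrite big_ltn // coef_map /= mulNr mulrN opprK [iota _ * _]mulrC; congr (_ + _).
rewrite /S mulr_suml mulr_sumr; apply: eq_big_nat => i /andP[ji _].
have -> : y ^+ i = y ^+ j * y * y ^+ (i - j.+1) by rewrite -exprSr -exprD subnKC.
by rewrite coef_map /=; ring.
Qed.

(** The element h^m / b satisfies an integral equation, say of degree e. Multiplied by b^e, it shows
    h^(m e) to be a multiple of b. *)
Lemma integral_divides b h :
    iota b != 0 -> (forall x, exists m, int (iota h ^+ m * x)) ->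
  exists c m, iota (b * c) = iota (h ^+ m).
Proof.
move=> b0 H; have [m [p mp /rootP pr]] := H (iota b)^-1.
set y := _ / _ in pr; set e := (size p).-1.
have sp : size p = e.+1 by rewrite -polySpred ?monic_neq0.
have pe : p`_e = 1 by have /monicP := mp; rewrite lead_coefE.
have by_ : iota b * y = iota (h ^+ m) by rewrite /y mulrCA mulfV // mulr1 rmorphXn.
have {}pr : \sum_(i < e) iota p`_i * y ^+ i + y ^+ e = 0.
  rewrite -[RHS]pr (@horner_coef_wide _ e.+1) -?sp ?size_poly // sp big_ord_recr /=.
  rewrite coef_map /= pe rmorph1 mul1r; congr (_ + _).
  by apply: eq_bigr => i _; rewrite coef_map.
case: e sp pe pr => [|e] sp pe pr.
  by move: pr; rewrite big_ord0 add0r expr0 => /eqP; rewrite oner_eq0.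
exists (- \sum_(i < e.+1) p`_i * h ^+ (m * i) * b ^+ (e - i)), (m * e.+1)%N.
rewrite rmorphM rmorphN rmorph_sum exprM rmorphXn -by_ exprMn.
move/eqP: pr; rewrite addrC addr_eq0 => /eqP ->.
rewrite mulrN exprS -mulrN -mulrA; congr (_ * _); rewrite mulrN; congr (- _).
rewrite mulr_sumr; apply: eq_bigr => i _.
have ie : (i <= e)%N by rewrite -ltnS.
have -> : iota b ^+ e = iota b ^+ (e - i) * iota b ^+ i by rewrite -exprD subnK.
rewrite !rmorphM exprM !rmorphXn /= -rmorphXn -by_ exprMn; ring.
Qed.

End Integral.

(** Euclid's trick: 1 + X h is coprime to [h], whereas by [integral_divides] it would divide a power
    of [h]. Transcendence of [z] transports this divisibility to polynomials over [K]. *)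
Lemma transcendental_not_integral (K : fieldType) (B : comNzRingType)
    (iota : {rmorphism B -> K}) z (h : {poly B}) :
    (forall p, poly_eval iota z p = 0 -> map_poly iota p = 0) ->
    poly_eval iota z h != 0 ->
  ~ forall x, exists m, integralOver (poly_eval iota z) (poly_eval iota z h ^+ m * x).
Proof.
move=> tr h0 Hh.
set H := map_poly iota h.
have H0 : H != 0 by apply: contraNneq h0; rewrite /poly_eval -/H => ->; rewrite horner0.
pose q := 1 + 'X * h.
have mq : map_poly iota q = 1 + 'X * H by rewrite rmorphD rmorphM rmorph1 /= map_polyX.
have sXH : size ('X * H) = (size H).+1 by rewrite mulrC size_mulX.
have sq : size (map_poly iota q) = (size H).+1.
  by rewrite mq addrC size_polyDl // size_poly1 sXH ltnS size_poly_gt0.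
have q0 : poly_eval iota z q != 0.
  by apply: contraTneq (leqnn (size H)) => /tr e; move: sq; rewrite e size_poly0.
have [c [m e]] := integral_divides q0 Hh.
have /tr : poly_eval iota z (q * c - h ^+ m) = 0 by rewrite rmorphB /= e subrr.
rewrite rmorphB rmorphM rmorphXn => /eqP; rewrite subr_eq0 => /eqP {}e.
have cop : coprimep (map_poly iota q) H.
  apply/Bezout_coprimepP; exists (1, - 'X) => /=.
  by rewrite mq mul1r mulNr addrK eqpxx.
have : map_poly iota q %| H ^+ m by rewrite /H -e dvdp_mulr.
move/dvdp_gcd_idl => gq; move: (coprimep_expr m cop).
by rewrite coprimep_def (eqp_size gq) sq eqSS size_poly_eq0 (negPf H0).
Qed.

(** Goldman's form of Zariski's lemma: powers of one element [h] make everything integral over [B].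
    The base is a ring because the induction passes from [B] to B[z]; [transcendental_not_integral]
    then forces z to be algebraic. *)
Lemma zariski_goldman (K : fieldType) (zs : seq K) (B : comNzRingType)
    (iota : {rmorphism B -> K}) : ring_generated iota zs ->
  exists h, iota h != 0 /\ forall x, exists m, integralOver iota (iota h ^+ m * x).
Proof.
elim: zs B iota => [|z zs IH] B iota gen.
  exists 1; rewrite rmorph1 oner_eq0; split=> // x; exists 0%N.
  by have [b ->] := ring_generated_nil gen x; rewrite mul1r; apply: integral_id.
have [h [h0 Hh]] := IH _ _ (ring_generated_cons gen).
have [[p [p0 pz]]|tr] := pselect (exists p, map_poly iota p != 0 /\ poly_eval iota z p = 0);
  last first.
  by case: (transcendental_not_integral _ h0 Hh) => p p0; apply: contrapT => /eqP np; apply: tr; exists p.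
have [b [b0 bz]] : exists b, iota b != 0 /\ integralOver iota (iota b * z).
  set P := map_poly iota p in p0.
  exists p`_(size P).-1; have e : iota p`_(size P).-1 = lead_coef P.
    by rewrite lead_coefE coef_map.
  rewrite e lead_coef_eq0; split=> //.
  apply: (@integral_scale _ _ _ ((lead_coef P)^-1 *: P)).
  - by rewrite monicE lead_coefZ mulVf ?lead_coef_eq0.
  - by rewrite rootZ ?invr_eq0 ?lead_coef_eq0 //; apply/rootP.
  - by rewrite -e; apply: integral_id.
  - move=> i; rewrite coefZ mulVKf ?lead_coef_eq0 // coef_map; exact: integral_id.
have bint (g : {poly B}) : exists k, forall l, (k <= l)%N ->
    integralOver iota (iota b ^+ l * poly_eval iota z g).
  exists (size g) => l gl; rewrite /poly_eval (@horner_coef_wide _ (size g)) ?size_poly //.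
  rewrite mulr_sumr; apply: integral_sum => i _.
  have il : (i <= l)%N by apply: leq_trans gl; apply: ltnW.
  rewrite -(subnK il) exprD coef_map.
  have -> : iota b ^+ (l - i) * iota b ^+ i * (iota g`_i * z ^+ i) =
     iota (b ^+ (l - i) * g`_i) * (iota b * z) ^+ i.
    by rewrite rmorphM rmorphXn exprMn /=; ring.
  by apply: integral_mul; [exact: integral_id | exact: integral_exp].
have [k /(_ k (leqnn k)) hk] := bint h.
set eta := poly_eval iota z h in h0 Hh hk.
have [c [c0 cint]] := integral_inverse_multiple (mulf_neq0 (expf_neq0 k b0) h0) hk.
(* Powers of b make polynomials in z integral, and c makes c / (b^k eta) integral, which absorbs the
   denominators eta^m. *)
exists (b * c); rewrite rmorphM mulf_neq0 //; split=> // x.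
have [m [s ms sr]] := Hh x.
have [N HN] : exists N, forall i, integralOver iota (iota b ^+ N * poly_eval iota z s`_i).
  have [f Hf] := choice (fun i => bint s`_i).
  exists (\max_(i < size s) f i) => i; have [si|si] := ltnP i (size s).
    by apply: Hf; apply: (leq_bigmax (Ordinal si)).
  by rewrite nth_default // rmorph0 mulr0; apply: integral0.
have bNx : integralOver iota (iota b ^+ N * (eta ^+ m * x)).
  apply: (integral_scale _ sr) => [||i]; first exact: monic_map.
    by rewrite -rmorphXn; apply: integral_id.
  by rewrite coef_map /=; apply: HN.
exists (N + m)%N.
have -> : (iota b * iota c) ^+ (N + m) * x =
    (iota b ^+ N * (eta ^+ m * x)) * (iota c / (iota b ^+ k * eta)) ^+ m *
    iota (b ^+ (k * m) * b ^+ m * c ^+ N).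
  rewrite !rmorphM !rmorphXn /= !exprD !exprMn exprVn exprMn -exprM exprM.
  field; rewrite ?expf_neq0 //.
by apply: integral_mul; [apply: integral_mul => //; apply: integral_exp | apply: integral_id].
Qed.

(** If z were transcendental, [zariski_goldman] over the base F[z] would contradict
    [transcendental_not_integral]. *)
Lemma zariski (F K : fieldType) (iota : {rmorphism F -> K}) (zs : seq K) :
  ring_generated iota zs -> forall z, algebraicOver iota z.
Proof.
move=> gen z; apply: contrapT => nz.
have genz : ring_generated (poly_eval iota z) zs.
  by move=> P P1 PB PM Pe; apply: gen => // a; rewrite -(poly_evalC iota z).
have [h [h0 Hh]] := zariski_goldman genz.
apply: (transcendental_not_integral _ h0 Hh) => p pz; apply/eqP.
rewrite map_poly_eq0; apply: contrapT => /negP p0; apply: nz.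
by exists p => //; apply/rootP.
Qed.

(** * The Cohen-Macaulay criterion *)

Section ResidueField.
Variables (R : comPzRingType) (M : set R) (hM : maximal_ideal M).

(** The field structure rests on the maximality of [M], so the proof [hM] is made a parameter of the
    type that carries it. *)
Definition residue_field : Type := let _ := hM in quot_ring M.
HB.instance Definition _ := GRing.ComPzRing.on residue_field.

Definition residue : R -> residue_field := fun x => \pi_(quot_ring M) x.

Lemma residue_is_zmod_morphism : zmod_morphism residue.
Proof. by move=> x y; rewrite /residue [LHS]raddfB. Qed.

Lemma residue_is_monoid_morphism : monoid_morphism residue.
Proof. exact: quot_ring_pi_is_monoid_morphism. Qed.

HB.instance Definition _ := GRing.isZmodMorphism.Build R residue_field residue
  residue_is_zmod_morphism.
HB.instance Definition _ := GRing.isMonoidMorphism.Build R residue_field residue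
  residue_is_monoid_morphism.

Lemma residue_eq0 x : residue x = 0 <-> M x.
Proof.
have [cM _ _] := hM; split=> [/quot_ring_pi_eq0 gx|Mx].
  exact: (ideal_gen_sub cM _ gx).
by apply/quot_ring_pi_eq0; apply: mem_ideal_gen.
Qed.

Lemma residue_surj z : exists x, z = residue x.
Proof. by exists (repr (z : quot_ring M)); rewrite /residue reprK. Qed.

Lemma residue_nonzero : (1 : residue_field) != 0.
Proof.
have [_ M1 _] := hM; apply/eqP => e; apply: M1; apply/residue_eq0.
by rewrite rmorph1.
Qed.

HB.instance Definition _ := GRing.PzSemiRing_isNonZero.Build residue_field residue_nonzero.

Lemma residue_inverse (z : residue_field) : exists w, (z = 0 -> w = 0) /\ (z <> 0 -> w * z = 1).
Proof.
have [z0|z0] := pselect (z = 0); first by exists 0.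
have [[M0 MD MM] M1 Mmax] := hM; have [x zx] := residue_surj z.
pose J : set R := [set y | exists a b, M a /\ y = a + b * x].
have cJ : ideal J.
  split=> [|_ _ [a [b [Ma ->]]] [c [d [Mc ->]]]|e _ [a [b [Ma ->]]]].
  - by exists 0, 0; rewrite mul0r addr0.
  - by exists (a + c), (b + d); split; [exact: MD | ring].
  - by exists (e * a), (e * b); split; [exact: MM | ring].
have [[a [b [Ma e]]]|J1] := pselect (J 1).
  exists (residue b); split=> // _; rewrite zx -rmorphM -(rmorph1 residue) e rmorphD.
  by rewrite /= (iffRL (residue_eq0 a) Ma) add0r.
case: z0; rewrite zx; apply/residue_eq0.
rewrite -(Mmax J) //; first by exists 0, 1; rewrite add0r mul1r.
by move=> y My; exists y, 0; rewrite mul0r addr0.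
Qed.

Definition residue_inv (z : residue_field) : residue_field :=
  projT1 (cid (residue_inverse z)).

Lemma residue_mulVf (z : residue_field) : z != 0 -> residue_inv z * z = 1.
Proof. by move=> /eqP z0; rewrite /residue_inv; case: cid => w /= [_]; apply. Qed.

Lemma residue_inv0 : residue_inv 0 = 0.
Proof. by rewrite /residue_inv; case: cid => w /= [w0 _]; apply: w0. Qed.

HB.instance Definition _ :=
  GRing.ComNzRing_isField.Build residue_field residue_mulVf residue_inv0.

End ResidueField.

Section Criterion.
Variables (F : fieldType) (R : comNzRingType) (cst : {rmorphism F -> R}).

Definition free_basis (r D : nat) (Z : 'I_r -> R) (G : 'I_D -> R) :=
  (forall x, mspan cst Z G x) /\
  (forall p : 'I_D -> {mpoly F[r]}, \sum_b mmap cst Z (p b) * G b = 0 ->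
     forall b, p b = 0).

(* p lies in the ideal generated by the variables of index < i *)
Definition low_vars r (i : nat) (p : {mpoly F[r]}) :=
  forall m : 'X_{1..r}, (forall l : 'I_r, (l < i)%N -> m l = 0%N) -> p@_m = 0.

Lemma low_varsMX r i (l : 'I_r) (p : {mpoly F[r]}) : (l < i)%N -> low_vars i ('X_l * p).
Proof.
move=> li m m0; rewrite [p]mpolyE mulr_sumr raddf_sum big1 //= => m' _.
rewrite -scalerAr -mpolyXD mcoeffZ mcoeffX.
have -> : (U_(l) + m' == m)%MM = false; last by rewrite mulr0.
apply/negP => /eqP e; have := m0 l li.
by rewrite -e mnmDE mnm1E eqxx.
Qed.

Lemma low_vars_sum r i I (s : seq I) (P : pred I) (p : I -> {mpoly F[r]}) :
  (forall j, P j -> low_vars i (p j)) -> low_vars i (\sum_(j <- s | P j) p j).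
Proof. by move=> H m m0; rewrite raddf_sum big1 // => j Pj; apply: H. Qed.

Lemma low_vars_cancel r (i : 'I_r) (p : {mpoly F[r]}) :
  low_vars i ('X_i * p) -> low_vars i p.
Proof.
move=> H m m0; rewrite -(mcoeffMX p U_(i)%MM m) mulrC addmC; apply: H => l li.
by rewrite mnmDE m0 // mnm1E; case: eqP => // e; move: li; rewrite -e ltnn.
Qed.

Lemma low_vars_ideal r (i : nat) (Z : 'I_r -> R) (J : set R) p : ideal J ->
  (forall l : 'I_r, (l < i)%N -> J (Z l)) -> low_vars i p -> J (mmap cst Z p).
Proof.
move=> [J0 JD JM] JZ pi; rewrite /mmap; apply: big_ind => // m _.
have [/forallP H|] := boolP [forall l : 'I_r, (l < i)%N ==> (m l == 0%N)].
  rewrite pi ?rmorph0 ?mul0r // => l li; apply/eqP.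
  by have /implyP := H l; apply.
rewrite negb_forall => /existsP[l]; rewrite negb_imply => /andP[li ml].
apply: (JM); rewrite /mmap1 (bigD1 l) //= -(prednK (n := m l)) ?lt0n // exprS.
by rewrite -mulrA mulrC; apply: JM; apply: JZ.
Qed.

(** Comparing coordinates in the basis [G] reduces the claim to the regularity of the variables in a
    polynomial ring. There, membership in the ideal of the first i variables is visible on
    monomials, and multiplication by the next variable does not affect it. *)
Lemma free_basis_regular r D (Z : 'I_r -> R) (G : 'I_D -> R) : free_basis Z G ->
  forall i x, (i < size (codom Z))%N ->
    ideal_gen [set` take i (codom Z)] ((codom Z)`_i * x) ->
    ideal_gen [set` take i (codom Z)] x.
Proof.
move=> [gen ind] i x; rewrite size_codom card_ord => ir.
have nthZ l (lr : (l < r)%N) : (codom Z)`_l = Z (Ordinal lr).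
  rewrite codomE (nth_map (Ordinal lr)) ?size_enum_ord //; congr (Z _).
  by apply: val_inj; rewrite /= nth_enum_ord.
have [p xp] := gen x.
move=> /ideal_gen_seqP[c]; rewrite size_take size_codom card_ord ir (nthZ _ ir) => ce.
have [q Hq] := choice (fun l => gen (c l)).
have lr (l : 'I_i) : (l < r)%N := ltn_trans (ltn_ord l) ir.
have key b : 'X_(Ordinal ir) * p b = \sum_(l < i) 'X_(Ordinal (lr l)) * q l b.
  apply/eqP; rewrite -subr_eq0; apply/eqP; move: b.
  apply: ind; under eq_bigr => b _ do rewrite rmorphB rmorphM /= mmapX mmap1U mulrBl -mulrA.
  rewrite sumrB -mulr_sumr -xp ce.
  under [X in _ - X]eq_bigr => b _ do rewrite rmorph_sum mulr_suml.
  rewrite exchange_big -sumrB big1 //= => l _; rewrite nth_take // (nthZ _ (lr l)) Hq.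
  rewrite mulrC mulr_sumr -sumrB big1 // => b _.
  by rewrite rmorphM /= mmapX mmap1U mulrA subrr.
have cJ := ideal_gen_ideal [set` take i (codom Z)].
rewrite xp; apply: ideal_sum => // b; have [_ _ JM] := cJ.
rewrite mulrC; apply: JM; apply: (low_vars_ideal (i := i)) => // [l li|].
  apply: mem_ideal_gen => /=.
  have -> : Z l = (take i (codom Z))`_l.
    by rewrite nth_take // (nthZ _ (ltn_ord l)); congr (Z _); apply: val_inj.
  by apply: mem_nth; rewrite size_take size_codom card_ord ir.
apply: (@low_vars_cancel _ (Ordinal ir)); rewrite key.
by apply: low_vars_sum => l _; apply: low_varsMX; apply: (ltn_ord l).
Qed.

Lemma cohen_macaulay_criterion (r : nat) (Y : 'I_r -> R) (zs : seq R) :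
    ring_generated cst zs ->
    (forall f : 'I_r -> {poly F}, (forall j, f j \is monic) ->
       (forall j, (1 < size (f j))%N) ->
       exists D (G : 'I_D -> R), free_basis (fun j => poly_eval cst (Y j) (f j)) G) ->
  cohen_macaulay R.
Proof.
move=> gen free; have nR : noetherian R := noetherian_generated (@noetherian_field F) gen.
split=> // M hM.
have gen' : ring_generated (residue hM \o cst) (map (residue hM) zs).
  move=> P P1 PB PM Pc Pz b; have [x ->] := residue_surj b.
  apply: (gen (fun x => P (residue hM x))) => [|u v|u v|a|z zz].
  - by rewrite rmorph1.
  - by rewrite rmorphB; apply: PB.
  - by rewrite rmorphM; apply: PM.
  - exact: Pc.
  - by apply: Pz; apply: map_f.
have exf (j : 'I_r) : exists f : {poly F},
    [/\ f \is monic, (1 < size f)%N & M (poly_eval cst (Y j) f)].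
  have [p p0 pr] := zariski gen' (residue hM (Y j)).
  have lc0 : lead_coef p != 0 by rewrite lead_coef_eq0.
  have root_p : M (poly_eval cst (Y j) p).
    by apply/residue_eq0; rewrite /poly_eval -horner_map -map_poly_comp; apply/rootP.
  exists ((lead_coef p)^-1 *: p); split.
  - by rewrite monicE lead_coefZ mulVf.
  - rewrite size_scale ?invr_eq0 // ltnNge; apply: contraL pr => /size1_polyC e.
    move: p0; rewrite e polyC_eq0 => p0; rewrite map_polyC rootC.
    by rewrite (fmorph_eq0 (residue hM \o cst)).
  - rewrite -mul_polyC rmorphM /=; have [[_ _ MM] _ _] := hM; exact: MM.
have [f Hf] := choice exf.
have [||D [G fG]] := free f; try by move=> j; have [] := Hf j.
set Z := fun j => _ in fG.
apply: (@cohen_macaulay_local_criterion _ _ M (loc (maximal_prime hM)) hM _ _ _ (codom Z)).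
- exact: loc_frac.
- exact: loc_unit.
- exact: loc_eq.
- exact: nR.
- by move=> _ /= /codomP[j ->]; have [] := Hf j.
- exact: free_basis_regular fG.
- move=> P e cP; rewrite size_codom card_ord.
  by apply: (finite_module_dimension fG.1 cP).
Qed.

End Criterion.

(** * Spanning family *)

Lemma big_image_uniq (R : zmodType) (A B : eqType) (s : seq A) (t : seq B)
    (f : A -> B) (G : B -> R) :
    uniq s -> uniq t -> {in s &, injective f} ->
    (forall y, y \in t <-> exists2 x, x \in s & y = f x) ->
  \sum_(y <- t) G y = \sum_(x <- s) G (f x).
Proof.
move=> us ut fi ft; rewrite -(big_map f xpredT G); apply: perm_big.
apply: uniq_perm => // [|y]; first by rewrite map_inj_in_uniq.
by apply/idP/mapP => [/ft|H]; last exact/ft.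
Qed.

Section PolyLists.
Variable k : finFieldType.
Implicit Types p u v w : {poly k}.

(** An explicit list, since [{poly k}] is not a finite type. The recursion on the top coefficient is
    the one behind [epolS]. *)
Fixpoint polys (i : nat) : seq {poly k} :=
  if i is j.+1 then [seq a *: 'X^j + p | a <- enum k, p <- polys j] else [:: 0].

Lemma polysS i : polys i.+1 = [seq a *: 'X^i + p | a <- enum k, p <- polys i].
Proof. by []. Qed.

Lemma size_polys i : size (polys i) = (#|k| ^ i)%N.
Proof. by elim: i => // i IH; rewrite polysS size_allpairs IH expnS cardE. Qed.

Lemma mem_polys i p : (p \in polys i) = (size p <= i)%N.
Proof.
elim: i p => [|i IH] p; first by rewrite inE leqn0 size_poly_eq0.
rewrite polysS; apply/allpairsP/idP => [[[a u] [_ ui ->]]|pi].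
  rewrite IH /= in ui; apply: leq_trans (size_polyD _ _) _.
  rewrite geq_max (leq_trans (size_scale_leq _ _)) ?size_polyXn //.
  exact: leq_trans ui _.
exists (p`_i, p - p`_i *: 'X^i); rewrite mem_enum IH; split=> //=; last by rewrite addrC subrK.
apply/leq_sizeP => j; rewrite leq_eqVlt coefB coefZ coefXn => /orP[/eqP <-|ij].
  by rewrite eqxx mulr1 subrr.
by rewrite nth_default ?(leq_trans pi) // gtn_eqF // mulr0 subr0.
Qed.

Lemma polys_uniq i : uniq (polys i).
Proof.
elim: i => // i IH; rewrite polysS; apply: allpairs_uniq => //; first exact: enum_uniq.
move=> _ _ /allpairsP[[a u] [_ ui ->]] /allpairsP[[b v] [_ vi ->]] /= e.
move: ui vi; rewrite !mem_polys /= => ui vi.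
have ab : a = b.
  have := congr1 (fun p : {poly k} => p`_i) e.
  by rewrite /= !coefD !coefZ !coefXn eqxx !mulr1 [u`_i]nth_default // [v`_i]nth_default // !addr0.
by move: e; rewrite ab => /addrI ->.
Qed.

Definition monics i : seq {poly k} := [seq 'X^i + p | p <- polys i].

Lemma size_monics i : size (monics i) = (#|k| ^ i)%N.
Proof. by rewrite size_map size_polys. Qed.

Lemma mem_monics i p : (p \in monics i) = (p \is monic) && (size p == i.+1).
Proof.
apply/mapP/andP => [[u ui ->]|[mp /eqP sp]].
  rewrite mem_polys in ui.
  have s : size ('X^i + u) = i.+1 by rewrite size_polyDl size_polyXn.
  split; last by rewrite s.
  by rewrite monicE lead_coefDl ?size_polyXn // lead_coefXn.
exists (p - 'X^i); last by rewrite addrC subrK.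
rewrite mem_polys; apply/leq_sizeP => j; rewrite leq_eqVlt coefB coefXn => /orP[/eqP <-|ij].
  by rewrite eqxx; have /monicP := mp; rewrite lead_coefE sp => ->; rewrite subrr.
by rewrite nth_default ?sp // gtn_eqF // subrr.
Qed.

Lemma monics_uniq i : uniq (monics i).
Proof. by rewrite map_inj_uniq ?polys_uniq //; apply: addrI. Qed.

Lemma size_mulXn_leq p i j : (size p <= j)%N -> (size (p * 'X^i)%R <= j + i)%N.
Proof.
move=> pj; have [->|p0] := eqVneq p 0; first by rewrite mul0r size_poly0.
by rewrite size_mulXn // addnC leq_add2r.
Qed.

End PolyLists.

Section RationalFunctions.
Variable k : finFieldType.
Local Notation F := {fraction {poly k}}.

Definition tF : F := ('X : {poly k})%:F.

Lemma tF_neq0 : tF != 0.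
Proof. by rewrite tofrac_eq0 polyX_eq0. Qed.

Definition inv_t_eval : {poly k} -> F := poly_eval (@const_ratfun k) tF^-1.
HB.instance Definition _ := GRing.RMorphism.on inv_t_eval.

(** Transcendence of 1/t: for p of degree d, t^d p(1/t) is the polynomial with reversed
    coefficients, whose constant term is the leading coefficient of p. *)
Lemma inv_t_eval_eq0 p : inv_t_eval p = 0 -> p = 0.
Proof.
move=> p0; apply/eqP; apply: contrapT => /negP pn0; have /eqP[] := pn0.
have sp : (0 < size p)%N by rewrite size_poly_gt0.
set d := (size p).-1; have dS : size p = d.+1 by rewrite prednK.
pose q : {poly k} := \sum_(i < d.+1) p`_i *: 'X^(d - i).
have : q%:F = 0.
  transitivity (tF ^+ d * inv_t_eval p); last by rewrite p0 mulr0.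
  rewrite rmorph_sum /inv_t_eval /poly_eval.
  rewrite (@horner_coef_wide _ d.+1) -?dS ?size_poly // mulr_sumr dS.
  apply: eq_bigr => i _; rewrite -mul_polyC rmorphM coef_map /= mulrCA; congr (_ * _).
  rewrite exprVn tofracXn -expfB_cond // [_ == 0](negPf tF_neq0); exact: (ltn_ord i).
move/eqP; rewrite tofrac_eq0 => /eqP/(congr1 (fun s : {poly k} => s`_0)).
rewrite /q coef_sum big_ord_recr big1 /= => [|i _].
  rewrite add0r subnn coefZ coefXn mulr1 coef0 => pd.
  by have := lead_coef_eq0 p; rewrite lead_coefE -/d pd eqxx => /esym/eqP.
rewrite coefZ coefXn; case: eqP => [e|_]; rewrite ?mulr0 //.
by have := ltn_ord i; lia.
Qed.

Lemma inv_t_evalX : inv_t_eval 'X = tF^-1.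
Proof. exact: poly_evalX. Qed.

Lemma inv_t_evalC a : inv_t_eval a%:P = const_ratfun a.
Proof. exact: poly_evalC. Qed.

End RationalFunctions.

Section Nakayama.
Variables (k : finFieldType) (R : comPzRingType).
Local Notation F := {fraction {poly k}}.
Variables (cst : {rmorphism F -> R}) (S : set R).
Hypothesis S0 : S 0.
Hypothesis SD : forall x y, S x -> S y -> S (x + y).
Hypothesis SZ : forall c x, S x -> S (cst c * x).

Lemma subspace_sum I (s : seq I) (P : pred I) (G : I -> R) :
  (forall i, P i -> S (G i)) -> S (\sum_(i <- s | P i) G i).
Proof. by move=> H; apply: big_ind. Qed.

(** The coefficients are the multiples of 1/t in k[1/t]: this is membership in S + (1/t) k[1/t] e,
    the hypothesis of Nakayama's lemma. *)
Definition small_comb (e : seq R) (x : R) :=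
  exists s (c : nat -> {poly k}), S s /\
    x = s + \sum_(i < size e) cst (inv_t_eval ('X * c i)) * e`_i.

(* The coefficients of the relations involve only positive powers of 1/t, so the
   determinant is 1 modulo 1/t, hence nonzero as 1/t is transcendental over k. *)
Lemma nakayama (e : seq R) :
  (forall i, (i < size e)%N -> small_comb e e`_i) -> forall i, (i < size e)%N -> S e`_i.
Proof.
move=> H.
have H' (i : 'I_(size e)) : exists sc : R * (nat -> {poly k}), S sc.1 /\
    e`_i = sc.1 + \sum_(j < size e) cst (inv_t_eval ('X * sc.2 j)) * e`_j.
  by have [s [c Hsc]] := H i (ltn_ord i); exists (s, c).
have [sc Hsc] := choice H'.
pose Mx : 'M[{poly k}]_(size e) := \matrix_(i, j) ('X * (sc i).2 j).
pose A := 1%:M - Mx.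
have detA : inv_t_eval (\det A) != 0.
  apply: contraTneq isT => /inv_t_eval_eq0 /(congr1 (horner_eval 0)).
  rewrite rmorph0 -det_map_mx /A rmorphB /=.
  have -> : map_mx (horner_eval 0) Mx = 0.
    by apply/matrixP => i j; rewrite !mxE /horner_eval hornerM hornerX mul0r.
  by rewrite subr0 map_mx1 det1 => /eqP; rewrite oner_eq0.
move=> i0 lti0; pose i := Ordinal lti0.
(* Cramer's rule: row i of the adjugate of 1 - Mx combines the elements of [S] into the determinant
   times the entry of [e]. The determinant is then divided out, as [S] is stable under all of F. *)
pose a l j : F := inv_t_eval (A l j); pose b l : F := inv_t_eval ((\adj A) i l).
have rel l : (sc l).1 = \sum_j cst (a l j) * e`_j.
  have [_ el] := Hsc l.
  have -> : (sc l).1 = e`_l - \sum_(j < size e) cst (inv_t_eval ('X * (sc l).2 j)) * e`_j.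
    by rewrite {1}el addrK.
  rewrite [e`_l in LHS](_ : _ = \sum_(j < size e) cst (inv_t_eval (l == j)%:R) * e`_j).
    rewrite -sumrB; apply: eq_bigr => j _.
    by rewrite /a /A !mxE rmorphB rmorphB mulrBl.
  rewrite (bigD1 l) //= eqxx !rmorph1 mul1r big1 ?addr0 // => j jl.
  by rewrite eq_sym (negPf jl) !rmorph0 mul0r.
have : S (\sum_l cst (b l) * (sc l).1).
  by apply: subspace_sum => l _; apply: SZ; have [] := Hsc l.
have -> : \sum_l cst (b l) * (sc l).1 = cst (inv_t_eval (\det A)) * e`_i0.
  under eq_bigr => l _ do rewrite rel mulr_sumr.
  rewrite exchange_big /=.
  transitivity (\sum_(j < size e) cst (inv_t_eval ((\adj A *m A) i j)) * e`_j).
    apply: eq_bigr => j _; rewrite mxE !rmorph_sum mulr_suml.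
    by apply: eq_bigr => l _; rewrite !rmorphM mulrA.
  rewrite mul_adj_mx (bigD1 i) //= mxE eqxx mulr1n big1 ?addr0 // => j ji.
  by rewrite mxE eq_sym (negPf ji) mulr0n !rmorph0 mul0r.
move=> /(SZ (inv_t_eval (\det A))^-1); rewrite mulrA -rmorphM mulVf //.
by rewrite rmorph1 mul1r.
Qed.

End Nakayama.

Fixpoint words (T : Type) (A : seq T) (d : nat) : seq (seq T) :=
  if d is d'.+1 then [seq a :: s | a <- A, s <- words A d'] else [:: [::]].

Lemma mem_words (T : eqType) (A : seq T) d s :
  (s \in words A d) = (size s == d) && all (fun a => a \in A) s.
Proof.
elim: d s => [|d IH] s; first by case: s.
rewrite -[words A d.+1]/[seq a :: s | a <- A, s <- words A d].
apply/allpairsP/idP => [[[a t] /= [aA tw ->]]|].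
  by move: tw; rewrite IH /= eqSS aA.
case: s => // a s; rewrite /= eqSS => /andP[ss /andP[aA sA]].
by exists (a, s); rewrite IH ss sA.
Qed.

(* A vector of V_n is encoded by a polynomial p of degree < n r, on which t acts
   as drop_poly r (see vec below); X p stands for 1/p. Classes of
   V_n \ V_(n-1) are the p with n.-1 * r < size p. *)
Section Straightening.
Variables (k : finFieldType) (R : comPzRingType).
Local Notation F := {fraction {poly k}}.
Local Notation polys := (polys k).
Local Notation monics := (monics k).
Variables (cst : {rmorphism F -> R}) (n r : nat) (X : {poly k} -> R).
Hypothesis n_gt0 : (0 < n)%N.
Local Notation N0 := (n.-1 * r)%N.
Local Notation con := (@const_ratfun k).

Hypothesis X_scale : forall (a : k) (p : {poly k}), a != 0 -> X (a *: p) = cst (con a^-1) * X p.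
Hypothesis X_mul : forall p q : {poly k}, (size p <= n * r)%N -> (size q <= n * r)%N ->
  p != 0 -> q != 0 -> p != q -> X p * X q = X (q - p) * (X p - X q).
Hypothesis X_tor : forall nu (p : {poly k}),
  (nu <= n)%N -> (size p <= n * r)%N -> (nu * r < size p)%N ->
  cst (@tF k ^+ nu) * X (drop_poly (nu * r) p) = \sum_(u <- polys (nu * r)) X (p - u).

(** One representative, up to scalars of k, for each vector of V_n outside V_(n-1). *)
Definition top_monics := flatten [seq monics i | i <- iota N0 r].
Local Notation Dl := top_monics.

Lemma mem_top_monics p : (p \in Dl) = (p \is monic) && (N0 < size p <= n * r)%N.
Proof.
have e : (N0 + r)%N = (n * r)%N by rewrite -mulSnr prednK.
apply/flatten_mapP/idP => [[i]|/andP[mp /andP[N0p pn]]].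
  rewrite mem_iota mem_monics e => /andP[N0i ir] /andP[-> /eqP ->].
  by rewrite ltnS N0i.
have p0 : (0 < size p)%N by apply: leq_ltn_trans N0p.
exists (size p).-1; last by rewrite mem_monics mp prednK ?eqxx.
rewrite mem_iota e; move: p0 N0p pn; lia.
Qed.

(** A vector of V_(n-1) can be divided by a power of t so as to leave V_(n-1). The torsion relation
    for that power then makes [X w] a positive power of 1/t times a sum of top elements, hence zero
    modulo 1/t. *)
Lemma X_shift (w : {poly k}) : w != 0 -> (size w <= n * r)%N ->
    (exists a w', [/\ a != 0, w' \in Dl, size w' = size w & X w = cst (con a) * X w']) \/
    (exists a nu, (0 < nu)%N /\ exists s : seq {poly k}, {subset s <= Dl} /\
       X w = cst (con a * (tF k)^-1 ^+ nu) * \sum_(u <- s) X u).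
Proof.
move=> w0 wn; have sw : (0 < size w)%N by rewrite size_poly_gt0.
have lw : lead_coef w != 0 by rewrite lead_coef_eq0.
have lVw : (lead_coef w)^-1 != 0 by rewrite invr_eq0.
have mw p : lead_coef p = lead_coef w -> (lead_coef w)^-1 *: p \is monic.
  by move=> e; rewrite monicE lead_coefZ e mulVf.
have [N0w|wN0] := ltnP N0 (size w); [left | right].
  exists (lead_coef w)^-1, ((lead_coef w)^-1 *: w); rewrite size_scale //; split=> //.
    by rewrite mem_top_monics mw // size_scale // N0w.
  by rewrite -{1}[w](scalerKV lw) X_scale.
pose l := (size w).-1; have lS : size w = l.+1 by rewrite prednK.
have r0 : (0 < r)%N.
  by rewrite lt0n; apply: contraTneq wN0 => ->; rewrite muln0 -ltnNge.
have llt : (l < N0)%N by rewrite -lS.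
(* The degree l sits on level l / r, and [nu] counts the levels up to the last one, n - 1; so w
   X^(nu r) has degree between (n-1) r and n r - 1. *)
pose nu := (n.-1 - l %/ r)%N.
have ldiv : (l %/ r < n.-1)%N by rewrite ltn_divLR.
have nu0 : (0 < nu)%N by rewrite subn_gt0.
have nun : (nu <= n)%N by rewrite /nu (leq_trans (leq_subr _ _)) // leq_pred.
have lnu : (l + nu * r)%N = (N0 + l %% r)%N.
  rewrite {1}(divn_eq l r) /nu mulnBl addnAC -mulnBl -mulnDl subnKC //; exact: ltnW.
have lrem : (l %% r < r)%N by rewrite ltn_mod.
have e : (N0 + r)%N = (n * r)%N by rewrite -mulSnr prednK.
pose p := w * 'X^(nu * r).
have sp : size p = (l + nu * r).+1 by rewrite size_mulXn // lS addnC.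
have spn : (size p <= n * r)%N by rewrite sp lnu -e -addnS leq_add2l.
have nup : (nu * r < size p)%N by rewrite sp ltnS leq_addl.
have pw : drop_poly (nu * r) p = w by rewrite drop_polyMXn_id.
have lp_u u : u \in polys (nu * r) -> size (p - u) = size p /\ lead_coef (p - u) = lead_coef w.
  rewrite mem_polys => us; have us' : (size (- u) < size p)%N by rewrite size_polyN (leq_ltn_trans us).
  rewrite size_polyDl // lead_coefDl //; split=> //.
  by rewrite lead_coef_Mmonic ?monicXn.
exists (lead_coef w)^-1, nu; split=> //.
exists [seq (lead_coef w)^-1 *: (p - u) | u <- polys (nu * r)]; split.
  move=> _ /mapP[u /lp_u[su lu] ->].
  by rewrite mem_top_monics mw // size_scale // su sp lnu ltnS leq_addr -addnS -e leq_add2l.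
rewrite big_map rmorphM -mulrA.
have := X_tor nun spn nup; rewrite pw => tw.
have -> : X w = cst ((tF k)^-1 ^+ nu) * (\sum_(u <- polys (nu * r)) X (p - u)).
  by rewrite -tw mulrA -rmorphM -exprMn mulVf ?tF_neq0 // expr1n rmorph1 mul1r.
rewrite mulrCA; congr (_ * _); rewrite mulr_sumr; apply: eq_bigr => u _.
by rewrite X_scale // mulrA -rmorphM invrK -rmorphM mulVf // !rmorph1 mul1r.
Qed.

Definition Xword (s : seq {poly k}) : R := \prod_(p <- s) X p.

Definition top_sum (i : nat) : R := \sum_(p <- monics i) X p.

Fixpoint top_products (js : seq nat) : seq R :=
  if js is i :: js' then
    [seq b * g | b <- 1 :: [seq X p | p <- behead (monics i)], g <- top_products js']
  else [:: 1].

Lemma top_products_cons i js : top_products (i :: js) =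
  [seq b * g | b <- 1 :: [seq X p | p <- behead (monics i)], g <- top_products js].
Proof. by []. Qed.

Definition lev (p : {poly k}) := (size p).-1.

Lemma top_products_mem js s : uniq js -> uniq (map lev s) ->
    {subset map lev s <= js} -> (forall p, p \in s -> p \in behead (monics (lev p))) ->
  Xword s \in top_products js.
Proof.
elim: js s => [|i js IH] s ujs us sub sb.
  case: s us sub sb => [|p s] _ sub _; first by rewrite /Xword big_nil mem_head.
  by have := sub (lev p) (mem_head _ _).
move: ujs; rewrite cons_uniq => /andP[nij ujs].
rewrite top_products_cons.
have [/mapP[p ps e]|ni] := boolP (i \in map lev s).
  have := perm_to_rem ps => pe.
  have -> : Xword s = X p * Xword (rem p s) by rewrite /Xword (perm_big _ pe) big_cons.
  have pe' : perm_eq (map lev s) (lev p :: map lev (rem p s)) := perm_map lev pe.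
  move: us; rewrite (perm_uniq pe') cons_uniq => /andP[np urem].
  apply/allpairsP; exists (X p, Xword (rem p s)); split=> //=.
    by rewrite inE map_f ?orbT // e sb.
  apply: IH => // [j jr|q qr]; last by apply: sb; apply: mem_rem qr.
  have : j \in i :: js by apply: sub; rewrite (perm_mem pe') inE jr orbT.
  by rewrite inE => /orP[/eqP ji|//]; rewrite ji e in jr; rewrite jr in np.
apply/allpairsP; exists (1, Xword s); split=> //=; rewrite ?mem_head ?mul1r //.
apply: IH => // j js'; have := sub _ js'; rewrite inE => /orP[/eqP ji|//].
by rewrite ji (negPf ni) in js'.
Qed.

Lemma small_comb_S (S : set R) e x : S x -> small_comb cst S e x.
Proof.
by move=> Sx; exists x, (fun=> 0); rewrite big1 ?addr0 // => i _; rewrite mulr0 !rmorph0 mul0r.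
Qed.

Lemma monic_sub_size (p q : {poly k}) : p \is monic -> q \is monic -> size p = size q ->
  (size (q - p)%R < size p)%N.
Proof.
move=> mp mq e; have sp : size p = (size p).-1.+1 by rewrite prednK ?size_poly_gt0 ?monic_neq0.
rewrite sp ltnS; apply/leq_sizeP => j; rewrite leq_eqVlt coefB => /orP[/eqP <-|lj].
  have /monicP := mp; have /monicP := mq; rewrite !lead_coefE -e => -> ->.
  by rewrite subrr.
by rewrite !nth_default ?subrr // -?e sp.
Qed.

Lemma not_uniq_lev (s : seq {poly k}) : ~~ uniq (map lev s) ->
  exists p q t, perm_eq s [:: p, q & t] /\ lev p = lev q.
Proof.
elim: s => // p s IH /=; rewrite negb_and negbK => /orP[/mapP[q qs e]|/IH[q [q' [t [pt e]]]]].
  exists p, q, (rem q s); split=> //; rewrite perm_cons; exact: perm_to_rem.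
exists q, q', (p :: t); split=> //.
apply: (@perm_trans _ (p :: [:: q, q' & t])); first by rewrite perm_cons.
by rewrite -[p :: _]/([:: p] ++ [:: q; q'] ++ t) perm_catCA.
Qed.

Lemma Xword_cons p s : Xword (p :: s) = X p * Xword s.
Proof. by rewrite /Xword big_cons. Qed.

Lemma Xword_perm s t : perm_eq s t -> Xword s = Xword t.
Proof. by move=> st; rewrite /Xword (perm_big _ st). Qed.

Section Span.
Variable S : set R.
Hypothesis S0 : S 0.
Hypothesis SD : forall x y, S x -> S y -> S (x + y).
Hypothesis SZ : forall c x, S x -> S (cst c * x).
Hypothesis SY : forall i x, i \in iota N0 r -> S x -> S (top_sum i * x).
Hypothesis SG : forall g, g \in top_products (iota N0 r) -> S g.

Lemma small_combD e x y :
  small_comb cst S e x -> small_comb cst S e y -> small_comb cst S e (x + y).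
Proof.
move=> [s [c [Ss ->]]] [t [d [St ->]]]; exists (s + t), (fun i => c i + d i).
split; first exact: SD.
rewrite addrACA -big_split; congr (_ + _); apply: eq_bigr => i _.
by rewrite mulrDr !rmorphD mulrDl.
Qed.

Lemma small_comb_scale e p x :
  small_comb cst S e x -> small_comb cst S e (cst (inv_t_eval p) * x).
Proof.
move=> [s [c [Ss ->]]]; exists (cst (inv_t_eval p) * s), (fun i => p * c i).
split; first exact: SZ.
rewrite mulrDr mulr_sumr; congr (_ + _); apply: eq_bigr => i _.
by rewrite mulrA -!rmorphM mulrCA.
Qed.

Lemma small_comb_const e a x :
  small_comb cst S e x -> small_comb cst S e (cst (con a) * x).
Proof. by rewrite -inv_t_evalC; apply: small_comb_scale. Qed.

Lemma small_combN e x : small_comb cst S e x -> small_comb cst S e (- x).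
Proof.
by move/(small_comb_const (-1)); rewrite !rmorphN !rmorph1 mulN1r.
Qed.

Lemma small_comb_sum e (I : eqType) (l : seq I) (G : I -> R) :
  (forall i, i \in l -> small_comb cst S e (G i)) -> small_comb cst S e (\sum_(i <- l) G i).
Proof.
move=> H; rewrite big_seq; apply: big_ind => //; last exact: small_combD.
exact: small_comb_S.
Qed.

Lemma small_comb_mem e a nu y : (0 < nu)%N -> y \in e ->
  small_comb cst S e (cst (con a * (tF k)^-1 ^+ nu) * y).
Proof.
move=> nu0 ye; exists 0, (fun i => (i == index y e)%:R * (a%:P * 'X^(nu.-1))).
split=> //; have ylt : (index y e < size e)%N by rewrite index_mem.
rewrite (bigD1 (Ordinal ylt)) //= big1 => [|i]; last first.
  by rewrite -val_eqE /= => /negPf ->; rewrite mul0r mulr0 !rmorph0 mul0r.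
rewrite add0r addr0 eqxx mul1r nth_index //; congr (cst _ * _).
rewrite mulrCA -exprS prednK // rmorphM rmorphXn /= inv_t_evalC.
by rewrite inv_t_evalX.
Qed.

Definition weight (s : seq {poly k}) := (\sum_(p <- s) size p)%N.

(* X_p X_q = X_(q - p) (X_p - X_q), and q - p has smaller degree than p and q. *)
Lemma straighten_pair d (p q : {poly k}) t :
    p != q -> size p = size q -> [:: p, q & t] \in words Dl d ->
    (forall s, s \in words Dl d -> (weight s < weight [:: p, q & t])%N ->
       small_comb cst S (map Xword (words Dl d)) (Xword s)) ->
  small_comb cst S (map Xword (words Dl d)) (Xword [:: p, q & t]).
Proof.
move=> npq spq; rewrite mem_words => /andP[sd /and3P[pD qD tD]] IH.
have pDl := pD; have qDl := qD; rewrite mem_top_monics in pD; rewrite mem_top_monics in qD.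
have [mp /andP[N0p pn]] := andP pD; have [mq /andP[N0q qn]] := andP qD.
have w0 : q - p != 0 by rewrite subr_eq0 eq_sym.
have sw := monic_sub_size mp mq spq.
(* If q - p is still a top vector, the new word is lighter and the induction hypothesis applies.
   Otherwise [X (q - p)] carries a positive power of 1/t, and the result is a small combination of
   words of the same length. *)
have half v : v \in Dl -> size v = size p -> small_comb cst S (map Xword (words Dl d))
    (X (q - p) * (X v * Xword t)).
  move=> vD sv; have [|[a [w' [a0 w'D sw' ->]]]|[a [nu [nu0 [us [usD ->]]]]]] := X_shift w0.
  - exact: leq_trans (ltnW sw) pn.
  - rewrite -mulrA; apply: small_comb_const; rewrite -!Xword_cons; apply: IH.
      by rewrite mem_words; move: sd => /= ->; rewrite w'D vD.
    by rewrite /weight !big_cons sw' sv -spq ltn_add2r.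
  - rewrite -mulrA mulr_suml mulr_sumr; apply: small_comb_sum => u uus.
    apply: small_comb_mem => //; apply/mapP; exists [:: u, v & t]; last by rewrite !Xword_cons.
    by rewrite mem_words; move: sd => /= ->; rewrite usD // vD.
rewrite !Xword_cons mulrA X_mul ?monic_neq0 //.
have -> : X (q - p) * (X p - X q) * Xword t =
  X (q - p) * (X p * Xword t) - X (q - p) * (X q * Xword t) by ring.
by apply: small_combD; [apply: half | apply: small_combN; apply: half].
Qed.

Lemma top_sum_split p : p \in Dl ->
  top_sum (lev p) = X p + \sum_(v <- monics (lev p) | v != p) X v.
Proof.
rewrite mem_top_monics => /andP[mp _]; rewrite /top_sum (bigD1_seq p) ?monics_uniq //=.
by rewrite mem_monics mp prednK ?eqxx // size_poly_gt0 monic_neq0.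
Qed.

Lemma lev_top p : p \in Dl -> lev p \in iota N0 r /\ size p = (lev p).+1.
Proof.
rewrite mem_top_monics mem_iota /lev => /andP[mp /andP[N0p pn]].
have sp : (0 < size p)%N by apply: leq_ltn_trans N0p.
have -> : (N0 + r)%N = (n * r)%N by rewrite -mulSnr prednK.
by rewrite -[X in (X <= _)%N]/(N0.+1.-1) -ltnS !prednK // N0p pn.
Qed.

Lemma monics_lev_top p v : p \in Dl -> v \in monics (lev p) -> v \in Dl /\ size v = size p.
Proof.
move=> pD; have [_ sp] := lev_top pD; rewrite mem_monics -sp => /andP[mv /eqP sv].
by move: pD; rewrite !mem_top_monics mv sv => /andP[_ ->].
Qed.

(** Here [c] counts the factors that come first among the monics of their degree. Such a factor is
    exchanged for Y minus the other [X v] of that degree: the Y term leaves a shorter word, and the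
    other terms have smaller [c]. Words with c = 0 belong to [top_products]. *)
Lemma uniq_lev_in_span d s : s \in words Dl d.+1 -> uniq (map lev s) ->
  (forall t, t \in words Dl d -> S (Xword t)) -> S (Xword s).
Proof.
pose c t := count (fun p => p == head 0 (monics (lev p))) t.
have [m] := ubnP (c s); elim: m s => // m IH s; rewrite ltnS => cm sW us Sd.
have sD p : p \in s -> p \in Dl.
  by move: sW; rewrite mem_words => /andP[_ /allP]; apply.
have mon_cons p : p \in Dl -> p = head 0 (monics (lev p)) -> monics (lev p) = p :: behead (monics (lev p)).
  move=> _ pe; have k0 : (0 < #|k|)%N by apply/card_gt0P; exists 0.
  have : (0 < size (monics (lev p)))%N by rewrite size_monics expn_gt0 k0.
  by case: (monics (lev p)) pe => //= v l <-.
have [/hasP[p ps /eqP pe]|nh] := boolP (has (fun p => p == head 0 (monics (lev p))) s); last first.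
  apply: SG; apply: top_products_mem => //; first exact: iota_uniq.
    by move=> _ /mapP[p /sD /lev_top[? _] ->].
  move=> p ps; have := hasPn nh p ps.
  have : p \in monics (lev p).
    have [_ sp] := lev_top (sD p ps); have := sD p ps.
    by rewrite mem_monics mem_top_monics sp eqxx andbT => /andP[].
  by case: (monics (lev p)) => //= v l; rewrite inE => /orP[->|].
have pD := sD p ps; have [polys sp] := lev_top pD.
have pt := perm_to_rem ps; set t := rem p s in pt.
have tW : t \in words Dl d.
  move: sW; rewrite !mem_words (perm_size pt) (perm_all _ pt) /= eqSS.
  by move=> /andP[-> /andP[_ ->]].
rewrite (Xword_perm pt) Xword_cons.
have -> : X p = top_sum (lev p) - \sum_(v <- behead (monics (lev p))) X v.
  by rewrite /top_sum {1}(mon_cons p pD pe) big_cons addrK.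
rewrite mulrBl; apply: SD; first by apply: SY => //; apply: Sd.
rewrite -mulN1r -(rmorph1 cst) -rmorphN; apply: (SZ).
rewrite mulr_suml big_seq; apply: subspace_sum => // v vb.
have vm : v \in monics (lev p) by apply: mem_behead.
have [vD sv] := monics_lev_top pD vm.
have lv : lev v = lev p by rewrite /lev sv.
rewrite -Xword_cons; apply: IH => //.
- apply: leq_trans cm; rewrite /c (permP pt) /= lv.
  have nv : v != head 0 (monics (lev p)).
    rewrite -pe; have := monics_uniq k (lev p); rewrite (mon_cons p pD pe) /= => /andP[np _].
    by apply: contraNneq np => e; move: vb; rewrite e.
  by rewrite (negPf nv) -pe eqxx.
- by move: tW; rewrite !mem_words /= eqSS vD.
- by move: us; rewrite (perm_uniq (perm_map lev pt)) /= lv.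
Qed.

(** Straightening preserves the number of factors, except in the terms where a Y is split off, which
    leave shorter words. Nakayama's lemma is therefore applied to the finite list of words of one
    length, by induction on that length. *)
Lemma Xword_in_span d s : s \in words Dl d -> S (Xword s).
Proof.
elim: d s => [|d IHd] s.
  rewrite inE => /eqP ->; apply: SG; apply: top_products_mem => //; exact: iota_uniq.
set es := map Xword (words Dl d.+1) => sW.
suff all_small t : t \in words Dl d.+1 -> small_comb cst S es (Xword t).
  have : Xword s \in es by apply: map_f.
  move=> /(nthP 0)[i ies <-]; apply: (nakayama S0 SD SZ _ ies) => j jes.
  by have /mapP[t tW ->] := mem_nth 0 jes; apply: all_small.
have [m] := ubnP (weight t); elim: m t => // m IH t; rewrite ltnS => tm tW.
have [us|/not_uniq_lev[p [q [u [pu le]]]]] := boolP (uniq (map lev t)).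
  by apply: small_comb_S; apply: uniq_lev_in_span tW us IHd.
have wt : weight t = weight [:: p, q & u] by rewrite /weight (perm_big _ pu).
have uW : [:: p, q & u] \in words Dl d.+1.
  by move: tW; rewrite !mem_words (perm_size pu) (perm_all _ pu).
rewrite (Xword_perm pu).
have {}IH s' : s' \in words Dl d.+1 -> (weight s' < weight [:: p, q & u])%N ->
    small_comb cst S es (Xword s').
  by move=> s'W ls; apply: IH => //; rewrite (leq_trans ls) // -wt.
have [pD qD uD] : [/\ p \in Dl, q \in Dl & all (fun a => a \in Dl) u].
  by move: uW; rewrite mem_words /= => /andP[_ /and3P[]].
have spq : size p = size q.
  by have [_ ->] := lev_top pD; have [_ ->] := lev_top qD; rewrite le.
(* The product rule requires distinct vectors. A square is first rewritten with X p = Y - (the other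
   X v of that degree); these have the same size, so the weight is unchanged and [straighten_pair]
   applies to each term. *)
have [pq|npq] := eqVneq p q; last exact: straighten_pair.
have puW : p :: u \in words Dl d.
  by move: uW; rewrite !mem_words /= !eqSS => /andP[-> /and3P[-> _ ->]].
rewrite -pq Xword_cons.
have -> : X p = top_sum (lev p) - \sum_(v <- monics (lev p) | v != p) X v.
  by rewrite top_sum_split // addrK.
rewrite mulrBl; apply: small_combD.
  apply: small_comb_S; apply: SY; [by have [] := lev_top pD | exact: IHd].
apply: small_combN; rewrite mulr_suml -big_filter; apply: small_comb_sum => v.
rewrite mem_filter => /andP[vp vm]; have [vD sv] := monics_lev_top pD vm.
have we : weight [:: v, p & u] = weight [:: p, q & u].
  by rewrite /weight !big_cons sv -spq.
rewrite -Xword_cons; apply: straighten_pair => //.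
  by move: uW; rewrite !mem_words /= vD pD qD.
by move=> s' s'W; rewrite we; apply: IH.
Qed.

Hypothesis gen : forall P : set R, P 1 -> (forall x y, P x -> P y -> P (x - y)) ->
  (forall x y, P x -> P y -> P (x * y)) -> (forall c, P (cst c)) ->
  (forall p : {poly k}, p != 0 -> (size p <= n * r)%N -> P (X p)) -> forall x, P x.

Lemma span_everything x : S x.
Proof.
pose comb (l : seq (F * seq {poly k})) := \sum_(t <- l) cst t.1 * Xword t.2.
pose ok (l : seq (F * seq {poly k})) := all (fun t => all (fun a => a \in Dl) t.2) l.
suff [l okl ->] : exists2 l, ok l & x = comb l.
  rewrite /comb big_seq; apply: subspace_sum => // t tl; apply: (SZ).
  apply: (@Xword_in_span (size t.2)); rewrite mem_words eqxx /=; exact: (allP okl).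
move: x; apply: (gen (P := fun x => exists2 l, ok l & x = comb l)).
- by exists [:: (1, [::])]; rewrite // /comb big_seq1 /Xword big_nil rmorph1 mulr1.
- move=> _ _ [l okl ->] [m okm ->].
  exists (l ++ [seq (- t.1, t.2) | t <- m]).
    by rewrite /ok all_cat all_map; apply/andP; split.
  rewrite /comb big_cat big_map -sumrN; congr (_ + _); apply: eq_bigr => t _.
  by rewrite rmorphN mulNr.
- move=> _ _ [l okl ->] [m okm ->].
  exists [seq (t.1 * u.1, t.2 ++ u.2) | t <- l, u <- m].
    apply/allP => _ /allpairsP[[t u] [/(allP okl) tD /(allP okm) uD ->]].
    by rewrite /= all_cat tD.
  rewrite /comb big_allpairs_dep /= mulr_suml; apply: eq_bigr => t _.
  rewrite mulr_sumr; apply: eq_bigr => u _.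
  by rewrite rmorphM /Xword big_cat mulrACA.
- by move=> c; exists [:: (c, [::])]; rewrite // /comb big_seq1 /Xword big_nil mulr1.
move=> p p0 pn; have [[a [w [a0 wD _ ->]]]|[a [nu [_ [us [usD ->]]]]]] := X_shift p0 pn.
  exists [:: (con a, [:: w])]; first by rewrite /ok /= wD.
  by rewrite /comb big_seq1 /Xword big_seq1.
exists [seq (con a * (tF k)^-1 ^+ nu, [:: u]) | u <- us].
  by apply/allP => _ /mapP[u /usD uD ->]; rewrite /= uD.
by rewrite /comb big_map mulr_sumr; apply: eq_bigr => u _; rewrite /Xword big_seq1.
Qed.

End Span.

End Straightening.

Section ModuleSpan.
Variables (F : fieldType) (R : comNzRingType) (cst : {rmorphism F -> R}).
Variables (r D : nat) (Z : 'I_r -> R) (G : 'I_D -> R).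
Local Notation S := (mspan cst Z G).

Lemma mspan0 : S 0.
Proof. by exists (fun=> 0); rewrite big1 // => b _; rewrite rmorph0 mul0r. Qed.

Lemma mspanD x y : S x -> S y -> S (x + y).
Proof.
move=> [p ->] [q ->]; exists (fun b => p b + q b); rewrite -big_split.
by apply: eq_bigr => b _; rewrite rmorphD mulrDl.
Qed.

Lemma mspanM p x : S x -> S (mmap cst Z p * x).
Proof.
move=> [q ->]; exists (fun b => p * q b); rewrite mulr_sumr.
by apply: eq_bigr => b _; rewrite rmorphM mulrA.
Qed.

Lemma mspanZ c x : S x -> S (cst c * x).
Proof. by move/(mspanM c%:MP); rewrite /= mmapC. Qed.

Lemma mspan_var j x : S x -> S (Z j * x).
Proof. by move/(mspanM 'X_j); rewrite /= mmapX mmap1U. Qed.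

Lemma mspan_mem b : S (G b).
Proof.
exists (fun c => (c == b)%:R); rewrite (bigD1 b) //= eqxx rmorph1 mul1r.
by rewrite big1 ?addr0 // => c /negPf ->; rewrite rmorph0 mul0r.
Qed.

Lemma mspan_ind (T : set R) : T 0 -> (forall x y, T x -> T y -> T (x + y)) ->
  (forall p x, T x -> T (mmap cst Z p * x)) -> (forall b, T (G b)) -> S `<=` T.
Proof.
by move=> T0 TD TM TG _ [p ->]; apply: big_ind => // b _; apply: TM.
Qed.

End ModuleSpan.

(** * Powers of the Y_j below deg f_j *)

Section PowerProducts.
Variables (F : fieldType) (R : comNzRingType) (cst : {rmorphism F -> R}).
Variables (r : nat) (Y : 'I_r -> R) (f : 'I_r -> {poly F}).
Hypothesis f_monic : forall j, f j \is monic.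
Hypothesis f_size : forall j, (1 < size (f j))%N.
Local Notation Z := (fun j => poly_eval cst (Y j) (f j)).

Fixpoint power_products (js : seq 'I_r) : seq R :=
  if js is j :: js' then
    [seq Y j ^+ a * y | a <- iota 0 (size (f j)).-1, y <- power_products js']
  else [:: 1].

Lemma power_products_cons j js : power_products (j :: js) =
  [seq Y j ^+ a * y | a <- iota 0 (size (f j)).-1, y <- power_products js].
Proof. by []. Qed.

Lemma size_power_products js :
  size (power_products js) = (\prod_(j <- js) (size (f j)).-1)%N.
Proof.
elim: js => [|j js IH]; first by rewrite big_nil.
by rewrite power_products_cons size_allpairs IH size_iota big_cons.
Qed.

Lemma power_products1 js : 1 \in power_products js.
Proof.
elim: js => [|j js IH]; first exact: mem_head.
rewrite power_products_cons; apply/allpairsP; exists (0%N, 1); split=> //=.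
  by rewrite mem_iota /= add0n -ltnS prednK // ltnW.
by rewrite expr0 mulr1.
Qed.

(** When the exponent reaches deg f_j, the monic equation f_j(Y_j) = Z_j lowers it. [S] is an
    arbitrary stable set so that the induction can be applied to the set of w for which Y_i^a w lies
    in [S]. *)
Lemma power_products_mul js (S : set R) : S 0 ->
    (forall x y, S x -> S y -> S (x + y)) -> (forall c x, S x -> S (cst c * x)) ->
    (forall j x, S x -> S (Z j * x)) -> (forall y, y \in power_products js -> S y) ->
  forall j y, j \in js -> y \in power_products js -> S (Y j * y).
Proof.
elim: js S => // i js IH S S0 SD SZ SV SG j y ji.
rewrite power_products_cons => /allpairsP[[a z] [/= ai zjs ->]].
have SG' b w : (b < (size (f i)).-1)%N -> w \in power_products js -> S (Y i ^+ b * w).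
  move=> bi wjs; apply: SG; rewrite power_products_cons; apply/allpairsP.
  by exists (b, w); rewrite mem_iota.
rewrite mem_iota add0n /= in ai.
have [->|nji] := eqVneq j i; last first.
  rewrite mulrCA; apply: (IH (fun w => S (Y i ^+ a * w))) => //.
  - by rewrite mulr0.
  - by move=> u v Su Sv; rewrite mulrDr; apply: SD.
  - by move=> c u Su; rewrite mulrCA; apply: SZ.
  - by move=> l u Su; rewrite mulrCA; apply: SV.
  - by move=> w wjs; apply: SG'.
  - by move: ji; rewrite inE (negPf nji).
rewrite mulrA -exprS; have [ltd|led] := ltnP a.+1 (size (f i)).-1; first exact: SG'.
have ad : (size (f i)).-1 = a.+1 by apply/eqP; rewrite eqn_leq led.
have sf : size (f i) = a.+2 by rewrite -ad prednK // ltnW.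
have -> : Y i ^+ a.+1 = Z i - \sum_(l < a.+1) cst (f i)`_l * Y i ^+ l.
  rewrite /poly_eval (@horner_coef_wide _ a.+2) -?sf ?size_poly // sf.
  rewrite big_ord_recr /= addrC coef_map /=.
  have -> : (f i)`_a.+1 = 1 by have /monicP := f_monic i; rewrite lead_coefE sf.
  rewrite rmorph1 mul1r; under eq_bigr => l _ do rewrite coef_map.
  by rewrite addrK.
rewrite mulrBl; apply: (SD); first by apply: SV; rewrite -[z]mul1r -(expr0 (Y i)); apply: SG' => //; rewrite ad.
rewrite -mulN1r -(rmorph1 cst) -rmorphN; apply: (SZ); rewrite mulr_suml.
apply: big_ind => // l _; rewrite -mulrA; apply: (SZ); apply: SG' => //.
by rewrite ad.
Qed.

End PowerProducts.

Section SpanningFamily.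
Variables (k : finFieldType) (R : comNzRingType).
Local Notation F := {fraction {poly k}}.
Variables (cst : {rmorphism F -> R}) (n r : nat) (X : {poly k} -> R).
Hypothesis n_gt0 : (0 < n)%N.
Local Notation N0 := (n.-1 * r)%N.

Hypothesis X_scale : forall (a : k) (p : {poly k}), a != 0 ->
  X (a *: p) = cst (const_ratfun a^-1) * X p.
Hypothesis X_mul : forall p q : {poly k},
  (size p <= n * r)%N -> (size q <= n * r)%N ->
  p != 0 -> q != 0 -> p != q -> X p * X q = X (q - p) * (X p - X q).
Hypothesis X_tor : forall nu (p : {poly k}),
  (nu <= n)%N -> (size p <= n * r)%N -> (nu * r < size p)%N ->
  cst (@tF k ^+ nu) * X (drop_poly (nu * r) p) = \sum_(u <- polys k (nu * r)) X (p - u).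
Hypothesis X_gen : forall P : set R, P 1 -> (forall x y, P x -> P y -> P (x - y)) ->
  (forall x y, P x -> P y -> P (x * y)) -> (forall c, P (cst c)) ->
  (forall p : {poly k}, p != 0 -> (size p <= n * r)%N -> P (X p)) -> forall x, P x.

Variable f : 'I_r -> {poly F}.
Hypothesis f_monic : forall j, f j \is monic.
Hypothesis f_size : forall j, (1 < size (f j))%N.

Definition Ytop (j : 'I_r) : R := top_sum X (N0 + j).

Definition spanning_list : seq R :=
  [seq y * g | y <- power_products Ytop f (enum 'I_r), g <- top_products X (iota N0 r)].

Lemma size_top_products js : size (top_products X js) = (\prod_(i <- js) #|k| ^ i)%N.
Proof.
elim: js => [|i js IH]; first by rewrite big_nil.
rewrite top_products_cons size_allpairs IH big_cons /= size_map size_behead size_monics.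
by rewrite prednK // expn_gt0; apply/orP; left; apply/card_gt0P; exists 0.
Qed.

Lemma size_spanning_list : size spanning_list =
  ((\prod_(j < r) (size (f j)).-1) * \prod_(i <- iota N0 r) #|k| ^ i)%N.
Proof.
by rewrite size_allpairs size_power_products size_top_products big_enum.
Qed.

Lemma spanning_family x :
  mspan cst (fun j => poly_eval cst (Ytop j) (f j))
    (fun b : 'I_(size spanning_list) => spanning_list`_b) x.
Proof.
set S := mspan _ _ _.
have memS y : y \in spanning_list -> S y.
  move=> yl; have lt : (index y spanning_list < size spanning_list)%N by rewrite index_mem.
  have := mspan_mem cst (fun j => poly_eval cst (Ytop j) (f j))
    (fun b : 'I_(size spanning_list) => spanning_list`_b) (Ordinal lt).
  by rewrite /= nth_index.
apply: (span_everything n_gt0 X_scale X_mul X_tor (S := S)).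
- exact: mspan0.
- by move=> u v; apply: mspanD.
- by move=> c u; apply: mspanZ.
- move=> i u; rewrite mem_iota => /andP[N0i ir]; have ltr : (i - N0 < r)%N by rewrite ltn_subLR.
  have -> : top_sum X i = Ytop (Ordinal ltr) by rewrite /Ytop /= subnKC.
  apply: (mspan_ind (T := fun u => S (Ytop (Ordinal ltr) * u))).
  + by rewrite mulr0; apply: mspan0.
  + by move=> v w Sv Sw; rewrite mulrDr; apply: mspanD.
  + by move=> p v Sv; rewrite mulrCA; apply: mspanM.
  + move=> b; have /allpairsP[[y g] [/= yj gj ->]] := mem_nth 0 (ltn_ord b).
    rewrite mulrA.
    apply: (power_products_mul f_monic f_size (S := fun u => S (u * g)) _ _ _ _ _ _ yj).
    * by rewrite mul0r; apply: mspan0.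
    * by move=> v w Sv Sw; rewrite mulrDl; apply: mspanD.
    * by move=> c v Sv; rewrite -mulrA; apply: mspanZ.
    * by move=> j v Sv; rewrite -mulrA; exact: (mspan_var (Z := fun j => poly_eval cst (Ytop j) (f j)) j Sv).
    * by move=> v vj; apply: memS; apply/allpairsP; exists (v, g).
    * by rewrite mem_enum.
- move=> g gj; apply: memS; apply/allpairsP; exists (1, g); split=> //=.
    exact: power_products1.
  by rewrite mul1r.
- exact: X_gen.
Qed.

End SpanningFamily.

(** * Tower of monic adjunctions *)

Lemma qpoly_horner (T : comNzRingType) (g p : {poly T}) :
  (map_poly (qpolyC g) p).['qX] = in_qpoly g p :> {poly %/ g}.
Proof.
rewrite -[p in RHS]coefK poly_def rmorph_sum (@horner_coef_wide _ (size p)) ?size_poly //.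
apply: eq_bigr => i _; rewrite coef_map /= -mul_polyC rmorphM rmorphXn /=; congr (_ * _).
apply: val_inj; rewrite /= Pdiv.CommonRing.rmodp_small //.
by rewrite (leq_ltn_trans (size_polyC_leq1 _)) // size_mk_monic_gt1.
Qed.

Lemma adjoin_root (T : comNzRingType) (g : {poly T}) d :
    g \is monic -> size g = d.+1 -> (0 < d)%N ->
  exists (T' : comNzRingType) (iota : {rmorphism T -> T'}) (y : T'),
    (map_poly iota g).[y] = 0 /\
    forall c : 'I_d -> T, \sum_a iota (c a) * y ^+ a = 0 -> forall a, c a = 0.
Proof.
(* [{poly %/ g}] is the quotient by [mk_monic g], which falls back to 'X unless g is monic of
   positive degree. *)
move=> mg sg d0; have gg : mk_monic g = g by rewrite /mk_monic sg ltnS d0 mg.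
exists {poly %/ g}, (qpolyC g), 'qX; split.
  by rewrite qpoly_horner; apply: val_inj; rewrite /= gg Pdiv.RingMonic.rmodpp.
move=> c c0 a; pose p := \poly_(i < d) (if insub i is Some j then c j else 0).
have pE (b : 'I_d) : p`_b = c b by rewrite coef_poly ltn_ord valK.
have : in_qpoly g p = 0.
  rewrite -qpoly_horner -[RHS]c0 (@horner_coef_wide _ d); last first.
    by apply: leq_trans (size_poly _ _) _; apply: size_poly.
  by apply: eq_bigr => b _; rewrite coef_map /= pE.
move/(congr1 val); rewrite /= gg Pdiv.CommonRing.rmodp_small ?sg ?ltnS ?size_poly // => p0.
by rewrite -pE p0 coef0.
Qed.

Section Stages.
Variable L : comNzRingType.

Definition subring_set (T : comPzRingType) (P : set T) :=
  [/\ P 1, forall x y, P x -> P y -> P (x - y) & forall x y, P x -> P y -> P (x * y)].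

Definition in_subring (T : comPzRingType) (theta : L -> T) (A : set T) (x : T) :=
  forall P : set T, subring_set P -> (forall l, P (theta l)) -> A `<=` P -> P x.

Definition lin_indep (T : comNzRingType) (theta : L -> T) (I : finType) (u : I -> T) :=
  forall c : I -> L, \sum_i theta (c i) * u i = 0 -> forall i, c i = 0.

(** A lower bound [D] for the rank over [L], witnessed inside the subring generated by [L] and [A].
    Only independence is recorded: the matching upper bound comes from the spanning family of
    R_n. *)
Definition stage (T : comNzRingType) (theta : L -> T) (A : set T) (D : nat) :=
  exists (I : finType) (u : I -> T),
    [/\ #|I| = D, lin_indep theta u & forall i, in_subring theta A (u i)].

Lemma stage0 : stage (idfun : {rmorphism L -> L}) set0 1.
Proof.
exists unit, (fun=> 1); split; first by rewrite card_unit.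
  by move=> c; rewrite (bigD1 tt) //= big1 ?addr0 ?mulr1 => [c0 []|[]].
by move=> i P [].
Qed.

Lemma stage_sub (T : comNzRingType) (theta : L -> T) A B D :
  A `<=` B -> stage theta A D -> stage theta B D.
Proof.
move=> AB [I [u [cI iu su]]]; exists I, u; split=> // i P P1 PL BP.
by apply: su => //; apply: subset_trans BP.
Qed.

Lemma stage_adjoin (T : comNzRingType) (theta : {rmorphism L -> T}) A D (g : {poly T}) d :
    g \is monic -> size g = d.+1 -> (0 < d)%N -> stage theta A D ->
  exists (T' : comNzRingType) (iota : {rmorphism T -> T'}) (y : T'),
    (map_poly iota g).[y] = 0 /\
    stage (iota \o theta) ([set y] `|` [set iota a | a in A]) (D * d).
Proof.
move=> mg sg d0 [I [u [cI iu su]]].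
have [T' [iota [y [gy ind]]]] := adjoin_root mg sg d0.
exists T', iota, y; split=> //.
exists (I * 'I_d)%type, (fun ia : I * 'I_d => iota (u ia.1) * y ^+ ia.2); split.
- by rewrite card_prod card_ord cI.
- move=> c c0 [i a].
  have {}c0 : \sum_(b < d) \sum_j iota (theta (c (j, b))) * (iota (u j) * y ^+ b) = 0.
    by rewrite exchange_big pair_bigA -[RHS]c0; apply: eq_bigr => -[j b] _.
  have /ind H : \sum_a iota (\sum_i theta (c (i, a)) * u i) * y ^+ a = 0.
    rewrite -[RHS]c0; apply: eq_bigr => b _; rewrite rmorph_sum mulr_suml.
    by apply: eq_bigr => j _; rewrite rmorphM mulrA.
  exact: (iu (fun i => c (i, a)) (H a)).
- move=> [i a] P [P1 PB PM] PL AP /=.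
  apply: (PM); last first.
    by elim: (val a) => [|b IH]; rewrite ?expr0 // exprS; apply: (PM) => //; apply: AP; left.
  apply: (su i (fun x => P (iota x))) => [|l|x Ax]; first split.
  + by rewrite rmorph1.
  + by move=> x z Px Pz; rewrite rmorphB; apply: PB.
  + by move=> x z Px Pz; rewrite rmorphM; apply: PM.
  + exact: PL.
  + by apply: AP; right; exists x.
Qed.

End Stages.

(** * Additive polynomials attached to finite k-subspaces *)

Section Additive.
Variables (k : finFieldType) (M : nat).
Local Notation q := #|k|.

(* lam is the k-linear map with X^l |-> y l for l < M. Its exponential
   epol i x = prod (x - lam u), over u of degree < i, is additive in x with
   constant derivative ecoef i, once the epol l (y l) with l < i are invertible. *)
Section Exponential.
Variables (T : comNzRingType) (theta : k -> T) (y : nat -> T).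

Definition lam (p : {poly k}) : T := \sum_(l < M) theta p`_l * y l.

Definition epol (i : nat) (x : T) : T := \prod_(u <- polys k i) (x - lam u).

Definition ecoef (i : nat) : T := \prod_(l < i) - epol l (y l) ^+ q.-1.

Definition ppol (i : nat) : {poly T} := \prod_(u <- polys k i) ('X - (lam u)%:P).

Lemma ppol_monic i : ppol i \is monic.
Proof. exact: monic_prod_XsubC. Qed.

Lemma size_ppol i : size (ppol i) = (q ^ i).+1.
Proof. by rewrite /ppol size_prod_XsubC size_polys. Qed.

Lemma horner_ppol i x : (ppol i).[x] = epol i x.
Proof.
rewrite /ppol horner_prod; apply: eq_bigr => u _.
by rewrite hornerXsubC.
Qed.

End Exponential.

Section Locality.
Variables (T : comNzRingType) (theta : {rmorphism k -> T}).

(** The points y_l are adjoined one at a time, and later ones hold arbitrary values meanwhile.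
    Locality ensures that equations already satisfied stay true when further points are set. *)
Lemma lam_local i (y y' : nat -> T) (u : {poly k}) : (forall l, (l < i)%N -> y l = y' l) ->
  (size u <= i)%N -> lam theta y u = lam theta y' u.
Proof.
move=> yy ui; apply: eq_bigr => l _; have [li|il] := ltnP l i; first by rewrite yy.
by rewrite nth_default ?rmorph0 ?mul0r // (leq_trans ui).
Qed.

Lemma epol_local i (y y' : nat -> T) x : (forall l, (l < i)%N -> y l = y' l) ->
  epol theta y i x = epol theta y' i x.
Proof.
move=> yy; apply: eq_big_seq => u; rewrite mem_polys => ui.
by rewrite (lam_local yy ui).
Qed.

Lemma ecoef_local i (y y' : nat -> T) : (forall l, (l < i)%N -> y l = y' l) ->
  ecoef theta y i = ecoef theta y' i.
Proof.
move=> yy; apply: eq_bigr => l _; rewrite -yy //.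
rewrite (@epol_local l y y') // => j jl; apply: yy; exact: ltn_trans jl _.
Qed.

End Locality.

Section Naturality.
Variables (T T' : comNzRingType) (theta : k -> T) (iota : {rmorphism T -> T'}).
Variable y : nat -> T.

Lemma lam_natural u : lam (iota \o theta) (iota \o y) u = iota (lam theta y u).
Proof. by rewrite rmorph_sum; apply: eq_bigr => l _; rewrite rmorphM. Qed.

Lemma epol_natural i x : epol (iota \o theta) (iota \o y) i (iota x) = iota (epol theta y i x).
Proof. by rewrite rmorph_prod; apply: eq_bigr => l _; rewrite rmorphB lam_natural. Qed.

Lemma ecoef_natural i : ecoef (iota \o theta) (iota \o y) i = iota (ecoef theta y i).
Proof.
by rewrite rmorph_prod; apply: eq_bigr => l _; rewrite rmorphN rmorphXn epol_natural.
Qed.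

Lemma ppol_natural i : ppol (iota \o theta) (iota \o y) i = map_poly iota (ppol theta y i).
Proof.
rewrite rmorph_prod; apply: eq_bigr => l _.
by rewrite rmorphB /= map_polyX map_polyC lam_natural.
Qed.

End Naturality.

End Additive.

Definition invertible (T : comPzRingType) (x : T) := exists v, x * v = 1.

Lemma invertibleM (T : comPzRingType) (x y : T) :
  invertible x -> invertible y -> invertible (x * y).
Proof. by move=> [v xv] [w yw]; exists (v * w); rewrite mulrACA xv yw mulr1. Qed.

Lemma invertible_prod (T : comPzRingType) (I : eqType) (s : seq I) (G : I -> T) :
  (forall i, i \in s -> invertible (G i)) -> invertible (\prod_(i <- s) G i).
Proof.
move=> H; rewrite big_seq; apply: big_ind => //; last exact: invertibleM.
by exists 1; rewrite mulr1.
Qed.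

Lemma invertible_factor (T : comPzRingType) (x y : T) : invertible (x * y) -> invertible x.
Proof. by move=> [v e]; exists (y * v); rewrite mulrA. Qed.

Lemma invertible_rmorph (T T' : comPzRingType) (iota : {rmorphism T -> T'}) x :
  invertible x -> invertible (iota x).
Proof. by move=> [v xv]; exists (iota v); rewrite -rmorphM xv rmorph1. Qed.

Lemma invertible_cancel (T : comPzRingType) (x y z : T) :
  invertible x -> x * y = x * z -> y = z.
Proof.
by move=> [v xv] e; rewrite -[y]mul1r -xv mulrAC e mulrAC xv mul1r.
Qed.

Section FiniteFieldPowers.
Variables (k : finFieldType) (T : comNzRingType) (theta : {rmorphism k -> T}).
Local Notation q := #|k|.

Lemma card_pchar : exists p m, [/\ p \in [pchar T], q = (p ^ m.+1)%N & prime p].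
Proof.
have [p pr pk] := finPcharP k; have e := card_pprimeChar pk.
exists p, (logn p q).-1; split=> //; first exact: (rmorph_pchar theta).
rewrite prednK // lt0n; apply: contraTneq (finNzRing_gt1 k) => l0.
by rewrite e l0.
Qed.

Lemma exprD_card (x z : T) : (x + z) ^+ q = x ^+ q + z ^+ q.
Proof.
have [p [m [pT -> pr]]] := card_pchar; apply: exprDn_pchar.
by rewrite (eq_pnat _ (pcharf_eq pT)) pnatX pnat_id.
Qed.

Lemma natr_card : q%:R = 0 :> T.
Proof.
by have [p [m [pT -> pr]]] := card_pchar; rewrite natrX (pcharf0 pT) expr0n.
Qed.

(* Homogeneous form of prod_a (X - a) = X^q - X; B is a unit in all uses. *)
Lemma prod_sub_scale (A B : T) : invertible B ->
  \prod_(a <- enum k) (A - theta a * B) = A ^+ q - B ^+ q.-1 * A.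
Proof.
move=> [v Bv]; have q0 : (0 < q)%N by apply/card_gt0P; exists 0.
have := congr1 (fun p => (map_poly theta p).[A * v]) (finField_genPoly k).
rewrite rmorphB rmorphXn /= map_polyX hornerD hornerN hornerXn hornerX rmorph_prod horner_prod => e.
have -> : A ^+ q - B ^+ q.-1 * A = B ^+ q * ((A * v) ^+ q - A * v).
  have BA : B * (A * v) = A by rewrite mulrCA Bv mulr1.
  by rewrite mulrBr -exprMn BA -{4}(prednK q0) exprSr -mulrA BA.
rewrite e -prodr_const -big_split /= big_enum /=; apply: eq_bigr => a _.
rewrite rmorphB /= map_polyX map_polyC hornerXsubC mulrBr; congr (_ - _); last by rewrite mulrC.
by rewrite mulrCA Bv mulr1.
Qed.

End FiniteFieldPowers.

Section Additive.
Variables (k : finFieldType) (M : nat).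
Local Notation q := #|k|.

Section General.
Variables (T : comNzRingType) (theta : {rmorphism k -> T}) (y : nat -> T).
Local Notation lam_ := (lam M theta y).
Local Notation epol_ := (epol M theta y).
Local Notation ecoef_ := (ecoef M theta y).

Lemma lamD u v : lam_ (u + v) = lam_ u + lam_ v.
Proof.
by rewrite -big_split; apply: eq_bigr => l _; rewrite coefD rmorphD mulrDl.
Qed.

Lemma lamZ a u : lam_ (a *: u) = theta a * lam_ u.
Proof.
by rewrite mulr_sumr; apply: eq_bigr => l _; rewrite coefZ rmorphM mulrA.
Qed.

Lemma lam0 : lam_ 0 = 0.
Proof. by rewrite /lam big1 // => l _; rewrite coef0 rmorph0 mul0r. Qed.

Lemma lamN u : lam_ (- u) = - lam_ u.
Proof. by rewrite -scaleN1r lamZ rmorphN rmorph1 mulN1r. Qed.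

Lemma lamB u v : lam_ (u - v) = lam_ u - lam_ v.
Proof. by rewrite lamD lamN. Qed.

Lemma lamXn l : (l < M)%N -> lam_ 'X^l = y l.
Proof.
move=> lM; rewrite /lam (bigD1 (Ordinal lM)) //= coefXn eqxx rmorph1 mul1r.
rewrite big1 ?addr0 // => j; rewrite -val_eqE /= coefXn => /negPf ->.
by rewrite rmorph0 mul0r.
Qed.

Lemma epol0 x : epol_ 0 x = x.
Proof. by rewrite /epol big_seq1 lam0 subr0. Qed.

Lemma epolS i x : (i < M)%N ->
  epol_ i.+1 x = \prod_(a <- enum k) epol_ i (x - theta a * y i).
Proof.
move=> iM; rewrite /epol polysS big_allpairs_dep /=; apply: eq_bigr => a _.
by apply: eq_bigr => u _; rewrite lamD lamZ lamXn // opprD addrA.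
Qed.

(** Additivity and recursion support each other: by linearity of e_i, e_(i+1)(x) is the product over
    a in k of e_i(x) - a e_i(y_i), which [prod_sub_scale] evaluates; the result is linear again
    because the q-th power is additive and fixes k. *)
Lemma epol_linear_rec i : (i <= M)%N ->
    (forall l, (l < i)%N -> invertible (epol_ l (y l))) ->
  (forall x z a, epol_ i (x + theta a * z) = epol_ i x + theta a * epol_ i z) /\
  forall l, (l < i)%N -> forall x,
    epol_ l.+1 x = epol_ l x ^+ q - epol_ l (y l) ^+ q.-1 * epol_ l x.
Proof.
elim: i => [_ _|i IH iM W].
  by split=> // x z a; rewrite !epol0.
have [lin rec] := IH (ltnW iM) (fun l li => W l (ltnW li)).
have reci x : epol_ i.+1 x = epol_ i x ^+ q - epol_ i (y i) ^+ q.-1 * epol_ i x.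
  rewrite epolS // -(prod_sub_scale theta _ (W i (ltnSn i))); apply: eq_bigr => a _.
  by rewrite -mulNr -rmorphN lin rmorphN mulNr.
split=> [x z a|l]; last by rewrite ltnS leq_eqVlt => /orP[/eqP ->|/rec].
rewrite !reci lin (exprD_card theta) exprMn -rmorphXn expf_card; ring.
Qed.

End General.

Section Derivative.
Variables (T : comNzRingType) (theta : {rmorphism k -> T}) (y : nat -> T).
Local Notation lam_ := (lam M theta y).
Local Notation epol_ := (epol M theta y).
Local Notation ecoef_ := (ecoef M theta y).
Local Notation ppol_ := (ppol M theta y).

Lemma ppol_epol i :
  ppol_ i = epol M (polyC \o theta) (polyC \o y) i 'X.
Proof.
rewrite /ppol /epol; apply: eq_bigr => u _.
by rewrite (lam_natural _ _ (@polyC T : {rmorphism T -> {poly T}})). Qed.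

(** The recursion for e_i is used over the polynomial ring, at the point ['X]. The q-th powers have
    zero derivative, so each step multiplies the derivative by the constant - e_i(y_i)^(q-1). *)
Lemma deriv_ppol i : (i <= M)%N -> (forall l, (l < i)%N -> invertible (epol_ l (y l))) ->
  (ppol_ i)^`() = (ecoef_ i)%:P.
Proof.
pose pC : {rmorphism T -> {poly T}} := @polyC T.
have epolC l x : epol M (pC \o theta) (pC \o y) l x%:P = (epol_ l x)%:P.
  exact: (epol_natural _ _ pC).
elim: i => [_ _|i IH iM W].
  by rewrite /ppol big_seq1 lam0 subr0 derivX /ecoef big_ord0.
have W' l : (l < i.+1)%N -> invertible (epol M (pC \o theta) (pC \o y) l ((pC \o y) l)).
  by move=> li; rewrite epolC; apply: (invertible_rmorph pC); apply: W.
have [_ rec] := epol_linear_rec (theta := pC \o theta) iM W'.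
rewrite ppol_epol (rec i (ltnSn i)) -ppol_epol epolC derivB.
have -> : (ppol_ i ^+ q)^`() = 0.
  by rewrite deriv_exp -mulr_natr (natr_card (pC \o theta)) mulr0.
rewrite -rmorphXn /= mul_polyC derivZ IH ?(ltnW iM) // => [|l li]; last exact: W (ltnW li).
by rewrite sub0r -mul_polyC -polyCM -polyCN /ecoef big_ord_recr /= mulrN mulrC.
Qed.

(** Logarithmic differentiation in a ring with possible zero divisors: the inverses of the factors
    are supplied as [v]. *)
Lemma deriv_prod (s : seq {poly k}) x (v : {poly k} -> T) :
    (forall u, u \in s -> (x - lam_ u) * v u = 1) ->
  ((\prod_(u <- s) ('X - (lam_ u)%:P))^`()).[x] =
    (\prod_(u <- s) (x - lam_ u)) * \sum_(u <- s) v u.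
Proof.
elim: s => [|u s IH] Hv; first by rewrite !big_nil derivC hornerC mulr0.
rewrite !big_cons derivM hornerD !hornerM derivXsubC hornerC mul1r hornerXsubC.
rewrite IH => [|w ws]; last by apply: Hv; rewrite inE ws orbT.
rewrite horner_prod; under eq_bigr => w _ do rewrite hornerXsubC.
set P := \prod_(_ <- _) _; set S := \sum_(_ <- _) _.
transitivity ((x - lam_ u) * v u * P + (x - lam_ u) * (P * S)); last by ring.
by rewrite Hv ?mem_head // mul1r.
Qed.

(** The logarithmic derivative of e_i at x is the sum of the 1/(x - lam u), and the numerator e_i'
    is the constant [ecoef i]. *)
Lemma sum_inverses i x (v : {poly k} -> T) : (i <= M)%N ->
    (forall l, (l < i)%N -> invertible (epol_ l (y l))) ->
    (forall u, u \in polys k i -> (x - lam_ u) * v u = 1) ->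
  epol_ i x * \sum_(u <- polys k i) v u = ecoef_ i.
Proof.
move=> iM W Hv; rewrite -deriv_prod // -/(ppol M theta y i) deriv_ppol //.
by rewrite hornerC.
Qed.

End Derivative.

Section Consequences.
Variables (n r : nat) (T : comNzRingType) (theta : {rmorphism k -> T}).
Variables (y Y Yi : nat -> T) (t ti : T).
Hypothesis M_def : M = (n * r)%N.
Hypothesis n_gt0 : (0 < n)%N.
Local Notation lam_ := (lam M theta y).
Local Notation epol_ := (epol M theta y).
Local Notation ecoef_ := (ecoef M theta y).
Hypothesis tti : t * ti = 1.
Hypothesis HY : forall i, (i < r)%N -> Y i * Yi i = 1.
Hypothesis Hlow : forall i, (i < r)%N -> epol_ i (y i) = ecoef_ i * t ^+ n.-1 * Yi i.
Hypothesis Hhigh : forall i, (r <= i)%N -> (i < M)%N ->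
  epol_ r (y i) = ti * ecoef_ r * y (i - r)%N.

Let rM : (r <= M)%N. Proof. by rewrite M_def leq_pmull. Qed.
Let t_inv : invertible t. Proof. by exists ti. Qed.
Let ti_inv : invertible ti. Proof. by exists t; rewrite mulrC. Qed.

Lemma invertible_exp (x : T) m : invertible x -> invertible (x ^+ m).
Proof.
move=> ix; elim: m => [|m IH]; first by exists 1; rewrite expr0 mulr1.
by rewrite exprS; apply: invertibleM.
Qed.

(** Up to sign, [ecoef i] is a product of powers of the earlier e_l(y_l), so the imposed equations
    make these values units one after the other. *)
Lemma epol_low_invertible i : (i <= r)%N -> forall l, (l < i)%N -> invertible (epol_ l (y l)).
Proof.
elim: i => [//|i IH] ir l; rewrite ltnS leq_eqVlt => /orP[/eqP ->|]; last exact: IH (ltnW ir) l.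
rewrite Hlow //; apply: invertibleM; last first.
  by exists (Y i); rewrite mulrC HY.
apply: invertibleM; last exact: invertible_exp.
apply: invertible_prod => j _; rewrite -mulN1r; apply: invertibleM.
  by exists (-1); rewrite mulrNN mulr1.
by apply: invertible_exp; apply: IH (ltnW ir) j (ltn_ord j).
Qed.

Let W := epol_low_invertible (leqnn r).

Lemma ecoef_invertible i : (i <= r)%N -> invertible (ecoef_ i).
Proof.
move=> ir; apply: invertible_prod => j _; rewrite -mulN1r; apply: invertibleM.
  by exists (-1); rewrite mulrNN mulr1.
by apply: invertible_exp; apply: W; apply: leq_trans ir.
Qed.

Lemma epol_r_linear x z a : epol_ r (x + theta a * z) = epol_ r x + theta a * epol_ r z.
Proof. by have [lin _] := epol_linear_rec rM W; apply: lin. Qed.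

Lemma epol_root i (u : {poly k}) : (size u <= i)%N -> epol_ i (lam_ u) = 0.
Proof.
by move=> ui; rewrite /epol (bigD1_seq u) ?polys_uniq ?mem_polys //= subrr mul0r.
Qed.

(** By linearity it suffices to treat the y_l: those with l < r are roots of e_r, the others satisfy
    [Hhigh]. Thus (t / ecoef_r) e_r is multiplication by t in a Drinfeld module of rank r, and it
    acts on the points lam p by dropping r coefficients. *)
Lemma epol_r_lam (p : {poly k}) : (size p <= M)%N ->
  epol_ r (lam_ p) = ti * ecoef_ r * lam_ (drop_poly r p).
Proof.
move=> pM; have e0 : epol_ r 0 = 0 by have := @epol_root r 0; rewrite lam0 size_poly0; apply.
have lin_sum (I : Type) (s : seq I) (c : I -> k) (z : I -> T) :
    epol_ r (\sum_(l <- s) theta (c l) * z l) = \sum_(l <- s) theta (c l) * epol_ r (z l).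
  elim: s => [|l s IH]; first by rewrite !big_nil.
  by rewrite !big_cons addrC epol_r_linear IH addrC.
rewrite {1}/lam lin_sum -(big_mkord xpredT (fun l => theta p`_l * epol_ r (y l))).
rewrite (big_cat_nat _ (n := r)) //= big_nat big1 ?add0r => [|l /andP[_ lr]]; last first.
  by rewrite -(lamXn theta y (leq_trans lr rM)) epol_root ?size_polyXn ?mulr0.
rewrite -{1}[r]add0n big_addn big_mkord mulr_sumr.
have sub : (M - r <= M)%N by rewrite leq_subr.
rewrite [RHS](bigID (fun l : 'I_M => (l < M - r)%N)) /= [X in _ + X]big1 ?addr0; last first.
  move=> l; rewrite -leqNgt => Ml; rewrite coef_drop_poly nth_default ?rmorph0 ?mul0r ?mulr0 //.
  by rewrite (leq_trans pM) // addnC -leq_subLR.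
rewrite (big_ord_widen_cond M xpredT (fun l => theta p`_(l + r) * epol_ r (y (l + r)%N)) sub).
apply: eq_bigr => l lM; have lrM : (l + r < M)%N by rewrite addnC -ltn_subRL.
by rewrite coef_drop_poly Hhigh ?leq_addl // addnK mulrCA.
Qed.

(** If p has degree i < r, then lam p is up to a scalar one of the factors of the unit e_i(y_i). In
    higher degree it is a factor of e_r(lam p), a unit times lam of a polynomial of smaller
    degree. *)
Lemma lam_invertible (p : {poly k}) : p != 0 -> (size p <= M)%N -> invertible (lam_ p).
Proof.
have [m] := ubnP (size p); elim: m p => // m IH p; rewrite ltnS => pm p0 pM.
have sp : (0 < size p)%N by rewrite size_poly_gt0.
pose i := (size p).-1; have iS : size p = i.+1 by rewrite prednK.
have [ri|ir] := leqP r i; last first.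
  pose a := lead_coef p; have a0 : a != 0 by rewrite lead_coef_eq0.
  pose u := 'X^i - a^-1 *: p.
  have ui : (size u <= i)%N.
    apply/leq_sizeP => j; rewrite leq_eqVlt coefB coefZ coefXn => /orP[/eqP <-|ij].
      by rewrite eqxx /a lead_coefE iS mulVf ?subrr // -/i; move: a0; rewrite /a lead_coefE iS.
    by rewrite nth_default ?iS // gtn_eqF // mulr0 subr0.
  have iM : (i < M)%N by rewrite -iS.
  have -> : lam_ p = theta a * (y i - lam_ u).
    by rewrite -(lamXn theta y iM) -lamB subKr lamZ mulrA -rmorphM mulfV // rmorph1 mul1r.
  apply: invertibleM; first by exists (theta a^-1); rewrite -rmorphM mulfV // rmorph1.
  have := W ir; rewrite /epol (bigD1_seq u) ?polys_uniq ?mem_polys //=.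
  exact: invertible_factor.
have dM : (size (drop_poly r p) <= M)%N by rewrite size_drop_poly (leq_trans (leq_subr _ _)).
have d0 : drop_poly r p != 0 by rewrite -size_poly_gt0 size_drop_poly iS subn_gt0 ltnS.
have [r0|r0] := posnP r; first by move: pM; rewrite M_def r0 muln0 leqn0 size_poly_eq0 (negPf p0).
have : invertible (epol_ r (lam_ p)).
  rewrite epol_r_lam //; apply: invertibleM.
    by apply: invertibleM => //; apply: ecoef_invertible.
  by apply: IH => //; rewrite size_drop_poly; apply: leq_trans pm; rewrite iS; lia.
rewrite /epol (bigD1_seq 0) ?polys_uniq ?mem_polys ?size_poly0 //= lam0 subr0.
exact: invertible_factor.
Qed.

Variable mu : {poly k} -> T.
Hypothesis lam_mu : forall p : {poly k}, p != 0 -> (size p <= M)%N -> lam_ p * mu p = 1.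

(** The monics of degree j are the X^j - u, so [sum_inverses] at y_j gives their sum of reciprocals
    as ecoef_j / e_j(y_j). The value prescribed for e_j(y_j) was chosen to turn this into Y_j /
    t^(n-1). *)
Lemma sum_monics_mu j : (j < r)%N -> \sum_(w <- monics k j) mu w * t ^+ n.-1 = Y j.
Proof.
move=> jr; have jM : (j < M)%N by apply: leq_trans rM.
have jW l : (l < j)%N -> invertible (epol_ l (y l)) by move=> lj; apply: W; apply: ltn_trans jr.
have := sum_inverses (theta := theta) (x := y j) (v := fun u => mu ('X^j - u)) (ltnW jM) jW.
have -> : \sum_(u <- polys k j) mu ('X^j - u) = \sum_(w <- monics k j) mu w.
  rewrite [RHS](@big_image_uniq _ _ _ (polys k j) (monics k j) (fun u => 'X^j - u)) //.
  - exact: polys_uniq.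
  - exact: monics_uniq.
  - by move=> u v _ _ /addrI/oppr_inj.
  move=> w; split=> [/mapP[u ul ->]|[u ul ->]].
    by exists (- u); rewrite ?opprK // mem_polys size_polyN -mem_polys.
  by apply/mapP; exists (- u); rewrite // mem_polys size_polyN -mem_polys.
move=> H; have {H} : epol_ j (y j) * \sum_(w <- monics k j) mu w = ecoef_ j.
  apply: H => u; rewrite mem_polys => uj; rewrite -(lamXn theta y jM) -lamB lam_mu //.
    by rewrite -size_poly_eq0 size_polyDl ?size_polyN size_polyXn.
  by rewrite size_polyDl ?size_polyN size_polyXn.
rewrite Hlow // -mulr_suml => e.
apply: (invertible_cancel (ecoef_invertible (ltnW jr))).
transitivity (ecoef_ j * t ^+ n.-1 * Yi j * (\sum_(w <- monics k j) mu w) * Y j); last by rewrite e.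
transitivity (ecoef_ j * (Y j * Yi j) * ((\sum_(w <- monics k j) mu w) * t ^+ n.-1)); last by ring.
by rewrite HY // mulr1.
Qed.

Lemma mu_torsion_r (p : {poly k}) : (size p <= M)%N -> (r < size p)%N ->
  t * mu (drop_poly r p) = \sum_(u <- polys k r) mu (p - u).
Proof.
move=> pM rp.
have szB u : u \in polys k r -> size (p - u) = size p.
  by rewrite mem_polys => ur; rewrite size_polyDl // size_polyN (leq_ltn_trans ur).
have e := sum_inverses (theta := theta) (x := lam_ p) (v := fun u => mu (p - u)) rM W.
have {}e : epol_ r (lam_ p) * (\sum_(u <- polys k r) mu (p - u)) = ecoef_ r.
  apply: e => u ul; rewrite -lamB lam_mu ?szB //.
  by rewrite -size_poly_gt0 szB // (leq_trans _ rp).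
have d0 : drop_poly r p != 0 by rewrite -size_poly_gt0 size_drop_poly subn_gt0.
have dM : (size (drop_poly r p) <= M)%N by rewrite size_drop_poly (leq_trans (leq_subr _ _)).
have ld := lam_mu d0 dM.
rewrite epol_r_lam // in e.
apply: (invertible_cancel (ecoef_invertible (leqnn r))).
set S := \sum_(_ <- _) _ in e *.
transitivity (ti * ecoef_ r * lam_ (drop_poly r p) * S * (t * mu (drop_poly r p))).
  by rewrite e.
transitivity (ecoef_ r * S * (t * ti) * (lam_ (drop_poly r p) * mu (drop_poly r p))).
  by ring.
by rewrite tti ld !mulr1.
Qed.

Lemma mu_torsion nu (p : {poly k}) : (nu <= n)%N -> (size p <= M)%N -> (nu * r < size p)%N ->
  t ^+ nu * mu (drop_poly (nu * r) p) = \sum_(u <- polys k (nu * r)) mu (p - u).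
Proof.
elim: nu p => [|nu IH] p nun pM np.
  by rewrite mul0n drop_poly0l expr0 mul1r /= big_seq1 subr0.
have rp : (r < size p)%N by apply: leq_ltn_trans np; rewrite mulSn leq_addr.
have dE : drop_poly (nu.+1 * r) p = drop_poly (nu * r) (drop_poly r p).
  by apply/polyP => i; rewrite !coef_drop_poly mulSn [(r + _)%N]addnC addnA.
have dM : (size (drop_poly r p) <= M)%N by rewrite size_drop_poly (leq_trans (leq_subr _ _)).
have nud : (nu * r < size (drop_poly r p))%N by rewrite size_drop_poly ltn_subRL -mulSn.
rewrite dE exprS -mulrA IH ?(ltnW nun) // mulr_sumr.
have step u : u \in polys k (nu * r) ->
    t * mu (drop_poly r p - u) = \sum_(w <- polys k r) mu (p - (u * 'X^r + w)).
  rewrite mem_polys => ul.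
  have sz : size (p - u * 'X^r) = size p.
    rewrite size_polyDl // size_polyN (leq_ltn_trans (size_mulXn_leq r ul)) //.
    by rewrite addnC -mulSn.
  have -> : drop_poly r p - u = drop_poly r (p - u * 'X^r).
    by rewrite linearB /= drop_polyMXn_id.
  rewrite mu_torsion_r ?sz //; apply: eq_bigr => w _; by rewrite opprD addrA.
rewrite (eq_big_seq _ step).
pose s := [seq u * 'X^r + w | u <- polys k (nu * r), w <- polys k r].
(* Division by X^r: each polynomial of degree < (nu+1) r is uniquely u X^r + w with deg u < nu r and
   deg w < r. *)
rewrite -[LHS](big_allpairs_dep (h := fun u w : {poly k} => u * 'X^r + w) (F := fun v => mu (p - v))).
apply: perm_big; apply: uniq_perm => [||v].
- apply: allpairs_uniq; rewrite ?polys_uniq // => -[u w] [u' w'].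
  move=> /allpairsP[[a b] [/= _ bl [-> ->]]] /allpairsP[[a' b'] [/= _ bl' [-> ->]]] /= e.
  move: bl bl'; rewrite !mem_polys => bl bl'.
  have ea : a = a'.
    rewrite -[LHS](drop_polyDMXn (n := r) (p := b)) // -[RHS](drop_polyDMXn (n := r) (p := b')) //.
    by rewrite addrC e addrC.
  by move: e; rewrite ea => /addrI ->.
- exact: polys_uniq.
apply/allpairsP/idP => [[[u w] [/= ul wl ->]]|].
  move: ul wl; rewrite !mem_polys => ul wl; apply: leq_trans (size_polyD _ _) _.
  rewrite geq_max mulSn addnC (size_mulXn_leq r ul) /= (leq_trans wl) //.
  by rewrite leq_addl.
rewrite mem_polys mulSn => vl; exists (drop_poly r v, take_poly r v); split.
- by rewrite mem_polys size_drop_poly leq_subLR.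
- by rewrite mem_polys size_take_poly.
- by rewrite /= addrC poly_take_drop.
Qed.

End Consequences.

End Additive.

(** * The tower over F(Z) *)

Section Tower.
Variables (k : finFieldType) (n r : nat).
Local Notation F := {fraction {poly k}}.
Variable f : 'I_r -> {poly F}.
Hypothesis f_monic : forall j, f j \is monic.
Hypothesis f_size : forall j, (1 < size (f j))%N.

Definition ratfuns := {fraction {mpoly F[r]}}.
HB.instance Definition _ := GRing.Field.on ratfuns.
Local Notation L := ratfuns.

Definition cL (c : F) : L := (c%:MP)%:F.

Lemma cL_is_zmod_morphism : zmod_morphism cL.
Proof. by move=> a b; rewrite /cL mpolyCB tofracB. Qed.

Lemma cL_is_monoid_morphism : monoid_morphism cL.
Proof. by split=> [|a b]; rewrite /cL ?mpolyC1 ?tofrac1 // mpolyCM tofracM. Qed.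

HB.instance Definition _ := GRing.isZmodMorphism.Build F L cL cL_is_zmod_morphism.
HB.instance Definition _ := GRing.isMonoidMorphism.Build F L cL cL_is_monoid_morphism.

Definition kL : {rmorphism k -> L} := (cL \o @const_ratfun k : {rmorphism k -> L}).

Definition Zvar (j : 'I_r) : L := ('X_j : {mpoly F[r]})%:F.

Lemma Zvar_subC_neq0 j c : Zvar j - cL c != 0.
Proof.
rewrite /Zvar /cL -tofracB tofrac_eq0; apply/eqP => /(congr1 (fun p : {mpoly F[r]} => p@_U_(j))).
rewrite /= mcoeffB mcoeffXU eqxx mcoeffC mcoeff0 mnm1_eq0 mulr0 subr0 => /eqP.
by rewrite oner_eq0.
Qed.

Section Data.
Variables (T : comNzRingType) (theta : {rmorphism L -> T}) (Y Yi y : nat -> T).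

(* By logarithmic differentiation of epol, the equations for i < r make the sum
   of 1/(lam p) over monic p of degree (n-1)r + i equal to Y i, and those for
   r <= i are the defining relations of R_n for the elements 1/(lam p). *)
Definition Ydata (l : 'I_r) :=
  (map_poly (theta \o cL) (f l)).[Y l] = theta (Zvar l) /\ Y l * Yi l = 1.

Definition ydata (i : nat) :=
  if (i < r)%N then
    epol (n * r) (theta \o kL) y i (y i) =
      ecoef (n * r) (theta \o kL) y i * theta (cL (tF k ^+ n.-1)) * Yi i
  else
    epol (n * r) (theta \o kL) y r (y i) =
      theta (cL (tF k)^-1) * ecoef (n * r) (theta \o kL) y r * y (i - r)%N.

End Data.

Definition gens (T : comNzRingType) (Y y : nat -> T) (j i : nat) : set T :=
  [set x | (exists2 l, (l < j)%N & x = Y l) \/ (exists2 l, (l < i)%N & x = y l)].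

Definition ydegree (i : nat) : nat := if (i < r)%N then (#|k| ^ i)%N else (#|k| ^ r)%N.

Lemma card_k_gt0 : (0 < #|k|)%N.
Proof. by apply/card_gt0P; exists 0. Qed.

Lemma tower_Y j : (j <= r)%N ->
  exists (T : comNzRingType) (theta : {rmorphism L -> T}) (Y Yi : nat -> T),
    (forall l : 'I_r, (l < j)%N -> Ydata theta Y Yi l) /\
    stage theta (gens Y Y j 0) (\prod_(l < r | (l < j)%N) (size (f l)).-1)%N.
Proof.
elim: j => [_|j IH jr].
  exists L, idfun, (fun=> 0), (fun=> 0); split; first by [].
  by rewrite big_pred0 //; apply: stage_sub (stage0 L) => x [].
have [T [theta [Y [Yi [HY st]]]]] := IH (ltnW jr).
pose J := Ordinal jr; pose d := (size (f J)).-1.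
have sf : size (f J) = d.+1 by rewrite prednK // ltnW.
have d0 : (0 < d)%N by rewrite -ltnS -sf.
pose fT := map_poly (theta \o cL) (f J).
have sfT : size fT = d.+1.
  by rewrite size_poly_eq ?sf // -lead_coefE (monicP (f_monic J)) rmorph1 oner_eq0.
pose g := fT - (theta (Zvar J))%:P.
have mfT : fT \is monic := monic_map (theta \o cL) (f_monic J).
have sC : (size (- (theta (Zvar J))%:P) < size fT)%N.
  by rewrite size_polyN sfT ltnS (leq_trans (size_polyC_leq1 _)).
have mg : g \is monic by rewrite monicE lead_coefDl // (monicP mfT).
have sg : size g = d.+1 by rewrite size_polyDl.
have [T' [iota [y [gy st']]]] := stage_adjoin mg sg d0 st.
have fy : (map_poly (iota \o (theta \o cL)) (f J)).[y] = iota (theta (Zvar J)).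
  apply/eqP; rewrite -subr_eq0 -gy rmorphB /= map_polyC hornerD hornerN hornerC.
  by rewrite /fT -map_poly_comp.
have [yi yyi] : exists yi, y * yi = 1.
  (* From f = h X + c one gets y h(y) = Z - c. The right-hand side is a nonzero element of the field
     [L], so y is a unit. *)
  pose c := (f J)`_0; pose h := drop_poly 1 (f J).
  have fE : f J = h * 'X + c%:P.
    rewrite -{1}[f J](poly_take_drop 1) addrC expr1; congr (_ + _).
    by apply/polyP => -[|i]; rewrite coef_take_poly coefC.
  move: fy; rewrite fE rmorphD rmorphM /= map_polyX map_polyC hornerD hornerMX hornerC /=.
  set H := _.[y] => e.
  exists (H * iota (theta (Zvar J - cL c)^-1)).
  have -> : y * (H * iota (theta (Zvar J - cL c)^-1)) =
      (H * y + iota (theta (cL c)) - iota (theta (cL c))) * iota (theta (Zvar J - cL c)^-1).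
    by ring.
  have nz := Zvar_subC_neq0 J c.
  by rewrite e -(rmorphB iota) -(rmorphB theta) -rmorphM -rmorphM (divff nz) !rmorph1.
exists T', (iota \o theta : {rmorphism L -> T'}).
exists (fun l => if l == j then y else iota (Y l)), (fun l => if l == j then yi else iota (Yi l)).
split=> [l|].
  rewrite ltnS leq_eqVlt /Ydata => /orP[/eqP lj|lj].
    have -> : l = J by apply: val_inj.
    by rewrite /= eqxx; split.
  rewrite (ltn_eqF lj); have [e1 e2] := HY l lj; split; last by rewrite -rmorphM e2 rmorph1.
  by rewrite /= -e1 -horner_map -map_poly_comp.
have -> : (\prod_(l < r | (l < j.+1)%N) (size (f l)).-1 =
    \prod_(l < r | (l < j)%N) (size (f l)).-1 * d)%N.
  rewrite (bigD1 J) /= ?ltnS // mulnC; congr (_ * _)%N; apply: eq_bigl => l.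
  by rewrite ltnS -val_eqE /= ltn_neqAle andbC.
apply: stage_sub st' => x [->|[a [|] [l lj ->] <-]] //.
- by left; exists j; rewrite ?eqxx.
- by left; exists l; rewrite ?(ltn_eqF lj) //; apply: ltnW.
Qed.

(** The new point is a root of e_j - kap with j = min(i, r), where both e_j and kap involve only
    earlier elements. The polynomial is monic of degree q^j, which is [ydegree i]. *)
Lemma tower_y i : (i <= n * r)%N ->
  exists (T : comNzRingType) (theta : {rmorphism L -> T}) (Y Yi y : nat -> T),
    [/\ forall l : 'I_r, Ydata theta Y Yi l,
        forall l, (l < i)%N -> ydata theta Yi y l &
        stage theta (gens Y y r i)
          ((\prod_(l < r) (size (f l)).-1) * \prod_(l < i) ydegree l)%N].
Proof.
elim: i => [_|i IH ir].
  have [T [theta [Y [Yi [HY st]]]]] := tower_Y (leqnn r).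
  exists T, theta, Y, Yi, (fun=> 0); split=> // [l|].
    exact: HY.
  rewrite big_ord0 muln1.
  have -> : (\prod_(l < r) (size (f l)).-1 = \prod_(l < r | (l < r)%N) (size (f l)).-1)%N.
    by apply: eq_bigl => l; rewrite ltn_ord.
  by apply: stage_sub st => x [[l lr ->]|[]] //; left; exists l.
have [T [theta [Y [Yi [y [HY Hy st]]]]]] := IH (ltnW ir).
pose e := if (i < r)%N then i else r.
have ei : (e <= i)%N by rewrite /e; case: ltnP.
have qe0 : (0 < #|k| ^ e)%N by rewrite expn_gt0 card_k_gt0.
pose kap := if (i < r)%N then
    ecoef (n * r) (theta \o kL) y i * theta (cL (tF k ^+ n.-1)) * Yi i
  else theta (cL (tF k)^-1) * ecoef (n * r) (theta \o kL) y r * y (i - r)%N.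
pose P := ppol (n * r) (theta \o kL) y e.
pose g := P - kap%:P.
have sP : size P = (#|k| ^ e).+1 by rewrite size_ppol.
have sC : (size (- kap%:P) < size P)%N.
  by rewrite size_polyN sP ltnS (leq_trans (size_polyC_leq1 _)).
have mg : g \is monic by rewrite monicE lead_coefDl // (monicP (ppol_monic _ _ _ _)).
have sg : size g = (#|k| ^ e).+1 by rewrite size_polyDl.
have [T' [iota [z [gz st']]]] := stage_adjoin mg sg qe0 st.
pose y' l := if l == i then z else iota (y l).
have y'E l : (l < i)%N -> y' l = (iota \o y) l by move=> li; rewrite /y' (ltn_eqF li).
have th_comp : (iota \o theta : {rmorphism L -> T'}) \o kL = iota \o (theta \o kL) :> (k -> T').
  by [].
have epolE j x : (j <= i)%N ->
    epol (n * r) (iota \o (theta \o kL)) y' j x = epol (n * r) (iota \o (theta \o kL)) (iota \o y) j x.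
  by move=> ji; apply: (@epol_local _ _ _ (iota \o (theta \o kL) : {rmorphism k -> T'})) => l lj;
     apply: y'E; apply: leq_trans ji.
have ecoefE j : (j <= i)%N ->
    ecoef (n * r) (iota \o (theta \o kL)) y' j = iota (ecoef (n * r) (theta \o kL) y j).
  move=> ji; rewrite -ecoef_natural.
  by apply: (@ecoef_local _ _ _ (iota \o (theta \o kL) : {rmorphism k -> T'})) => l lj;
     apply: y'E; apply: leq_trans ji.
exists T', (iota \o theta : {rmorphism L -> T'}), (iota \o Y), (iota \o Yi), y'; split.
- move=> l; have [e1 e2] := HY l; split; last by rewrite /= -rmorphM e2 rmorph1.
  by rewrite /= -e1 -horner_map -map_poly_comp.
- move=> l; rewrite ltnS leq_eqVlt => /orP[/eqP ->|li].
    have Ez : epol (n * r) (iota \o (theta \o kL)) y' e (y' i) = iota kap.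
      rewrite epolE // /y' eqxx -horner_ppol ppol_natural.
      by apply/eqP; rewrite -subr_eq0 -gz rmorphB /= map_polyC hornerD hornerN hornerC.
    rewrite /ydata th_comp; move: Ez; rewrite /e /kap.
    case: ltnP => [ltir|leri] ->.
      by rewrite ecoefE // !rmorphM.
    rewrite ecoefE // !rmorphM /= /y' ltn_eqF // ltn_subrL.
    have := ir; case: (r) leri => [|//]; first by rewrite muln0.
    by move=> r' ri' _; rewrite /= (leq_trans _ ri').
  have := Hy l li; rewrite /ydata th_comp; case: ltnP => [lr|rl] el.
    rewrite epolE ?(ltnW li) // y'E // epol_natural el ecoefE ?(ltnW li) //.
    by rewrite !rmorphM.
  have ri : (r <= i)%N by apply: leq_trans rl (ltnW li).
  rewrite epolE // y'E // epol_natural el ecoefE // y'E ?(leq_ltn_trans (leq_subr _ _)) //.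
  by rewrite !rmorphM.
rewrite big_ord_recr /= mulnA.
have -> : ydegree i = (#|k| ^ e)%N by rewrite /ydegree /e; case: ltnP.
apply: stage_sub st' => x [->|[a [|] [l li ->] <-]].
- by right; exists i; rewrite /y' ?eqxx.
- by left; exists l.
- by right; exists l; rewrite ?y'E //; apply: ltnW.
Qed.

End Tower.

(** * Freeness *)

Section Independence.
Variables (k : finFieldType) (r D : nat).
Local Notation F := {fraction {poly k}}.
Local Notation L := (ratfuns k r).
Variables (R T : comNzRingType) (cst : {rmorphism F -> R}) (theta : {rmorphism L -> T}).
Variables (Psi : {rmorphism R -> T}) (Z : 'I_r -> R) (G : 'I_D -> R).
Hypothesis gen : forall x, mspan cst Z G x.
Hypothesis Psi_cst : forall c, Psi (cst c) = theta (cL r c).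
Hypothesis Psi_Z : forall j, Psi (Z j) = theta (Zvar k j).

Definition Lspan (x : T) := exists l : 'I_D -> L, x = \sum_b theta (l b) * Psi (G b).

Lemma Psi_mmap p : Psi (mmap cst Z p) = theta (p%:F : L).
Proof.
rewrite [p in RHS]mpolyE !rmorph_sum; apply: eq_bigr => m _.
rewrite -mul_mpolyC !rmorphM /= Psi_cst; congr (_ * _).
rewrite mpolyXE_id !rmorph_prod; apply: eq_bigr => j _.
by rewrite !rmorphXn /= Psi_Z.
Qed.

Lemma Lspan_Psi x : Lspan (Psi x).
Proof.
have [p ->] := gen x; exists (fun b => (p b)%:F : L); rewrite rmorph_sum.
by apply: eq_bigr => b _; rewrite rmorphM /= Psi_mmap.
Qed.

Lemma LspanZ l x : Lspan x -> Lspan (theta l * x).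
Proof.
move=> [m ->]; exists (fun b => l * m b); rewrite mulr_sumr.
by apply: eq_bigr => b _; rewrite rmorphM mulrA.
Qed.

Lemma LspanD x z : Lspan x -> Lspan z -> Lspan (x + z).
Proof.
move=> [l ->] [m ->]; exists (fun b => l b + m b); rewrite -big_split.
by apply: eq_bigr => b _; rewrite rmorphD mulrDl.
Qed.

Lemma Lspan_sum I (s : seq I) (P : pred I) (H : I -> T) :
  (forall i, P i -> Lspan (H i)) -> Lspan (\sum_(i <- s | P i) H i).
Proof.
move=> HH; apply: big_ind => //; last exact: LspanD.
by rewrite -(rmorph0 Psi); apply: Lspan_Psi.
Qed.

Lemma LspanN x : Lspan x -> Lspan (- x).
Proof. by move=> /(LspanZ (-1)); rewrite rmorphN rmorph1 mulN1r. Qed.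

Lemma Lspan_subring : subring_set Lspan.
Proof.
split=> [|x z Sx Sz|x z [l ->] [m ->]].
- by rewrite -(rmorph1 Psi); apply: Lspan_Psi.
- by apply: LspanD => //; apply: LspanN.
- rewrite mulr_suml; apply: Lspan_sum => a _; rewrite mulr_sumr; apply: Lspan_sum => b _.
  rewrite mulrACA -rmorphM -rmorphM; apply: LspanZ; exact: Lspan_Psi.
Qed.

(* The powers of u are linearly dependent, so v is a polynomial in u. *)
Lemma Lspan_inv u v : u * v = 1 -> Lspan u -> Lspan v.
Proof.
have [S1 _ SM] := Lspan_subring; move=> uv Su.
have Sexp i : Lspan (u ^+ i).
  by elim: i => [|i IH]; rewrite ?expr0 // exprS; apply: SM.
have [l Hl] := choice Sexp.
pose A : 'M[L]_(D.+1, D) := \matrix_(i, j) l i j.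
have kA : kermx A != 0.
  by rewrite -mxrank_eq0 mxrank_ker subn_eq0 -ltnNge ltnS rank_leq_col.
have /rowV0Pn[c cA c0] := kA; have {}cA : c *m A = 0 by apply/sub_kermxP.
have rel : \sum_i theta (c 0 i) * u ^+ i = 0.
  under eq_bigr => i _ do rewrite Hl mulr_sumr.
  rewrite exchange_big big1 //= => b _.
  transitivity (theta ((c *m A) 0 b) * Psi (G b)); last by rewrite cA mxE rmorph0 mul0r.
  rewrite mxE rmorph_sum mulr_suml; apply: eq_bigr => i _.
  by rewrite rmorphM !mxE mulrA.
have ex : exists i, (i < D.+1)%N && (c 0 (inord i) != 0).
  by have /rV0Pn[i ci] := c0; exists i; rewrite ltn_ord inord_val.
(* Let j be the lowest index in the dependence relation. Multiplying by v^(j+1) / c_j turns the term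
   of index j into v and the later ones into scalar multiples of powers of u. *)
have [j /andP[jD cj] jmin] := ex_minnP ex.
pose J := Ordinal jD; have cJ : c 0 J != 0 by rewrite -(inord_val J).
have vu i : v ^+ i * u ^+ i = 1 by rewrite -exprMn mulrC uv expr1n.
have -> : v = \sum_(i < D.+1 | (j < i)%N) theta (- (c 0 J)^-1 * c 0 i) * u ^+ (i - j.+1); last first.
  by apply: Lspan_sum => i _; apply: LspanZ.
have : theta (c 0 J)^-1 * v ^+ j.+1 * (\sum_i theta (c 0 i) * u ^+ i) = 0 by rewrite rel mulr0.
rewrite (bigD1 J) //= mulrDr.
have -> : theta (c 0 J)^-1 * v ^+ j.+1 * (theta (c 0 J) * u ^+ j) = v.
  transitivity ((theta (c 0 J)^-1 * theta (c 0 J)) * (v ^+ j * u ^+ j) * v).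
    by rewrite exprS; ring.
  by rewrite -rmorphM mulVf // rmorph1 vu !mul1r.
move/eqP; rewrite addr_eq0 => /eqP ->; rewrite mulr_sumr -sumrN.
rewrite (bigID (fun i : 'I_D.+1 => (j < i)%N)) /= [X in _ + X]big1 ?addr0 => [|i]; last first.
  rewrite -val_eqE /= -leqNgt => /andP[ij ji].
  have [->|ci] := eqVneq (c 0 i) 0; first by rewrite rmorph0 mul0r mulr0 oppr0.
  have : (j <= i)%N by apply: jmin; rewrite ltn_ord inord_val.
  by move=> ji'; move: ij; rewrite eqn_leq ji ji'.
apply: eq_big => [i|i /andP[_ ji]]; first by rewrite -val_eqE /=; case: ltngtP.
have -> : u ^+ i = u ^+ j.+1 * u ^+ (i - j.+1) by rewrite -exprD subnKC.
rewrite rmorphM rmorphN !mulNr; congr (- _).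
transitivity ((v ^+ j.+1 * u ^+ j.+1) * (theta (c 0 J)^-1 * theta (c 0 i) * u ^+ (i - j.+1))).
  by ring.
by rewrite vu mul1r.
Qed.

(** The L-span of the D elements [Psi (G b)] is a subring closed under inverses, so it contains the
    D independent elements of the stage. The square matrix expressing these is then invertible and
    the [Psi (G b)] are independent over [L]; a relation over F[Z] in [R] maps to a relation over
    [L]. *)
Lemma stage_free_basis A : stage theta A D ->
    (forall P, subring_set P -> (forall l, P (theta l)) -> (forall x, P (Psi x)) ->
       (forall u v, u * v = 1 -> P u -> P v) -> A `<=` P) ->
  free_basis cst Z G.
Proof.
move=> [I [u [cI iu su]]] HA; split=> // p p0.
have [S1 SB SM] := Lspan_subring.
have Stheta l : Lspan (theta l) by rewrite -[theta l]mulr1; apply: LspanZ.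
have uS i : Lspan (u i).
  apply: (su i _ Lspan_subring Stheta); apply: HA.
  - exact: Lspan_subring.
  - exact: Stheta.
  - exact: Lspan_Psi.
  - exact: Lspan_inv.
have [l Hl] := choice uS.
have D_I : #|I| = D := cI.
pose e (i : 'I_D) : I := enum_val (cast_ord (esym D_I) i).
pose M : 'M[L]_D := \matrix_(i, j) l (e i) j.
have e_sum (g : I -> T) : \sum_i g i = \sum_(i < D) g (e i).
  rewrite (reindex e) //=; exists (fun i => cast_ord D_I (enum_rank i)) => i _.
    by rewrite /e enum_valK cast_ordKV.
  by rewrite /e cast_ordK enum_rankK.
have key (v : 'rV[L]_D) : \sum_b theta ((v *m M) 0 b) * Psi (G b) = 0 -> v = 0.
  move=> v0; apply/rowP => i; rewrite mxE.
  pose c (j : I) := v 0 (cast_ord D_I (enum_rank j)).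
  have ce j : c (e j) = v 0 j by rewrite /c /e enum_valK cast_ordKV.
  rewrite -ce; apply: iu; rewrite e_sum -[RHS]v0.
  under eq_bigr => j _ do rewrite ce Hl mulr_sumr.
  rewrite exchange_big; apply: eq_bigr => b _ /=.
  rewrite mxE rmorph_sum mulr_suml; apply: eq_bigr => j _.
  by rewrite rmorphM mxE mulrA.
have uM : M \in unitmx.
  rewrite -row_free_unit -kermx_eq0; apply/eqP/row_matrixP => i; rewrite row0.
  apply: key; rewrite big1 // => b _; rewrite -row_mul mulmx_ker.
  by rewrite row0 mxE rmorph0 mul0r.
pose polys : 'rV[L]_D := \row_b ((p b)%:F : L).
have lp0 : polys *m invmx M = 0.
  apply: key; rewrite mulmxKV // -[RHS](rmorph0 Psi) -p0 rmorph_sum.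
  by apply: eq_bigr => b _; rewrite mxE rmorphM /= Psi_mmap.
have {}lp0 : polys = 0 by rewrite -(mulmxKV uM polys) lp0 mul0mx.
move=> b; have /rowP/(_ b) := lp0; rewrite !mxE => /eqP.
by rewrite tofrac_eq0 => /eqP.
Qed.

End Independence.

(** * Homomorphisms from R_n *)

Lemma inv_mul_sub (K : fieldType) (x y : K) : x != 0 -> y != 0 -> y - x != 0 ->
  x^-1 * y^-1 = (y - x)^-1 * (x^-1 - y^-1).
Proof. by move=> x0 y0 yx; field; rewrite x0 y0 yx. Qed.

Section Reciprocals.
Variables (k : fieldType) (V : vectType k).

HB.instance Definition _ := GRing.isLinear.Build k V (Sym V) _ (@sym_inj k V)
  (@sym_inj_linear k V).

Lemma sym_inj_eq0 (v : V) : (sym_inj v == 0) = (v == 0).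
Proof.
apply/eqP/eqP => [v0|->]; last by rewrite raddf0.
rewrite (coord_vbasis (memvf v)) big1 // => i _.
have := congr1 (fun p : Sym V => p@_U_(i)) v0.
rewrite mcoeff0 /sym_inj raddf_sum (bigD1 i) //= mcoeffZ mcoeffXU eqxx mulr1.
rewrite big1 ?addr0 => [->|j ji]; first by rewrite scale0r.
by rewrite mcoeffZ mcoeffXU (negPf ji) mulr0.
Qed.

Lemma sym_frac_eq0 (v : V) : (sym_frac v == 0) = (v == 0).
Proof. by rewrite /sym_frac tofrac_eq0 sym_inj_eq0. Qed.

Lemma sym_fracZ a (v : V) : sym_frac (a *: v) = const_frac V a * sym_frac v.
Proof. by rewrite /sym_frac /const_frac linearZ -tofracM mul_mpolyC. Qed.

Lemma sym_fracB (u v : V) : sym_frac (u - v) = sym_frac u - sym_frac v.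
Proof. by rewrite /sym_frac raddfB tofracB. Qed.

Lemma recipZ a (v : V) : recip (a *: v) = recip_const V a^-1 * recip v.
Proof.
apply: val_inj => /=; rewrite sym_fracZ invfM; congr (_ * _).
(* For a = 0 both sides vanish, as the inverse of 0 is 0 in [k] and in the fraction field. *)
have [a0|a0] := eqVneq a 0.
  have -> : a^-1 = 0 by apply/eqP; rewrite invr_eq0 a0.
  have e : const_frac V 0 = 0 by rewrite /const_frac mpolyC0 tofrac0.
  by rewrite a0 e; apply/eqP; rewrite invr_eq0.
have ca0 : const_frac V a != 0 by rewrite tofrac_eq0 mpolyC_eq0.
by apply: (mulfI ca0); rewrite mulfV // -tofracM -mpolyCM mulfV // mpolyC1.
Qed.

Lemma recipM (u v : V) : u != 0 -> v != 0 -> u != v ->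
  recip u * recip v = recip (v - u) * (recip u - recip v).
Proof.
move=> u0 v0 uv; apply: val_inj => /=; rewrite sym_fracB.
have : sym_frac v - sym_frac u != 0 by rewrite -sym_fracB sym_frac_eq0 subr_eq0 eq_sym.
by apply: inv_mul_sub; rewrite sym_frac_eq0.
Qed.

Section Lift.
Variables (T : comNzRingType) (theta : {rmorphism k -> T}) (la mu : V -> T).
Hypothesis laD : forall u v, la (u + v) = la u + la v.
Hypothesis laZ : forall a v, la (a *: v) = theta a * la v.
Hypothesis la_mu : forall v, v != 0 -> la v * mu v = 1.

Definition sym_lift : Sym V -> T := mmap theta (fun i => la (vbasis {:V})`_i).
HB.instance Definition _ := GRing.RMorphism.on sym_lift.

Lemma sym_lift_const c : sym_lift c%:MP = theta c.
Proof. by rewrite /sym_lift mmapC. Qed.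

Lemma sym_lift_inj v : sym_lift (sym_inj v) = la v.
Proof.
have la0 : la 0 = 0 by rewrite -(scale0r 0) laZ rmorph0 mul0r.
rewrite [in RHS](coord_vbasis (memvf v)) (big_morph la laD la0) rmorph_sum.
by apply: eq_bigr => i _; rewrite laZ /= /sym_lift mmapZ mmapX mmap1U.
Qed.

Definition den (s : seq V) : Sym V := \prod_(v <- s) sym_inj v.

Lemma sym_lift_den_invertible s : all (fun v => v != 0) s -> invertible (sym_lift (den s)).
Proof.
move=> /allP s0; rewrite /den rmorph_prod; apply: invertible_prod => v vs.
by exists (mu v); rewrite /= sym_lift_inj la_mu ?s0.
Qed.

(* T need not be a domain: the extension of sym_lift to fractions is defined by
   its graph, on fractions whose denominator is a product of vectors. *)
Definition lift_graph (x : SymFrac V) (z : T) := exists p s,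
  [/\ all (fun v => v != 0) s, x * (den s)%:F = p%:F & z * sym_lift (den s) = sym_lift p].

Lemma lift_graph_fun x z w : lift_graph x z -> lift_graph x w -> z = w.
Proof.
move=> [p [s [s0 xs zs]]] [q [t [t0 xt wt]]].
have e : p * den t = q * den s.
  by apply/eqP; rewrite -tofrac_eq !tofracM -xs -xt mulrAC.
apply: (invertible_cancel (invertibleM (sym_lift_den_invertible s0) (sym_lift_den_invertible t0))).
have := congr1 sym_lift e; rewrite !rmorphM /= -zs -wt => e'.
by transitivity (z * sym_lift (den s) * sym_lift (den t)); [ring | rewrite e'; ring].
Qed.

Lemma den_cat s t : den (s ++ t) = den s * den t.
Proof. by rewrite /den big_cat. Qed.

Lemma lift_graphB x y z w : lift_graph x z -> lift_graph y w -> lift_graph (x - y) (z - w).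
Proof.
move=> [p [s [s0 xs zs]]] [q [t [t0 yt wt]]].
exists (p * den t - q * den s), (s ++ t); rewrite all_cat s0 t0 den_cat; split=> //.
  by rewrite tofracB !tofracM -xs -yt; ring.
by rewrite !(rmorphB, rmorphM) /= -zs -wt; ring.
Qed.

Lemma lift_graphM x y z w : lift_graph x z -> lift_graph y w -> lift_graph (x * y) (z * w).
Proof.
move=> [p [s [s0 xs zs]]] [q [t [t0 yt wt]]].
exists (p * q), (s ++ t); rewrite all_cat s0 t0 den_cat; split=> //.
  by rewrite !tofracM -xs -yt; ring.
by rewrite !rmorphM /= -zs -wt; ring.
Qed.

Lemma lift_graph_const c : lift_graph (const_frac V c) (theta c).
Proof.
exists c%:MP, [::]; rewrite /den big_nil tofrac1 rmorph1 !mulr1 sym_lift_const.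
by split.
Qed.

Lemma lift_graph_recip v : v != 0 -> lift_graph (sym_frac v)^-1 (mu v).
Proof.
move=> v0; exists 1, [:: v]; rewrite /= v0 /den big_seq1 sym_lift_inj.
split=> //; first by rewrite -[(sym_inj v)%:F]/(sym_frac v) mulVf ?sym_frac_eq0 // tofrac1.
by rewrite mulrC la_mu // rmorph1.
Qed.

Lemma lift_graph_total (x : recip_ring V) : exists z, lift_graph (val x) z.
Proof.
have /asboolP H := valP x.
apply: (H [set x | exists z, lift_graph x z]); split=> [|y].
  split=> [|u v|u v]; rewrite !inE.
  - exists 1; rewrite -(rmorph1 theta).
    have -> : 1 = const_frac V 1 by rewrite /const_frac mpolyC1 tofrac1.
    exact: lift_graph_const.
  - by move=> [z uz] [w vw]; exists (z - w); apply: lift_graphB.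
  - by move=> [z uz] [w vw]; exists (z * w); apply: lift_graphM.
case=> [[c _ <-]|[v /= v0 <-]]; first by exists (theta c); apply: lift_graph_const.
by exists (mu v); apply: lift_graph_recip.
Qed.

Definition recip_lift (x : recip_ring V) : T := projT1 (cid (lift_graph_total x)).

Lemma recip_liftP x : lift_graph (val x) (recip_lift x).
Proof. by rewrite /recip_lift; case: cid. Qed.

Lemma recip_lift_is_zmod_morphism : zmod_morphism recip_lift.
Proof.
move=> x y; apply: lift_graph_fun (recip_liftP _) _.
by apply: lift_graphB; apply: recip_liftP.
Qed.

Lemma recip_lift_const c : recip_lift (recip_const V c) = theta c.
Proof. by apply: lift_graph_fun (recip_liftP _) _; apply: lift_graph_const. Qed.

Lemma recip_lift_is_monoid_morphism : monoid_morphism recip_lift.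
Proof.
split=> [|x y]; first by rewrite -(rmorph1 (recip_const V)) recip_lift_const rmorph1.
apply: lift_graph_fun (recip_liftP _) _.
by apply: lift_graphM; apply: recip_liftP.
Qed.

Lemma recip_lift_recip v : v != 0 -> recip_lift (recip v) = mu v.
Proof. by move=> v0; apply: lift_graph_fun (recip_liftP _) _; apply: lift_graph_recip. Qed.

HB.instance Definition _ := GRing.isZmodMorphism.Build (recip_ring V) T recip_lift
  recip_lift_is_zmod_morphism.
HB.instance Definition _ := GRing.isMonoidMorphism.Build (recip_ring V) T recip_lift
  recip_lift_is_monoid_morphism.

End Lift.
End Reciprocals.

Section TensorHom.
Variables (k B C T : comPzRingType) (f : {rmorphism k -> B}) (g : {rmorphism k -> C}).
Variables (phi : {rmorphism B -> T}) (psi : {rmorphism C -> T}).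
Hypothesis phi_psi : forall a, phi (f a) = psi (g a).

Definition tensor_hom : tensor f g -> T := tlift (fun b c => phi b * psi c).

Lemma tensor_hom_balanced : balanced f g (fun b c => phi b * psi c).
Proof.
split=> [b b' c|b c c'|a b c]; rewrite ?(rmorphD, rmorphM) ?mulrDl ?mulrDr //.
by rewrite phi_psi; ring.
Qed.

Lemma tensor_hom_tens b c : tensor_hom (tens b c) = phi b * psi c.
Proof. exact: (tlift_tens tensor_hom_balanced). Qed.

Lemma tensor_hom_is_zmod_morphism : zmod_morphism tensor_hom.
Proof. exact: (tlift_is_zmod_morphism tensor_hom_balanced). Qed.

Lemma tensor_hom_is_monoid_morphism : monoid_morphism tensor_hom.
Proof.
split=> [|x y]; first by rewrite -tens1 tensor_hom_tens !rmorph1 mulr1.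
elim/tensor_ind: x => [b c|x x' hx hx'].
  elim/tensor_ind: y => [b' c'|y y' hy hy'].
    by rewrite tens_mul !tensor_hom_tens !rmorphM mulrACA.
  by rewrite mulrBr !tensor_hom_is_zmod_morphism hy hy' mulrBr.
by rewrite mulrBl !tensor_hom_is_zmod_morphism hx hx' mulrBl.
Qed.

End TensorHom.

Section QuotientHom.
Variables (R T : comPzRingType) (S : set R) (phi : R -> T).
Hypothesis phiB : zmod_morphism phi.
Hypothesis phiM : monoid_morphism phi.
Hypothesis phiS : forall x, S x -> phi x = 0.

Definition quot_hom (z : quot_ring S) : T := phi (repr z).

Lemma quot_hom_pi x : quot_hom (\pi_(quot_ring S) x) = phi x.
Proof.
pose K : set R := [set x | phi x = 0].
have cK : ideal K.
  have phi0 : phi 0 = 0 by rewrite -(subrr 0) phiB subrr.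
  have phiN u : phi (- u) = - phi u by rewrite -sub0r phiB phi0 sub0r.
  split=> [|u v|a u]; rewrite /K /=; first by rewrite phi0.
    by move=> u0 v0; rewrite -[v]opprK phiB phiN u0 v0 oppr0 subr0.
  by move=> u0; rewrite phiM.2 u0 mulr0.
apply/eqP; rewrite -subr_eq0 -phiB; apply/eqP.
apply: (ideal_gen_sub cK (S := S)) => //.
apply/quot_ring_pi_eq0; rewrite raddfB /= reprK; exact: subrr.
Qed.

Lemma quot_hom_is_zmod_morphism : zmod_morphism quot_hom.
Proof.
move=> x y; rewrite -[x]reprK -[y]reprK !quot_hom_pi -phiB -quot_hom_pi.
by congr quot_hom; rewrite [RHS]raddfB.
Qed.

Lemma quot_hom_is_monoid_morphism : monoid_morphism quot_hom.
Proof.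
split=> [|x y].
  by rewrite -(quot_ring_pi_is_monoid_morphism S).1 quot_hom_pi phiM.1.
have quotP (z : quot_ring S) : exists a, z = \pi_(quot_ring S) a.
  by exists (repr z); rewrite reprK.
have [a ->] := quotP x; have [b ->] := quotP y.
by rewrite -(quot_ring_pi_is_monoid_morphism S).2 !quot_hom_pi phiM.2.
Qed.

End QuotientHom.

HB.instance Definition _ (k : finFieldType) (n : nat) :=
  GRing.isLinear.Build k 'rV[k]_n (torsion k n) _ (@torsion_of_row k n)
    (@torsion_of_row_linear k n).

(** * Coordinates on V_n *)

Section Encoding.
Variables (k : finFieldType) (r n : nat).
Hypothesis n_gt0 : (0 < n)%N.
Local Notation V := (Vn k r n).
Local Notation A := {poly k}.

(** Entry m is the coefficient of t^m in a numerator over t^n, hence that of t^-(n-m). The index is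
    reversed so that higher torsion corresponds to higher degree of p. *)
Definition vec_row (p : {poly k}) (j : 'I_r) : 'rV[k]_n :=
  \row_(m < n) p`_((n.-1 - m) * r + j).

(* The coefficient of X^((nu-1) r + j) in p is the coefficient of t^-nu in the
   j-th component, so that t acts by dropping the r lowest coefficients. *)
Definition vec (p : {poly k}) : V := [ffun j => torsion_of_row (vec_row p j)].

Lemma vec_row_is_linear j : linear (vec_row^~ j).
Proof. by move=> a p q; apply/rowP => m; rewrite !mxE coefD coefZ. Qed.

Lemma vec_is_linear : linear vec.
Proof.
move=> a p q; apply/ffunP => j; rewrite !ffunE vec_row_is_linear.
exact: torsion_of_row_linear.
Qed.

HB.instance Definition _ := GRing.isLinear.Build k {poly k} V _ vec vec_is_linear.

Lemma vec_eq0 (p : {poly k}) : (size p <= n * r)%N -> vec p = 0 -> p = 0.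
Proof.
move=> pn p0; apply/polyP => i; rewrite coef0.
have [ni|ni] := leqP (n * r) i; first by rewrite nth_default // (leq_trans pn).
have r0 : (0 < r)%N by case: (r) ni => //; rewrite muln0.
have jr : (i %% r < r)%N by rewrite ltn_mod.
have dn : (i %/ r < n)%N by rewrite ltn_divLR.
have mn : (n.-1 - i %/ r < n)%N by rewrite -(prednK n_gt0) ltnS leq_subr.
have /ffunP/(_ (Ordinal jr)) := p0; rewrite !ffunE -(linear0 (@torsion_of_row k n)).
move/torsion_of_row_inj/rowP/(_ (Ordinal mn)); rewrite !mxE /= subKn; last first.
  by rewrite -ltnS prednK.
by rewrite -divn_eq.
Qed.

Lemma vec_surj (v : V) : exists2 p : {poly k}, (size p <= n * r)%N & v = vec p.
Proof.
pose c i := if insub (i %% r)%N is Some j then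
  if insub (n.-1 - i %/ r)%N is Some m then row_of_torsion (v j) 0 m else 0 else 0.
exists (\poly_(i < n * r) c i); first exact: size_poly.
apply/ffunP => j; rewrite ffunE -[LHS]row_of_torsionK; congr torsion_of_row.
apply/rowP => m; rewrite mxE coef_poly.
have r0 : (0 < r)%N by apply: leq_ltn_trans (ltn_ord j).
have mn : (m <= n.-1)%N by rewrite -ltnS prednK.
have lt : ((n.-1 - m) * r + j < n * r)%N.
  rewrite -ltn_divLR // divnMDl // divn_small // addn0.
  by apply: leq_ltn_trans (leq_subr _ _) _; rewrite prednK.
rewrite lt /c modnMDl modn_small // divnMDl // divn_small // addn0 subKn //.
by rewrite !valK.
Qed.

Lemma coef_vec_row (p : {poly k}) j i :
  (rVpoly (vec_row p j))`_i = if (i < n)%N then p`_((n.-1 - i) * r + j) else 0.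
Proof.
rewrite coef_rVpoly; case: ltnP => ni; first by rewrite insubT mxE.
by rewrite insubF // ltnNge ni.
Qed.

Lemma vec_actX (p : {poly k}) : (size p <= n * r)%N ->
  Vn_act 'X (vec p) = vec (drop_poly r p).
Proof.
move=> pn; apply/ffunP => j; rewrite !ffunE; apply: val_inj => /=.
(* Multiplication by t moves the coefficient of t^-1, which is p_j, to the constant term, where it
   vanishes in F/A. *)
rewrite FmodA_scale_pi; apply/FmodA_pi_eq; exists (p`_j)%:P.
have Xn0 : ('X^n : A)%:F != 0 by rewrite tofrac_eq0 expf_neq0 ?polyX_eq0.
rewrite mulrA -mulrBl -tofracM -tofracB.
apply: (mulIf Xn0); rewrite mulfVK // -tofracM; congr (_%:F).
apply/polyP => i; rewrite coefB coefXM coefCM coefXn !coef_vec_row coef_drop_poly.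
have e1 m : ((n.-1 - m.+1) * r + j + r = (n.-1 - m.+1).+1 * r + j)%N by rewrite mulSn; lia.
case: i => [|i].
  rewrite n_gt0 (ltn_eqF n_gt0) mulr0 sub0r nth_default ?oppr0 //.
  apply: leq_trans pn _; rewrite subn0 addnAC -mulSnr prednK //; exact: leq_addr.
rewrite [_ == 0%N]/= [_.-1]/=; have [lt|ge] := ltnP i.+1 n.
  rewrite (ltn_eqF lt) mulr0 (ltnW lt) e1 subnSK ?subrr //.
  by rewrite -ltnS prednK.
have [e|ne] := eqVneq i.+1 n.
  by rewrite -e ltnSn /= subnn mul0n add0n mulr1 subr0.
have -> : (i < n)%N = false by apply/negbTE; rewrite -leqNgt -ltnS ltn_neqAle eq_sym ne.
by rewrite subrr mulr0.
Qed.

Lemma Vn_actM (a b : A) (v : V) : Vn_act (a * b) v = Vn_act a (Vn_act b v).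
Proof. by apply/ffunP => j; rewrite !ffunE; apply: val_inj; rewrite /= scalerA. Qed.

Lemma Vn_act1 (v : V) : Vn_act 1 v = v.
Proof. by apply/ffunP => j; rewrite !ffunE; apply: val_inj; rewrite /= scale1r. Qed.

Lemma Vn_actC a (v : V) : Vn_act a%:P v = a *: v.
Proof. by apply/ffunP => j; rewrite !ffunE. Qed.

Lemma vec_actXn nu (p : {poly k}) : (size p <= n * r)%N ->
  Vn_act 'X^nu (vec p) = vec (drop_poly (nu * r) p).
Proof.
elim: nu p => [|nu IH] p pn; first by rewrite expr0 Vn_act1 mul0n drop_poly0l.
have dn : (size (drop_poly r p) <= n * r)%N.
  by rewrite size_drop_poly (leq_trans (leq_subr _ _)).
rewrite exprSr Vn_actM vec_actX // IH //; congr vec.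
by apply/polyP => i; rewrite !coef_drop_poly mulSn [(r + _)%N]addnC addnA.
Qed.

Lemma vec_Vsub nu (p : {poly k}) : (size p <= n * r)%N ->
  (vec p \in Vsub nu) = (size p <= nu * r)%N.
Proof.
move=> pn; rewrite Vsub_torsion vec_actXn //.
have dn : (size (drop_poly (nu * r) p) <= n * r)%N.
  by rewrite size_drop_poly (leq_trans (leq_subr _ _)).
apply/eqP/idP => [/(vec_eq0 dn) /eqP|pnu]; last by rewrite drop_poly_eq0 ?linear0.
by rewrite -size_poly_eq0 size_drop_poly subn_eq0.
Qed.

Lemma sum_Vsub (U : zmodType) nu (G : V -> U) : (nu <= n)%N ->
  \sum_(v : V | v \in Vsub nu) G v = \sum_(u <- polys k (nu * r)) G (vec u).
Proof.
move=> nun; have le : (nu * r <= n * r)%N by rewrite leq_mul2r nun orbT.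
rewrite -big_filter; apply: (@big_image_uniq U {poly k} V) => [||u v|v].
- exact: polys_uniq.
- by rewrite filter_uniq // index_enum_uniq.
- rewrite !mem_polys => un vn /eqP; rewrite -subr_eq0 -linearB => /eqP/vec_eq0.
  move=> H; apply/eqP; rewrite -subr_eq0; apply/eqP/H.
  apply: leq_trans (size_polyD _ _) _.
  by rewrite size_polyN geq_max !(leq_trans _ le).
rewrite mem_filter mem_index_enum andbT; split=> [|[u un ->]]; last first.
  by rewrite mem_polys in un; rewrite vec_Vsub // (leq_trans un).
have [p pn ->] := vec_surj v; rewrite vec_Vsub // => pnu.
by exists p; rewrite ?mem_polys.
Qed.

End Encoding.

(** * Generators, relations and homomorphisms of R_n *)

Section RnFacts.
Variables (k : finFieldType) (r n : nat).
Hypothesis n_gt0 : (0 < n)%N.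
Local Notation F := {fraction {poly k}}.
Local Notation V := (Vn k r n).
Local Notation tensRF := (@tens k (recip_ring V) F (@recip_const k V) (@const_ratfun k)).

Definition Rn_pi (x : RVn_F k r n) : Rn k r n := \pi_(quot_ring (@Rn_rel k r n)) x.

Lemma Rn_pi_is_zmod_morphism : zmod_morphism Rn_pi.
Proof. by move=> x y; rewrite /Rn_pi [LHS]raddfB. Qed.

Lemma Rn_pi_is_monoid_morphism : monoid_morphism Rn_pi.
Proof. exact: quot_ring_pi_is_monoid_morphism. Qed.

HB.instance Definition _ := GRing.isZmodMorphism.Build (RVn_F k r n) (Rn k r n) Rn_pi
  Rn_pi_is_zmod_morphism.
HB.instance Definition _ := GRing.isMonoidMorphism.Build (RVn_F k r n) (Rn k r n) Rn_pi
  Rn_pi_is_monoid_morphism.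

Lemma Rn_pi_rel x : Rn_rel x -> Rn_pi x = 0.
Proof. by move=> relx; apply/quot_ring_pi_eq0; apply: mem_ideal_gen. Qed.

Lemma Rn_pi_surj z : exists x, z = Rn_pi x.
Proof. by exists (repr (z : quot_ring (@Rn_rel k r n))); rewrite /Rn_pi reprK. Qed.

Definition cstR (c : F) : Rn k r n := Rn_pi (tensRF 1 c).

Lemma cstR_is_zmod_morphism : zmod_morphism cstR.
Proof.
move=> a b; rewrite /cstR -rmorphB; congr Rn_pi.
by apply/eqP; rewrite eq_sym subr_eq -tensDr subrK.
Qed.

Lemma cstR_is_monoid_morphism : monoid_morphism cstR.
Proof.
split=> [|a b]; first by rewrite /cstR tens1 rmorph1.
by rewrite /cstR -rmorphM tens_mul mulr1.
Qed.

HB.instance Definition _ := GRing.isZmodMorphism.Build F (Rn k r n) cstR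
  cstR_is_zmod_morphism.
HB.instance Definition _ := GRing.isMonoidMorphism.Build F (Rn k r n) cstR
  cstR_is_monoid_morphism.

Definition XV (v : V) : Rn k r n := Rn_pi (tensRF (recip v) 1).

Definition XR (p : {poly k}) : Rn k r n := XV (vec r n p).

Lemma tens_cst b c : Rn_pi (tensRF b c) = Rn_pi (tensRF b 1) * cstR c.
Proof. by rewrite /cstR -rmorphM tens_mul mulr1 mul1r. Qed.

Lemma XR_scale (a : k) (p : {poly k}) :
  XR (a *: p) = cstR (const_ratfun a^-1) * XR p.
Proof.
by rewrite /XR linearZ /= /XV recipZ tensM tens_cst mulrC mulr1.
Qed.

Lemma vec_neq0 (p : {poly k}) : (size p <= n * r)%N -> p != 0 -> vec r n p != 0.
Proof. by move=> pn; apply: contraNneq => /(vec_eq0 n_gt0 pn) ->. Qed.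

Lemma XR_mul (p q : {poly k}) : (size p <= n * r)%N -> (size q <= n * r)%N ->
  p != 0 -> q != 0 -> p != q -> XR p * XR q = XR (q - p) * (XR p - XR q).
Proof.
move=> pn qn p0 q0 pq; rewrite /XR /XV linearB /= -rmorphB -!rmorphM; congr Rn_pi.
have -> : tensRF (recip (vec r n p)) 1 - tensRF (recip (vec r n q)) 1 =
    tensRF (recip (vec r n p) - recip (vec r n q)) 1.
  by apply/eqP; rewrite subr_eq -tensDl subrK.
rewrite !tens_mul recipM ?vec_neq0 //.
rewrite -subr_eq0 -linearB; apply: vec_neq0; last by rewrite subr_eq0.
apply: leq_trans (size_polyD _ _) _.
by rewrite size_polyN geq_max pn.
Qed.

Lemma XR_torsion nu (p : {poly k}) :
  (nu <= n)%N -> (size p <= n * r)%N -> (nu * r < size p)%N ->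
  cstR (@tF k ^+ nu) * XR (drop_poly (nu * r) p) = \sum_(u <- polys k (nu * r)) XR (p - u).
Proof.
move=> nun pn nup; pose a : {poly k} := 1 *: 'X^nu.
pose S := \sum_(v' : V | v' \in Vsub nu) tensRF (recip (vec r n p - v')) 1.
have rel : Rn_rel (tensRF (recip (Vn_act a (vec r n p))) a%:F - S).
  exists 1, nu, (vec r n p); split=> //; first exact: oner_neq0.
  by rewrite vec_Vsub // -ltnNge.
have e : Rn_pi (tensRF (recip (Vn_act a (vec r n p))) a%:F) = Rn_pi S.
  by move: (Rn_pi_rel rel); rewrite rmorphB => /eqP; rewrite subr_eq0 => /eqP.
have aE : a = 'X^nu by rewrite /a scale1r.
rewrite tens_cst aE vec_actXn // tofracXn mulrC in e.
rewrite -[LHS]/(cstR (('X : {poly k})%:F ^+ nu) * Rn_pi (tensRF (recip (vec r n (drop_poly (nu * r) p))) 1)).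
rewrite e /S rmorph_sum (sum_Vsub n_gt0 (fun v' => Rn_pi (tensRF (recip (vec r n p - v')) 1))) //.
by apply: eq_bigr => u _; rewrite /XR linearB.
Qed.

Lemma Rn_generated (P : set (Rn k r n)) : P 1 -> (forall x y, P x -> P y -> P (x - y)) ->
  (forall x y, P x -> P y -> P (x * y)) -> (forall c, P (cstR c)) ->
  (forall p : {poly k}, p != 0 -> (size p <= n * r)%N -> P (XR p)) -> forall x, P x.
Proof.
move=> P1 PB PM Pc PX x; have [z ->] := Rn_pi_surj x.
elim/tensor_ind: z => [b c|z w Pz Pw]; last by rewrite rmorphB; apply: PB.
rewrite tens_cst; apply: (PM) => // {c}.
have /asboolP H := valP b.
have [|b' /val_inj -> //] := H [set y | exists2 b' : recip_ring V,
  val b' = y & P (Rn_pi (tensRF b' 1))].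
have tensB b1 b2 : tensRF (b1 - b2) 1 = tensRF b1 1 - tensRF b2 1.
  by apply/eqP; rewrite eq_sym subr_eq -tensDl subrK.
split=> [|y].
  split=> [|y w|y w]; rewrite !inE.
  - by exists 1 => //; rewrite tens1 rmorph1.
  - move=> [b1 <- P1'] [b2 <- P2']; exists (b1 - b2); first by rewrite rmorphB.
    by rewrite tensB rmorphB; apply: PB.
  - move=> [b1 <- P1'] [b2 <- P2']; exists (b1 * b2); first by rewrite rmorphM.
    have -> : tensRF (b1 * b2) 1 = tensRF b1 1 * tensRF b2 1 by rewrite tens_mul mulr1.
    by rewrite rmorphM; apply: PM.
case=> [[c _ <-]|[v /= v0 <-]].
  exists (recip_const V c) => //; rewrite -[recip_const V c]mulr1 tensM.
  by rewrite mulr1; apply: Pc.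
exists (recip v) => //; have [p pn ve] := vec_surj n_gt0 v.
have p0 : p != 0 by apply: contraNneq v0 => p0; rewrite ve p0 linear0.
by have := PX p p0 pn; rewrite /XR /XV -ve.
Qed.

Section Hom.
Variables (T : comNzRingType) (thF : {rmorphism F -> T}).
Variables (la mu : {poly k} -> T).
Hypothesis laD : forall p q, la (p + q) = la p + la q.
Hypothesis laZ : forall a p, la (a *: p) = thF (const_ratfun a) * la p.
Hypothesis la_mu : forall p : {poly k}, p != 0 -> (size p <= n * r)%N -> la p * mu p = 1.
Hypothesis mu_tor : forall nu (p : {poly k}),
  (nu <= n)%N -> (size p <= n * r)%N -> (nu * r < size p)%N ->
  thF (@tF k ^+ nu) * mu (drop_poly (nu * r) p) = \sum_(u <- polys k (nu * r)) mu (p - u).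

Definition unvec (v : V) : {poly k} := projT1 (cid2 (vec_surj n_gt0 v)).

Lemma unvecP v : (size (unvec v) <= n * r)%N /\ vec r n (unvec v) = v.
Proof. by rewrite /unvec; case: cid2 => p /= pn <-. Qed.

Lemma vecK (p : {poly k}) : (size p <= n * r)%N -> unvec (vec r n p) = p.
Proof.
move=> pn; have [un uv] := unvecP (vec r n p).
apply/eqP; rewrite -subr_eq0; apply/eqP/(vec_eq0 (k := k) (r := r) n_gt0); last first.
  by rewrite linearB /= uv subrr.
by apply: leq_trans (size_polyD _ _) _; rewrite size_polyN geq_max un.
Qed.

Lemma unvecD u v : unvec (u + v) = unvec u + unvec v.
Proof.
have [un uv] := unvecP u; have [vn vv] := unvecP v.
rewrite -{1}uv -{1}vv -linearD vecK //.
by apply: leq_trans (size_polyD _ _) _; rewrite geq_max un.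
Qed.

Lemma unvecZ a v : unvec (a *: v) = a *: unvec v.
Proof.
have [vn vv] := unvecP v; rewrite -{1}vv -linearZ vecK //.
by apply: leq_trans (size_scale_leq _ _) _.
Qed.

Lemma unvec_neq0 v : v != 0 -> unvec v != 0.
Proof.
by apply: contraNneq => v0; have [_ <-] := unvecP v; rewrite v0 linear0.
Qed.

Let thk : {rmorphism k -> T} := thF \o @const_ratfun k.
Let la' (v : V) := la (unvec v).
Let mu' (v : V) := mu (unvec v).

Let la'D u v : la' (u + v) = la' u + la' v.
Proof. by rewrite /la' unvecD laD. Qed.
Let la'Z a v : la' (a *: v) = thk a * la' v.
Proof. by rewrite /la' unvecZ laZ. Qed.
Let la'_mu' v : v != 0 -> la' v * mu' v = 1.
Proof. by move=> v0; rewrite la_mu ?unvec_neq0 //; have [] := unvecP v. Qed.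

Let phi : {rmorphism recip_ring V -> T} := recip_lift la'D la'Z la'_mu'.

Let phi_recip (p : {poly k}) : p != 0 -> (size p <= n * r)%N -> phi (recip (vec r n p)) = mu p.
Proof.
move=> p0 pn; rewrite /phi /= recip_lift_recip ?vec_neq0 //.
by rewrite /mu' vecK.
Qed.

Let phi_const a : phi (recip_const V a) = thF (const_ratfun a).
Proof. exact: recip_lift_const. Qed.

Let tphi := tensor_hom (f := @recip_const k V) (g := @const_ratfun k) phi thF.

Let tphi_tens b c : tphi (tensRF b c) = phi b * thF c.
Proof. exact: tensor_hom_tens phi_const _ _. Qed.

Let tphiB : zmod_morphism tphi. Proof. exact: tensor_hom_is_zmod_morphism phi_const. Qed.

(** The scalar alpha cancels between the reciprocal and the second tensor factor, which leaves the
    relation [mu_tor] for t^nu. *)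
Let tphi_rel x : Rn_rel x -> tphi x = 0.
Proof.
have tphi0 : tphi 0 = 0 by rewrite -(subrr 0) tphiB subrr.
have tphiN u : tphi (- u) = - tphi u by rewrite -sub0r tphiB tphi0 sub0r.
have tphiD u v : tphi (u + v) = tphi u + tphi v.
  by rewrite -[v]opprK tphiB tphiN !opprK.
move=> [a [nu [v [a0 nun nV ->]]]] /=.
rewrite tphiB (big_morph tphi tphiD tphi0) tphi_tens.
have [pn ve] := unvecP v; set p := unvec v in pn ve.
rewrite -ve vec_Vsub // -ltnNge in nV.
have dE : Vn_act (a *: 'X^nu) v = vec r n (a *: drop_poly (nu * r) p).
  by rewrite -mul_polyC Vn_actM -ve vec_actXn // Vn_actC linearZ.
have dn : (size (drop_poly (nu * r) p) <= n * r)%N.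
  by rewrite size_drop_poly (leq_trans (leq_subr _ _)).
have d0 : drop_poly (nu * r) p != 0 by rewrite -size_poly_gt0 size_drop_poly subn_gt0.
rewrite dE linearZ /= recipZ rmorphM phi_const phi_recip //.
rewrite (sum_Vsub n_gt0 (fun v' => tphi (tensRF (recip (v - v')) 1))) //.
rewrite (eq_big_seq (fun u => mu (p - u))) => [|u]; last first.
  rewrite mem_polys => un; rewrite tphi_tens rmorph1 mulr1 -ve -linearB phi_recip //.
    by rewrite -size_poly_gt0 size_polyDl ?size_polyN ?(leq_ltn_trans un) // (leq_ltn_trans _ nV).
  by rewrite size_polyDl ?size_polyN ?(leq_ltn_trans un).
rewrite -mu_tor // -mul_polyC tofracM tofracXn rmorphM -/(const_ratfun a).
apply/eqP; rewrite subr_eq0; apply/eqP.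
transitivity (thF (const_ratfun a^-1) * thF (const_ratfun a) *
   (thF (tF k ^+ nu) * mu (drop_poly (nu * r) p))); first by rewrite /tF; ring.
by rewrite -!rmorphM mulVf // !rmorph1 mul1r.
Qed.

Definition Rn_hom : Rn k r n -> T := quot_hom (S := @Rn_rel k r n) tphi.

Let tphiM : monoid_morphism tphi. Proof. exact: tensor_hom_is_monoid_morphism phi_const. Qed.

Lemma Rn_hom_is_zmod_morphism : zmod_morphism Rn_hom.
Proof. exact: quot_hom_is_zmod_morphism tphiB tphiM tphi_rel. Qed.

Lemma Rn_hom_is_monoid_morphism : monoid_morphism Rn_hom.
Proof. exact: quot_hom_is_monoid_morphism tphiB tphiM tphi_rel. Qed.

HB.instance Definition _ := GRing.isZmodMorphism.Build (Rn k r n) T Rn_hom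
  Rn_hom_is_zmod_morphism.
HB.instance Definition _ := GRing.isMonoidMorphism.Build (Rn k r n) T Rn_hom
  Rn_hom_is_monoid_morphism.

Lemma Rn_hom_cst c : Rn_hom (cstR c) = thF c.
Proof.
by rewrite /Rn_hom /cstR /Rn_pi (quot_hom_pi tphiB tphiM tphi_rel) tphi_tens rmorph1 mul1r.
Qed.

Lemma Rn_hom_X (p : {poly k}) : p != 0 -> (size p <= n * r)%N -> Rn_hom (XR p) = mu p.
Proof.
move=> p0 pn; rewrite /Rn_hom /XR /XV /Rn_pi (quot_hom_pi tphiB tphiM tphi_rel) tphi_tens.
by rewrite rmorph1 mulr1 phi_recip.
Qed.

Lemma Rn_hom_exists : exists Psi : {rmorphism Rn k r n -> T},
  (forall c, Psi (cstR c) = thF c) /\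
  forall p : {poly k}, p != 0 -> (size p <= n * r)%N -> Psi (XR p) = mu p.
Proof. by exists Rn_hom; split; [exact: Rn_hom_cst | exact: Rn_hom_X]. Qed.

End Hom.

End RnFacts.

(** * The homomorphism from R_n to the tower *)

Section TowerPoint.
Variables (k : finFieldType) (r n : nat).
Hypothesis n_gt0 : (0 < n)%N.
Local Notation F := {fraction {poly k}}.
Local Notation L := (ratfuns k r).
Variable f : 'I_r -> {poly F}.
Hypothesis f_monic : forall j, f j \is monic.
Hypothesis f_size : forall j, (1 < size (f j))%N.

(** This identity of exponents makes the two counts agree: (n-1) r equations of degree q^r
    contribute q^((n-1) r) for each of the r values l < r, raising q^l to q^((n-1) r + l). *)
Lemma prod_ydegree :
  (\prod_(l < n * r) ydegree k r l = \prod_(i <- iota (n.-1 * r) r) #|k| ^ i)%N.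
Proof.
have e : (n * r = r + n.-1 * r)%N by rewrite -mulSn prednK.
rewrite e big_split_ord /= [X in (X * _)%N](eq_bigr (fun i : 'I_r => (#|k| ^ i)%N)); last first.
  by move=> i _; rewrite /ydegree ltn_ord.
rewrite [X in (_ * X)%N](eq_bigr (fun=> (#|k| ^ r)%N)); last first.
  by move=> i _; rewrite /ydegree ltnNge leq_addr.
rewrite prod_nat_const card_ord -expnM.
have -> : iota (n.-1 * r) r = [seq (n.-1 * r + j)%N | j <- iota 0 r].
  by rewrite -iotaDl addn0.
rewrite big_map -(subn0 r) -/(index_iota 0 r) subn0 big_mkord.
under [RHS]eq_bigr => i _ do rewrite expnD.
by rewrite big_split /= prod_nat_const card_ord -expnM mulnC [(r * _)%N]mulnC.
Qed.

Definition tower_point (T : comNzRingType) (theta : {rmorphism L -> T})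
    (Y y : nat -> T) (mu : {poly k} -> T) (Psi : {rmorphism Rn k r n -> T}) :=
  [/\ forall c, Psi (cstR r n c) = theta (cL r c),
      forall p : {poly k}, p != 0 -> (size p <= n * r)%N ->
        Psi (XR r n p) = mu p /\ lam (n * r) (theta \o kL k r) y p * mu p = 1,
      forall l : 'I_r, (map_poly (theta \o cL r) (f l)).[Y l] = theta (Zvar k l),
      forall l : 'I_r, \sum_(p <- monics k (n.-1 * r + l)) mu p = Y l &
      stage theta (gens Y y r (n * r))
        ((\prod_(l < r) (size (f l)).-1) * \prod_(i <- iota (n.-1 * r) r) #|k| ^ i)%N].

Lemma tower_point_exists : exists (T : comNzRingType) (theta : {rmorphism L -> T})
    (Y y : nat -> T) (mu : {poly k} -> T) (Psi : {rmorphism Rn k r n -> T}),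
  tower_point theta Y y mu Psi.
Proof.
have [T [theta [Y [Yi [y [HY Hy st]]]]]] := tower_y f_monic f_size (leqnn (n * r)).
rewrite prod_ydegree in st.
pose thF : {rmorphism F -> T} := theta \o cL r.
pose thk : {rmorphism k -> T} := theta \o kL k r.
pose t := thF (tF k); pose ti := thF (tF k)^-1.
have tti : t * ti = 1 by rewrite /t /ti -rmorphM mulfV ?tF_neq0 // rmorph1.
have HY' i : (i < r)%N -> Y i * Yi i = 1 by move=> ir; have [_] := HY (Ordinal ir).
have rM : (r <= n * r)%N by rewrite leq_pmull.
have Hlow i : (i < r)%N -> epol (n * r) thk y i (y i) = ecoef (n * r) thk y i * t ^+ n.-1 * Yi i.
  by move=> ir; have := Hy i (leq_trans ir rM); rewrite /ydata ir => ->; rewrite /t !rmorphXn.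
have Hhigh i : (r <= i)%N -> (i < n * r)%N ->
    epol (n * r) thk y r (y i) = ti * ecoef (n * r) thk y r * y (i - r)%N.
  by move=> ri iM; have := Hy i iM; rewrite /ydata ltnNge ri.
have lam_inv := lam_invertible (erefl (n * r)%N) n_gt0 tti HY' Hlow Hhigh.
have ex (p : {poly k}) : exists v, p != 0 -> (size p <= n * r)%N ->
    lam (n * r) thk y p * v = 1.
  have [p0|p0] := eqVneq p 0; first by exists 0.
  have [pn|pn] := leqP (size p) (n * r); last by exists 0.
  by have [v e] := lam_inv p p0 pn; exists v.
have [mu Hmu] := choice ex.
have tor := mu_torsion (erefl (n * r)%N) n_gt0 tti HY' Hlow Hhigh Hmu.
have tor' nu (p : {poly k}) : (nu <= n)%N -> (size p <= n * r)%N -> (nu * r < size p)%N ->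
    thF (tF k ^+ nu) * mu (drop_poly (nu * r) p) = \sum_(u <- polys k (nu * r)) mu (p - u).
  by move=> nun pn nup; rewrite rmorphXn; apply: tor.
have [Psi [Psi_cst Psi_X]] := Rn_hom_exists n_gt0 (thF := thF)
  (lamD (n * r) thk y) (lamZ (n * r) thk y) Hmu tor'.
exists T, theta, Y, y, mu, Psi; split.
- exact: Psi_cst.
- by move=> p p0 pn; split; [exact: Psi_X | exact: Hmu].
- by move=> l; have [] := HY l.
- move=> l; rewrite -(sum_monics_mu (erefl (n * r)%N) n_gt0 tti HY' Hlow Hmu (ltn_ord l)).
  pose N0 := (n.-1 * r)%N.
  have e : (N0 + r = n * r)%N by rewrite -mulSnr prednK.
  have wX w : w \in monics k l -> size (w * 'X^N0) = (N0 + l).+1 /\ w * 'X^N0 \is monic.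
    rewrite mem_monics => /andP[mw /eqP sw]; split; last by rewrite monicMr ?monicXn.
    by rewrite size_Mmonic ?monicXn ?monic_neq0 // sw size_polyXn addnC; lia.
  (* The torsion relation for t^(n-1) replaces a monic w of degree l by all w X^((n-1) r) - u with u
     of degree < (n-1) r. Together these run once through the monics of degree (n-1) r + l. *)
  have step w : w \in monics k l ->
      mu w * t ^+ n.-1 = \sum_(u <- polys k N0) mu (w * 'X^N0 - u).
    move=> wl; have [sw _] := wX w wl.
    rewrite -tor ?leq_pred ?sw //.
    + by rewrite drop_polyMXn_id mulrC.
    + by rewrite -e -addnS leq_add2l.
    + by rewrite ltnS leq_addr.
  rewrite (eq_big_seq _ step).
  rewrite -[RHS](big_allpairs_dep (h := fun w u : {poly k} => w * 'X^N0 - u) (F := mu)).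
  apply: perm_big; apply: uniq_perm => [||v]; first exact: monics_uniq.
    apply: allpairs_uniq; rewrite ?monics_uniq ?polys_uniq // => -[w u] [w' u'].
    move=> /allpairsP[[a b] [/= _ bl [-> ->]]] /allpairsP[[a' b'] [/= _ bl' [-> ->]]] /= ee.
    move: bl bl'; rewrite !mem_polys => bl bl'.
    have ea : a = a'.
      rewrite -[LHS](drop_polyDMXn (n := N0) (p := - b)) ?size_polyN //.
      by rewrite -[RHS](drop_polyDMXn (n := N0) (p := - b')) ?size_polyN // addrC ee addrC.
    by move: ee; rewrite ea => /addrI/oppr_inj ->.
  apply/idP/allpairsP => [|[[w u] [/= wl ul ->]]].
    rewrite mem_monics => /andP[mv /eqP sv].
    exists (drop_poly N0 v, - take_poly N0 v); split.
    + have sd : size (drop_poly N0 v) = l.+1 by rewrite size_drop_poly sv -addnS addKn.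
      rewrite mem_monics sd eqxx andbT monicE lead_coefE sd coef_drop_poly.
      by move: mv; rewrite monicE lead_coefE sv /= addnC.
    + by rewrite mem_polys size_polyN size_take_poly.
    + by rewrite /= opprK addrC poly_take_drop.
  have [sw mw] := wX w wl; rewrite mem_polys in ul.
  have su : (size (- u)%R < size (w * 'X^N0)%R)%N.
    by rewrite size_polyN sw ltnS (leq_trans ul) // leq_addr.
  by rewrite mem_monics monicE lead_coefDl // (monicP mw) size_polyDl // sw !eqxx.
- exact: st.
Qed.

End TowerPoint.

(** * Freeness of R_n and the Cohen-Macaulay property *)

Section MainTheorem.
Variables (k : finFieldType) (r n : nat) (hn : (0 < n)%N).
Local Notation F := {fraction {poly k}}.

(* The proof that 1 != 0 in R_n uses n > 0, which is therefore made a parameter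
   of this alias. *)
Definition RnN : Type := let _ := hn in Rn k r n.
HB.instance Definition _ := GRing.ComPzRing.on RnN.

(** The tower is a nonzero ring receiving a homomorphism from R_n; f_j = X is one admissible choice
    for building it. *)
Lemma RnN_nonzero : (1 : RnN) != 0.
Proof.
have [T [theta [Y [y [mu [Psi _]]]]]] := tower_point_exists hn
  (f := fun _ : 'I_r => 'X : {poly F}) (fun=> monicX _) (fun=> eq_leq (esym (size_polyX _))).
apply/eqP => /(congr1 (Psi : Rn k r n -> T)); rewrite rmorph0 rmorph1 => /eqP.
by rewrite oner_eq0.
Qed.

HB.instance Definition _ := GRing.PzSemiRing_isNonZero.Build RnN RnN_nonzero.

Let cst : {rmorphism F -> RnN} := cstR r n : {rmorphism F -> Rn k r n}.
Let X : {poly k} -> RnN := @XR k r n.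

Lemma RnN_free (f : 'I_r -> {poly F}) :
    (forall j, f j \is monic) -> (forall j, (1 < size (f j))%N) ->
  exists D (G : 'I_D -> RnN),
    free_basis cst (fun j => poly_eval cst (Ytop n X j) (f j)) G.
Proof.
move=> f_monic f_size.
have [T [theta [Y [y [mu [Psi [Hcst HX HY Hsum st]]]]]]] :=
  tower_point_exists hn f_monic f_size.
pose Psi' : {rmorphism RnN -> T} := Psi.
exists (size (spanning_list n X f)), (fun b => (spanning_list n X f)`_b).
have PsiY (l : 'I_r) : Psi' (Ytop n X l) = Y l.
  rewrite /Ytop /top_sum rmorph_sum -Hsum; apply: eq_big_seq => p.
  rewrite mem_monics => /andP[mp /eqP sp].
  have e : (n.-1 * r + r = n * r)%N by rewrite -mulSnr prednK.
  by have [|-> //] := HX p (monic_neq0 mp); rewrite sp -e -addnS leq_add2l.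
apply: (@stage_free_basis k r _ RnN T cst theta Psi' _ _ _ _ _ (gens Y y r (n * r))).
- move=> x; apply: spanning_family.
  + exact: hn.
  + by move=> a p _; exact: XR_scale.
  + exact: (XR_mul hn).
  + exact: (XR_torsion hn).
  + exact: (Rn_generated hn).
  + exact: f_monic.
  + exact: f_size.
- exact: Hcst.
- move=> j; rewrite /poly_eval -horner_map -map_poly_comp PsiY -HY.
  congr (_.[_]); apply: eq_map_poly => c; exact: Hcst.
- by rewrite size_spanning_list.
move=> P Psub Ptheta PPsi Pinv x [[l lr ->]|[l lM ->]].
  by rewrite -(PsiY (Ordinal lr)); apply: PPsi.
have Xl0 : ('X^l : {poly k}) != 0 by rewrite -size_poly_gt0 size_polyXn.
have Xln : (size ('X^l : {poly k}) <= n * r)%N by rewrite size_polyXn.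
have [e1 e2] := HX _ Xl0 Xln.
rewrite -(lamXn (theta \o kL k r) y lM).
(* The point y_l is recovered as the inverse of the image of the generator 1/X^l of R_n, hence the
   closure under inverses. *)
by apply: (Pinv (mu 'X^l)); [rewrite mulrC | rewrite -e1; apply: PPsi].
Qed.

Lemma RnN_cohen_macaulay : cohen_macaulay RnN.
Proof.
apply: (cohen_macaulay_criterion (cst := cst) (Y := @Ytop k RnN n r X)
  (zs := [seq X p | p <- polys k (n * r)])).
  move=> P P1 PB PM Pc Px; apply: (Rn_generated hn) => // p p0 pn.
  by apply: Px; apply: map_f; rewrite mem_polys.
by move=> f; apply: RnN_free.
Qed.

End MainTheorem.

Theorem theorem3p3p3 (Fq : finFieldType) (n r : nat) (hn : (1 <= n)%N)
    (hr : (1 <= r)%N) :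
  cohen_macaulay (Rn Fq r n).
Proof. exact: (RnN_cohen_macaulay Fq r hn). Qed.
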